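(* Let $(M,I,J,K,g)$ be a compact, connected hyperKähler manifold of real dimension $4n$, with associated form $\Omega=\omega_J-\mathfrak{i}\,\omega_K$, and let $f\in C^\infty(M)$ be a real function. There exists a constant $C$, depending only on $f$, $\sup_M|\phi|$ and the hyperhermitian structure $(I,J,K,g)$, such that every smooth real solution $\phi$ of the quaternionic Monge-Ampère equation $$(\Omega+\partial\partial_J\phi)^n=e^f\,\Omega^n,\qquad \Omega+\partial\partial_J\phi>0,$$ satisfies $$|\partial\partial_J\phi|_g\le C\quad\text{on } M .$$ (That is: for every $B\ge 0$ there is $C=C(f,B,I,J,K,g)$ such that the estimate holds for all smooth real solutions $\phi$ with $\sup_M|\phi|=B$.)
   Context: A hypercomplex manifold $(M,I,J,K)$ is a smooth manifold of real dimension $4n$ with three (integrable) complex structures $I,J,K$ satisfying $I\circ J\circ K=-\mathrm{id}_{TM}$. Convention: endomorphisms act on tangent vectors from the right, so $X(IJ)=(XI)J$ and $K=IJ$; an endomorphism field $L$ acts on complex $k$-forms by $(L\alpha)(X_1,\dots,X_k)=\alpha(X_1L,\dots,X_kL)$, and acts trivially on functions. Bidegrees and the Dolbeault operators $\partial,\overline\partial$ are taken with respect to $I$. The operator $\partial_J$ is $\partial_J:=J^{-1}\circ\overline\partial\circ J$, which maps $\Lambda^{p,q}_I(M)$ to $\Lambda^{p+1,q}_I(M)$. A Riemannian metric $g$ on $(M,I,J,K)$ is hyperhermitian if it is Hermitian with respect to $I$, $J$ and $K$. For $L\in\{I,J,K\}$ put $\omega_L(X,Y)=g(XL,Y)$,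 and put $\Omega=\omega_J-\mathfrak{i}\,\omega_K$, where $\mathfrak{i}$ is the imaginary unit; $\Omega$ is of type $(2,0)$ with respect to $I$ and is $J$-real, i.e. $J\Omega=\overline\Omega$. For a $J$-real $(2,0)$-form $\Psi$, $\Psi>0$ means $\Psi(z,\bar zJ)>0$ for every nonzero $z\in T^{1,0}_IM$. The metric $g$ is hyperKähler if $d\omega_I=d\omega_J=d\omega_K=0$ (equivalently $d\Omega=0$). $|\cdot|_g$ is the pointwise norm on complex-valued forms induced by $g$. *)

(* Defs.v *)
From HB Require Import structures.
From mathcomp Require Import all_boot all_order all_algebra all_fingroup.
From mathcomp Require Import complex.
From mathcomp Require Import all_classical all_reals all_analysis.

Set Implicit Arguments.
Unset Strict Implicit.
Unset Printing Implicit Defensive.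

Import Order.TTheory GRing.Theory Num.Theory.
Import numFieldNormedType.Exports.

Local Open Scope classical_set_scope.
Local Open Scope ring_scope.

(* Geometry is done in charts.  A vector is a row vector, so that an
   endomorphism acts on it from the right, by X *m L.  Tensor fields on a
   manifold are families of local expressions, one for each chart, related by
   the Jacobians of the transition maps; only the values on the image of the
   chart are meaningful.                                                      *)

Section Smoothness.
Variables (R : realType) (m : nat).
Implicit Types (U : set 'rV[R]_m).

Fixpoint Ck (k : nat) U (u : 'rV[R]_m -> R) : Prop :=
  (forall y, U y -> {for y, continuous u}) /\
  if k is k'.+1 then
    forall j : 'I_m, (forall y, U y -> derivable u y (delta_mx 0 j)) /\
                     Ck k' U (fun y => 'D_(delta_mx 0 j) u y)
  else True.

Definition smooth_on U (u : 'rV[R]_m -> R) : Prop := forall k, Ck k U u.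

Definition smooth_mx_on p q U (u : 'rV[R]_m -> 'M[R]_(p, q)) : Prop :=
  forall i j, smooth_on U (fun y => u y i j).

Definition lie_bracket (X Y : 'rV[R]_m -> 'rV[R]_m) (y : 'rV[R]_m) : 'rV[R]_m :=
  'D_(X y) Y y - 'D_(Y y) X y.

Definition nijenhuis (L : 'rV[R]_m -> 'M[R]_m) (X Y : 'rV[R]_m -> 'rV[R]_m)
    (y : 'rV[R]_m) : 'rV[R]_m :=
  let XL z := X z *m L z in
  let YL z := Y z *m L z in
  lie_bracket XL YL y - lie_bracket XL Y y *m L y
    - lie_bracket X YL y *m L y - lie_bracket X Y y.

End Smoothness.

(* A smooth manifold of dimension m, with a smooth atlas indexed by [chart];
   [param a] is the inverse of the homeomorphism [chart_coord a].                   *)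
Record manifold (R : realType) (m : nat) := Manifold {
  carrier :> topologicalType;
  chart : Type;
  dom : chart -> set carrier;
  chart_coord : chart -> carrier -> 'rV[R]_m;
  param : chart -> 'rV[R]_m -> carrier;
  manifold_hausdorff : hausdorff_space carrier;
  manifold_second_countable : @second_countable carrier;
  dom_cover : forall x, exists a, dom a x;
  dom_open : forall a, open (dom a);
  chart_im_open : forall a, open (chart_coord a @` dom a);
  chart_coord_continuous : forall a x, dom a x -> {for x, continuous (chart_coord a)};
  param_continuous :
    forall a y, (chart_coord a @` dom a) y -> {for y, continuous (param a)};
  chart_coordK : forall a x, dom a x -> param a (chart_coord a x) = x;
  transition_smooth : forall a b,
    smooth_mx_on (chart_coord a @` (dom a `&` dom b)) (chart_coord b \o param a)
}.

Section Tensors.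
Variables (R : realType) (m : nat) (M : manifold R m).

Definition chart_im (a : chart M) : set 'rV[R]_m := chart_coord a @` dom a.

Definition smooth_fun (u : M -> R) : Prop :=
  forall a, smooth_on (chart_im a) (u \o param a).

Definition matrix_field := chart M -> 'rV[R]_m -> 'M[R]_m.

Definition transition_jacobian (a b : chart M) (x : M) : 'M[R]_m :=
  jacobian (chart_coord b \o param a) (chart_coord a x).

Definition smooth_field (T : matrix_field) : Prop :=
  forall a, smooth_mx_on (chart_im a) (T a).

Definition endomorphism_field (L : matrix_field) : Prop :=
  smooth_field L /\
  forall a b x, dom a x -> dom b x ->
    L a (chart_coord a x) *m transition_jacobian a b x
    = transition_jacobian a b x *m L b (chart_coord b x).

Definition bilinear_field (T : matrix_field) : Prop :=
  smooth_field T /\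
  forall a b x, dom a x -> dom b x ->
    T a (chart_coord a x) = transition_jacobian a b x *m T b (chart_coord b x)
                        *m (transition_jacobian a b x)^T.

Definition complex_structure (L : matrix_field) : Prop :=
  [/\ endomorphism_field L,
      forall a y, chart_im a y -> L a y *m L a y = - 1%:M
    & forall a (X Y : 'rV[R]_m -> 'rV[R]_m),
        smooth_mx_on (chart_im a) X -> smooth_mx_on (chart_im a) Y ->
        forall y, chart_im a y -> nijenhuis (L a) X Y y = 0].

Definition hypercomplex (I J K : matrix_field) : Prop :=
  [/\ complex_structure I, complex_structure J, complex_structure K
    & forall a y, chart_im a y -> I a y *m J a y *m K a y = - 1%:M].

Definition riemannian (g : matrix_field) : Prop :=
  [/\ bilinear_field g,
      forall a y, chart_im a y -> (g a y)^T = g a y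
    & forall a y, chart_im a y ->
        forall X : 'rV[R]_m, X != 0 -> 0 < (X *m g a y *m X^T) 0 0].

Definition hermitian_metric (L g : matrix_field) : Prop :=
  forall a y, chart_im a y -> L a y *m g a y *m (L a y)^T = g a y.

Definition hyperhermitian (I J K g : matrix_field) : Prop :=
  [/\ hermitian_metric I g, hermitian_metric J g & hermitian_metric K g].

End Tensors.

(* Complex-valued forms on an open set of R^m, as functions of complexified
   tangent vectors.                                                           *)
Section Forms.
Variables (R : realType) (m : nat).
Local Notation C := R[i].
Local Notation pt := ('rV[R]_m).
Local Notation vec := ('rV[C]_m).

Definition kform (k : nat) := ('I_k -> vec) -> C.
Definition kform_field (k : nat) := pt -> kform k.

Definition cplx p q (A : 'M[R]_(p, q)) : 'M[C]_(p, q) :=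
  map_mx (real_complex R) A.

Definition fun_form (u : pt -> R) : kform_field 0 :=
  fun y _ => real_complex R (u y).

Definition mx_form (W : 'M[C]_m) : kform 2 :=
  fun X => (X ord0 *m W *m (X ord_max)^T) 0 0.

Definition cderive (F : pt -> C) (y : pt) (v : vec) : C :=
  \sum_(j < m) v 0 j *
    Complex ('D_(delta_mx 0 j) (fun z => complex.Re (F z)) y)
            ('D_(delta_mx 0 j) (fun z => complex.Im (F z)) y).

(* The bracket terms of the invariant formula vanish, since the X_s are
   extended as constant vector fields of the chart.                           *)
Definition ext_d k (alpha : kform_field k) : kform_field k.+1 :=
  fun y X => \sum_(s < k.+1) (-1) ^+ s *
    cderive (fun z => alpha z (fun t => X (lift s t))) y (X s).

Definition wedge k l (alpha : kform k) (beta : kform l) : kform (k + l) :=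
  fun X => (k`! * l`!)%:R^-1 *
    \sum_(s : 'S_(k + l)) (-1) ^+ odd_perm s *
      (alpha (fun t => X (s (lshift l t))) * beta (fun t => X (s (rshift k t)))).

Fixpoint wedge_pow k (alpha : kform k) (n : nat) : kform (n * k) :=
  if n is n'.+1 then wedge alpha (@wedge_pow k alpha n') else fun _ => 1.

Definition endo_act k (L : 'M[R]_m) (alpha : kform k) : kform k :=
  fun X => alpha (fun t => X t *m cplx L).

Definition proj10 (L : 'M[R]_m) (z : vec) : vec :=
  2^-1 *: (z - 'i%C *: (z *m cplx L)).
Definition proj01 (L : 'M[R]_m) (z : vec) : vec :=
  2^-1 *: (z + 'i%C *: (z *m cplx L)).

(* The component of bidegree (p, k - p) of a k-form.                          *)
Definition bidegree k (p : nat) (L : 'M[R]_m) (alpha : kform k) : kform k :=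
  fun X => \sum_(S : {set 'I_k} | #|S| == p)
    alpha (fun t => if t \in S then proj10 L (X t) else proj01 L (X t)).

Section Dolbeault.
Variables (I J : pt -> 'M[R]_m).

Definition del k (alpha : kform_field k) : kform_field k.+1 :=
  fun y X => \sum_(p < k.+1)
    bidegree p.+1 (I y) (ext_d (fun z => bidegree p (I z) (alpha z)) y) X.

Definition delbar k (alpha : kform_field k) : kform_field k.+1 :=
  fun y X => \sum_(p < k.+1)
    bidegree p (I y) (ext_d (fun z => bidegree p (I z) (alpha z)) y) X.

Definition del_J k (alpha : kform_field k) : kform_field k.+1 :=
  fun y => endo_act (invmx (J y))
             (delbar (fun z => endo_act (J z) (alpha z)) y).

Definition del_del_J (u : pt -> R) : kform_field 2 := del (del_J (fun_form u)).

End Dolbeault.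

Definition positive20 (I J : 'M[R]_m) (Psi : kform 2) : Prop :=
  forall z : vec, z *m cplx I = 'i%C *: z -> z != 0 ->
    0 < Psi (tnth [tuple z; map_mx conjc z *m cplx J]).

(* Normalised so that wedges of distinct covectors of an orthonormal coframe
   have norm 1.                                                               *)
Definition form_norm k (g : 'M[R]_m) (alpha : kform k) : R :=
  let e (i : {ffun 'I_k -> 'I_m}) : 'I_k -> vec := fun t => delta_mx 0 (i t) in
  Num.sqrt (complex.Re ((k`!)%:R^-1 *
    \sum_(i : {ffun 'I_k -> 'I_m}) \sum_(j : {ffun 'I_k -> 'I_m})
      (\prod_(t < k) cplx (invmx g) (i t) (j t)) *
      (alpha (e i) * conjc (alpha (e j))))).

End Forms.

Arguments wedge_pow {R m k} alpha n X.

Section HyperKahler.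
Variables (R : realType) (m : nat) (M : manifold R m).
Implicit Types (I J K L g : matrix_field M) (a : chart M) (y : 'rV[R]_m).

Definition fund_form L g a : kform_field R m 2 :=
  fun y => mx_form (cplx (L a y *m g a y)).

Definition Omega J K g a : kform_field R m 2 :=
  fun y X => fund_form J g a y X - 'i%C * fund_form K g a y X.

Definition closed_form k (alpha : chart M -> kform_field R m k) : Prop :=
  forall a y, chart_im a y -> forall X, ext_d (alpha a) y X = 0.

Definition hyperkahler I J K g : Prop :=
  [/\ closed_form (fund_form I g), closed_form (fund_form J g)
    & closed_form (fund_form K g)].

Definition hessian_form I J (phi : M -> R) a : kform_field R m 2 :=
  del_del_J (I a) (J a) (phi \o param a).

Definition perturbed_form I J K g (phi : M -> R) a : kform_field R m 2 :=
  fun y X => Omega J K g a y X + hessian_form I J phi a y X.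

Definition quaternionic_MA (n : nat) I J K g (f phi : M -> R) : Prop :=
  forall a y, chart_im a y ->
    (forall X, wedge_pow (perturbed_form I J K g phi a y) n X
       = real_complex R (expR (f (param a y)))
           * wedge_pow (Omega J K g a y) n X) /\
    positive20 (I a y) (J a y) (perturbed_form I J K g phi a y).

End HyperKahler.

(* Main.v *)
From HB Require Import structures.
From mathcomp Require Import all_boot all_order all_algebra all_fingroup.
From mathcomp Require Import complex.
From mathcomp Require Import all_classical all_reals all_analysis.
From mathcomp Require Import ring lra zify.
Require Import Defs.

Set Implicit Arguments.
Unset Strict Implicit.
Unset Printing Implicit Defensive.

Import Order.TTheory GRing.Theory Num.Theory.
Import numFieldNormedType.Exports.

Local Open Scope classical_set_scope.
Local Open Scope ring_scope.

(* Work in a chart, with the Levi-Civita Hessian S of phi.  Let H be the average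
   of S over the quaternionic structure, and h = g + H.  Then
   \partial\partial_J phi is the form of (J - iK) H, the perturbed form is that of
   (J - iK) h, and h is positive definite.  In a quaternionic frame that is
   orthonormal for g and diagonalises h with eigenvalues lambda_1, ..., lambda_n,
   the equation reads \prod lambda_j = e^f, that is det h = e^{4f} det g.

   Since I, J, K are parallel, the curvature contracts to zero with every
   quaternion-invariant tensor, so that differentiating the equation twice gives,
   for v = \Delta phi = tr(g^-1 H), the exact inequality
   tr(h^-1 \nabla^2 v) >= 4 \Delta f, the third derivatives of phi contributing a
   square.  At a maximum of v - phi this yields
   4 \sum_j 1 / lambda_j = tr(h^-1 g) <= 4n - 4 \Delta f; with the product known,
   the lambda_j are bounded there.  Hence v is bounded above everywhere in terms
   of sup |phi|, and so are the lambda_j and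
   |\partial\partial_J phi|^2 = 4 \sum_j (lambda_j - 1)^2. *)

(** * Calculus of smooth functions *)

(** The obstacle is the order of covariant derivatives. Both \nabla^2 v and the twice differentiated
    equation contain \nabla^2 Hess phi contracted with g^-1 and h^-1, but with the two inverse
    metrics in exchanged positions. One commutation turns the gradient of each trace into a
    divergence, tr(P \nabla_k S) = \sum_i (P \nabla_i S)_ik; a second one exchanges the two outer
    derivatives. Every curvature term met on the way is contracted with g^-1 or h^-1, both
    quaternion-invariant, so the inequality carries no curvature constant. Subtracting phi from v
    adds tr(h^-1 (g - h)) = tr(h^-1 g) - 4n at the maximum, which is where the control of the
    inverse eigenvalues comes from. Frames are chosen at single points and never differentiated: the
    equation is differentiated through det h, so no regularity of the eigenvalues is involved. The
    maximum is taken over M, so v must not depend on the chart. This comes from writing it as -1/2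
    tr(g^-1 d(I d phi) I^T): an exterior derivative transforms with the Jacobian alone, and no
    transformation law for Christoffel symbols is required. *)

Section PartialDerivatives.
Variables (R : realType) (m : nat).
Implicit Types (U : set 'rV[R]_m) (u v : 'rV[R]_m -> R).

Definition pderiv (j : 'I_m) u : 'rV[R]_m -> R := fun y => 'D_(delta_mx 0 j) u y.

Lemma near_eq_on U u v y : open U -> U y -> (forall z, U z -> u z = v z) ->
  \near y, u y = v y.
Proof.
move=> oU Uy uv; have : nbhs y U by exact: open_nbhs_nbhs.
by apply: filterS => z /uv.
Qed.

Lemma pderiv_eq_on U u v y j : open U -> U y -> (forall z, U z -> u z = v z) ->
  pderiv j u y = pderiv j v y.
Proof. by move=> oU Uy uv; apply: near_eq_derive; exact: near_eq_on oU Uy uv. Qed.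

Lemma continuous_eq_on U u v y : open U -> U y -> (forall z, U z -> u z = v z) ->
  {for y, continuous u} -> {for y, continuous v}.
Proof.
move=> oU Uy uv uc; rewrite /prop_for /continuous_at -uv //.
have uvn : \forall z \near y, u z = v z by exact: near_eq_on uv.
exact: cvg_trans (near_eq_cvg uvn) uc.
Qed.

(** Openness of [U] makes derivatives at points of [U] depend only on values on [U]. Tensor fields
    mean nothing outside the image of a chart, so identities are known on [U] only and are
    differentiated through this principle. *)
Lemma Ck_eq_on k U u v : open U -> (forall z, U z -> u z = v z) ->
  Ck k U u -> Ck k U v.
Proof.
move=> oU; elim: k u v => [|k IH] u v uv /= [uc ud]; split=> //.
- by move=> y Uy; apply: continuous_eq_on oU Uy uv (uc y Uy).
- by move=> y Uy; apply: continuous_eq_on oU Uy uv (uc y Uy).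
- move=> j; split => [y Uy|].
    by apply: (near_eq_derivable _ ((ud j).1 y Uy)); exact: near_eq_on oU Uy uv.
  apply: IH (ud j).2 => z Uz; exact: pderiv_eq_on oU Uz uv.
Qed.

Lemma CkW k U u : Ck k.+1 U u -> Ck k U u.
Proof.
elim: k u => [|k IH] u [uc ud]; split=> // j.
by have [udj ukj] := ud j; split=> //; exact: IH.
Qed.

Lemma Ck_cst k U c : Ck k U (fun=> c).
Proof.
elim: k c => [|k IH] c; split=> //; try by move=> y _; exact: cst_continuous.
move=> j; split=> [y _|]; first exact: derivable_cst.
have -> : (fun y : 'rV[R]_m => 'D_(delta_mx 0 j) (fun=> c) y) = fun=> 0.
  by apply/funext => y; exact: derive_cst.
exact: IH.
Qed.

Lemma CkD k U u v : open U -> Ck k U u -> Ck k U v -> Ck k U (fun y => u y + v y).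
Proof.
move=> oU; elim: k u v => [|k IH] u v [uc ud] [vc vd]; split=> //;
  try by move=> y Uy; apply: continuousD; [exact: uc|exact: vc].
move=> j; have [[udj uk] [vdj vk]] := (ud j, vd j); split=> [y Uy|].
  by apply: derivableD; [exact: udj|exact: vdj].
apply: Ck_eq_on (IH _ _ uk vk) => // y Uy.
by rewrite -deriveD; [|exact: udj|exact: vdj].
Qed.

Lemma CkM k U u v : open U -> Ck k U u -> Ck k U v -> Ck k U (fun y => u y * v y).
Proof.
move=> oU; elim: k u v => [|k IH] u v uk vk.
  split=> // y Uy; apply: continuousM; [exact: uk.1|exact: vk.1].
have [[uc ud] [vc vd]] := (uk, vk); split=> //.
  by move=> y Uy; apply: continuousM; [exact: uc|exact: vc].
move=> j; have [[udj uk'] [vdj vk']] := (ud j, vd j); split=> [y Uy|].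
  by apply: derivableM; [exact: udj|exact: vdj].
apply: Ck_eq_on (CkD oU (IH _ _ (CkW uk) vk') (IH _ _ (CkW vk) uk')) => // y Uy.
by rewrite -[LHS](deriveM (udj _ Uy) (vdj _ Uy)).
Qed.

Lemma CkV k U u : open U -> (forall y, U y -> u y != 0) ->
  Ck k U u -> Ck k U (fun y => (u y)^-1).
Proof.
move=> oU u0; elim: k => [|k IH] uk.
  by split=> // y Uy; apply: continuousV; [exact: u0|exact: uk.1].
have [uc ud] := uk; split.
  by move=> y Uy; apply: continuousV; [exact: u0|exact: uc].
move=> j; have [udj uk'] := ud j; split=> [y Uy|].
  by apply: derivableV; [exact: u0|exact: udj].
have ik := IH (CkW uk).
apply: Ck_eq_on (CkM oU (Ck_cst k U (-1)) (CkM oU (CkM oU ik ik) uk')) => // y Uy.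
rewrite (deriveV (u0 _ Uy) (udj _ Uy)) expr2 invfM /GRing.scale /=; ring.
Qed.

Lemma smooth_onP U u : smooth_on U u ->
  (forall y, U y -> {for y, continuous u}) /\
  forall j, (forall y, U y -> derivable u y (delta_mx 0 j)) /\
            smooth_on U (pderiv j u).
Proof.
move=> su; split=> [|j]; first exact: (su 0).1.
by split=> [|k]; [have [_ /(_ j)[]] := su 1%N|have [_ /(_ j)[]] := su k.+1].
Qed.

Lemma smooth_eq_on U u v : open U -> (forall z, U z -> u z = v z) ->
  smooth_on U u -> smooth_on U v.
Proof. by move=> oU uv su k; exact: Ck_eq_on (su k). Qed.

Lemma smooth_cst U c : smooth_on U (fun=> c). Proof. by move=> k; exact: Ck_cst. Qed.

Lemma smoothD U u v : open U ->
  smooth_on U u -> smooth_on U v -> smooth_on U (fun y => u y + v y).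
Proof. by move=> oU su sv k; exact: CkD. Qed.

Lemma smoothM U u v : open U ->
  smooth_on U u -> smooth_on U v -> smooth_on U (fun y => u y * v y).
Proof. by move=> oU su sv k; exact: CkM. Qed.

Lemma smoothN U u : open U -> smooth_on U u -> smooth_on U (fun y => - u y).
Proof.
move=> oU su; apply: smooth_eq_on (smoothM oU (smooth_cst U (-1)) su) => // y _.
by rewrite mulN1r.
Qed.

Lemma smoothB U u v : open U ->
  smooth_on U u -> smooth_on U v -> smooth_on U (fun y => u y - v y).
Proof. by move=> oU su sv; apply: smoothD => //; exact: smoothN. Qed.

Lemma smoothV U u : open U -> (forall y, U y -> u y != 0) ->
  smooth_on U u -> smooth_on U (fun y => (u y)^-1).
Proof. by move=> oU u0 su k; exact: CkV. Qed.

Lemma smooth_pderiv U u j : smooth_on U u -> smooth_on U (pderiv j u).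
Proof. by move=> /smooth_onP[_ /(_ j)[]]. Qed.

Lemma smooth_continuous U u y : smooth_on U u -> U y -> {for y, continuous u}.
Proof. by move=> /smooth_onP[+ _]; apply. Qed.

Lemma smooth_derivable U u y j : smooth_on U u -> U y ->
  derivable u y (delta_mx 0 j).
Proof. by move=> /smooth_onP[_ /(_ j)[+ _]]; apply. Qed.

Lemma smooth_sum U (I : Type) (r : seq I) (P : pred I) (F : I -> 'rV[R]_m -> R) :
  open U -> (forall i, P i -> smooth_on U (F i)) ->
  smooth_on U (fun y => \sum_(i <- r | P i) F i y).
Proof.
move=> oU sF; elim: r => [|i r IH].
  by apply: smooth_eq_on (smooth_cst U 0) => // y _; rewrite big_nil.
case Pi: (P i); last first.
  by apply: smooth_eq_on IH => // y _; rewrite big_cons Pi.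
apply: smooth_eq_on (smoothD oU (sF i Pi) IH) => // y _.
by rewrite big_cons Pi.
Qed.

Lemma smooth_prod U (I : Type) (r : seq I) (P : pred I) (F : I -> 'rV[R]_m -> R) :
  open U -> (forall i, P i -> smooth_on U (F i)) ->
  smooth_on U (fun y => \prod_(i <- r | P i) F i y).
Proof.
move=> oU sF; elim: r => [|i r IH].
  by apply: smooth_eq_on (smooth_cst U 1) => // y _; rewrite big_nil.
case Pi: (P i); last first.
  by apply: smooth_eq_on IH => // y _; rewrite big_cons Pi.
apply: smooth_eq_on (smoothM oU (sF i Pi) IH) => // y _.
by rewrite big_cons Pi.
Qed.

Section Rules.
Variables (U : set 'rV[R]_m) (y : 'rV[R]_m) (j : 'I_m).
Hypothesis (Uy : U y).

Lemma pderiv_cst c : pderiv j (fun=> c) y = 0.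
Proof. exact: derive_cst. Qed.

Lemma pderivD u v : smooth_on U u -> smooth_on U v ->
  pderiv j (fun z => u z + v z) y = pderiv j u y + pderiv j v y.
Proof. by move=> su sv; apply: deriveD; apply: (smooth_derivable (U := U)). Qed.

Lemma pderivM u v : smooth_on U u -> smooth_on U v ->
  pderiv j (fun z => u z * v z) y = pderiv j u y * v y + u y * pderiv j v y.
Proof.
move=> su sv; have du := smooth_derivable (j := j) su Uy; have dv := smooth_derivable (j := j) sv Uy.
by rewrite addrC [pderiv j u y * _]mulrC; exact: (deriveM du dv).
Qed.

Lemma pderivN u : smooth_on U u -> pderiv j (fun z => - u z) y = - pderiv j u y.
Proof. by move=> su; apply: deriveN; apply: (smooth_derivable (U := U)). Qed.

Lemma pderivB u v : smooth_on U u -> smooth_on U v ->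
  pderiv j (fun z => u z - v z) y = pderiv j u y - pderiv j v y.
Proof. by move=> su sv; apply: deriveB; apply: (smooth_derivable (U := U)). Qed.

Lemma pderiv_sum (I : Type) (r : seq I) (P : pred I) (F : I -> 'rV[R]_m -> R) :
  open U -> (forall i, P i -> smooth_on U (F i)) ->
  pderiv j (fun y => \sum_(i <- r | P i) F i y) y =
  \sum_(i <- r | P i) pderiv j (F i) y.
Proof.
move=> oU sF; elim: r => [|i r IH].
  rewrite big_nil (_ : (fun _ => _) = fun=> 0) ?pderiv_cst //.
  by apply/funext => z; rewrite big_nil.
rewrite big_cons; case Pi: (P i); rewrite -IH; last first.
  by congr pderiv; apply/funext => z; rewrite big_cons Pi.
rewrite -(pderivD (sF i Pi) (smooth_sum r oU sF)).
by congr pderiv; apply/funext => z; rewrite big_cons Pi.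
Qed.

End Rules.
End PartialDerivatives.

(** * Differentiability of smooth functions and symmetry of second derivatives *)

Section C1Differentiable.
Variables (R : realType) (m : nat).
Implicit Types (U : set 'rV[R]_m) (u v : 'rV[R]_m -> R).

Lemma coord_le_norm (h : 'rV[R]_m) j : `|h 0 j| <= `|h|.
Proof.
by rewrite [leRHS]/Num.Def.normr/= mx_normrE; exact: (le_bigmax _ _ (ord0, j)).
Qed.

Lemma norm_le_coord (h : 'rV[R]_m) c :
  0 <= c -> (forall j, `|h 0 j| <= c) -> `|h| <= c.
Proof.
move=> c0 hc; rewrite [leLHS]/Num.Def.normr/= mx_normrE (bigmax_le _ c0) //=.
by move=> [i j] _; rewrite ord1.
Qed.

Lemma norm_delta_le (t : R) (j : 'I_m) :
  `|t *: (delta_mx 0 j : 'rV[R]_m)| <= `|t|.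
Proof.
apply: norm_le_coord => // k; rewrite !mxE eqxx /= normrM.
by case: eqP => _; rewrite ?normr1 ?mulr1 // normr0 mulr0.
Qed.

Lemma is_derive_line u (y v : 'rV[R]_m) (t : R) :
  derivable u (y + t *: v) v ->
  is_derive t 1 (fun s : R => u (y + s *: v)) ('D_v u (y + t *: v)).
Proof.
rewrite /derivable => du.
have E : (fun h : R => h^-1 *: (u (y + (h *: 1 + t) *: v) - u (y + t *: v))) =
  (fun h => h^-1 *: ((u \o shift (y + t *: v)) (h *: v) - u (y + t *: v))).
  apply/funext => h /=; congr (_ *: (u _ - _)).
  by rewrite [h *: 1]mulr1 scalerDl addrCA addrA.
by apply: DeriveDef; rewrite /derivable /derive /= E.
Qed.

Lemma pderiv_shift u (c z : 'rV[R]_m) j :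
  pderiv j (fun z => u (z + c)) z = pderiv j u (z + c).
Proof.
rewrite /pderiv /derive.
have -> // : (fun h : R => h^-1 *: (((fun z => u (z + c)) \o shift z)
      (h *: delta_mx 0 j) - u (z + c))) =
  (fun h => h^-1 *: ((u \o shift (z + c)) (h *: delta_mx 0 j) - u (z + c))).
by apply/funext => h /=; rewrite addrA.
Qed.

Lemma derivable_shift u (c z v : 'rV[R]_m) :
  derivable u (z + c) v -> derivable (fun z => u (z + c)) z v.
Proof.
rewrite /derivable => du.
have -> // : (fun h : R => h^-1 *: (((fun z => u (z + c)) \o shift z) (h *: v) - u (z + c))) =
  (fun h => h^-1 *: ((u \o shift (z + c)) (h *: v) - u (z + c))).
by apply/funext => h /=; rewrite addrA.
Qed.

(** The one-variable mean value theorem on [0, h] or [h, 0]; both signs of [h] occur, since a point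
    is displaced in every direction. *)
Lemma mean_value_line u (z v : 'rV[R]_m) (h : R) :
  (forall s : R, `|s| <= `|h| ->
     derivable u (z + s *: v) (v)) ->
  exists2 s : R, `|s| <= `|h| &
    u (z + h *: v) - u z = h * 'D_v u (z + s *: v).
Proof.
move=> du; set f := fun s : R => u (z + s *: v).
have df (s : R) : `|s| <= `|h| ->
    is_derive s 1 f ('D_v u (z + s *: v)).
  by move=> sh; apply: is_derive_line; exact: du.
have cf (a b : R) : (forall s : R, s \in `[a, b] -> `|s| <= `|h|) ->
    {within `[a, b], continuous f}.
  move=> ab; apply: derivable_within_continuous => s /ab /df.
  exact: @ex_derive.
have f0 : f 0 = u z by rewrite /f scale0r addr0.
have [h0|h0|->] := ltgtP h 0; last first.
- by exists 0; rewrite // scale0r addr0 subrr mul0r.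
- have ab (s : R) : s \in `[0, h] -> `|s| <= `|h|.
    by rewrite in_itv /= => /andP[s0 sh]; rewrite !ger0_norm // ltW.
  have [s|s sI E] := MVT (df := fun s => 'D_v u (z + s *: v)) h0 _ (cf _ _ ab).
    by move=> sI; apply/df/ab; exact: subset_itv_oo_cc sI.
  exists s; first by apply: ab; exact: subset_itv_oo_cc sI.
  by rewrite -/(f h) -f0 E subr0 mulrC.
- have ab (s : R) : s \in `[h, 0] -> `|s| <= `|h|.
    by rewrite in_itv /= => /andP[sh s0]; rewrite !ler0_norm ?lerN2 // ltW.
  have [s|s sI E] := MVT (df := fun s => 'D_v u (z + s *: v)) h0 _ (cf _ _ ab).
    by move=> sI; apply/df/ab; exact: subset_itv_oo_cc sI.
  exists s; first by apply: ab; exact: subset_itv_oo_cc sI.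
  by rewrite -/(f h) -f0 -opprB E sub0r mulrN opprK mulrC.
Qed.

Lemma mean_value_coord u (z : 'rV[R]_m) (j : 'I_m) (h : R) :
  (forall s : R, `|s| <= `|h| ->
     derivable u (z + s *: delta_mx 0 j) (delta_mx 0 j)) ->
  exists2 s : R, `|s| <= `|h| &
    u (z + h *: delta_mx 0 j) - u z = h * pderiv j u (z + s *: delta_mx 0 j).
Proof. exact: mean_value_line. Qed.

Lemma open_norm_ball U y : open U -> U y ->
  exists2 d : R, 0 < d & forall z, `|z - y| < d -> U z.
Proof.
move=> oU Uy; have /nbhs_ballP[d /= d0 dU] := open_nbhs_nbhs (conj oU Uy).
exists d => // z zy; apply: dU; rewrite -ball_normE /ball_ /=.
by rewrite distrC.
Qed.

Lemma continuous_norm_ball u y (e : R) : {for y, continuous u} -> 0 < e ->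
  exists2 d : R, 0 < d & forall z, `|z - y| < d -> `|u z - u y| < e.
Proof.
move=> uc e0; have /cvgrPdist_lt /(_ e e0) : u z @[z --> y] --> u y by [].
move=> /nbhs_ballP[d /= d0 dU]; exists d => // z zy.
by rewrite distrC; apply: dU; rewrite -ball_normE /ball_ /= distrC.
Qed.

Definition linear_form (a : 'cV[R]_m) (h : 'rV[R]_m) : R := (h *m a) 0 0.

Lemma linear_form_is_linear a : linear (linear_form a).
Proof. by move=> k x y; rewrite /linear_form mulmxDl -scalemxAl !mxE. Qed.

HB.instance Definition _ a :=
  GRing.isLinear.Build R 'rV[R]_m R _ (linear_form a) (linear_form_is_linear a).

Lemma continuous_sum (I : Type) (r : seq I) (F : I -> 'rV[R]_m -> R) y :
  (forall i, {for y, continuous (F i)}) ->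
  {for y, continuous (fun z => \sum_(i <- r) F i z)}.
Proof.
move=> Fc; elim: r => [|i r IH].
  have -> : (fun z => \sum_(i <- [::]) F i z) = fun=> 0.
    by apply/funext => z; rewrite big_nil.
  exact: cst_continuous.
have -> : (fun z => \sum_(i <- i :: r) F i z) = fun z => F i z + \sum_(i <- r) F i z.
  by apply/funext => z; rewrite big_cons.
by apply: continuousD; [exact: Fc|exact: IH].
Qed.

Lemma linear_form_continuous a : continuous (linear_form a).
Proof.
have -> : linear_form a = fun h => \sum_j h 0 j * a j 0.
  by apply/funext => k; rewrite /linear_form mxE.
move=> h; apply: continuous_sum => j.
apply: continuousM; [exact: coord_continuous|exact: cst_continuous].
Qed.

Definition partial_sum (k : nat) (h : 'rV[R]_m) : 'rV[R]_m :=
  \row_j (if (j < k)%N then h 0 j else 0).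

Lemma partial_sumS (k : 'I_m) h :
  partial_sum k.+1 h = partial_sum k h + h 0 k *: delta_mx 0 k.
Proof.
apply/rowP => j; rewrite !mxE eqxx /= ltnS leq_eqVlt.
case: (eqVneq j k) => [->|jk]; first by rewrite eqxx ltnn mulr1 add0r.
by rewrite -val_eqE in jk; rewrite (negPf jk) mulr0 addr0.
Qed.

Lemma partial_sum_step_le (k : 'I_m) (s : R) (h : 'rV[R]_m) : `|s| <= `|h 0 k| ->
  `|partial_sum k h + s *: delta_mx 0 k| <= `|h|.
Proof.
move=> sh; apply: norm_le_coord => // j; rewrite !mxE eqxx /=.
case: (eqVneq j k) => [->|jk].
  by rewrite ltnn mulr1 add0r (le_trans sh) // coord_le_norm.
by rewrite mulr0 addr0; case: ifP => _; rewrite ?normr0 // coord_le_norm.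
Qed.

Definition gradient u y : 'cV[R]_m := \col_j pderiv j u y.

(** Continuous partial derivatives give a total differential: y + h is reached from y by changing
    one coordinate at a time. Each change is a mean value along an axis, at a point within |h| of y,
    where the partial derivative is close to its value at y. *)
Lemma gradient_approx U u y (e : R) : open U -> U y -> smooth_on U u -> 0 < e ->
  exists2 d : R, 0 < d & forall h, `|h| < d ->
    `|u (h + y) - u y - linear_form (gradient u y) h| <= e * `|h|.
Proof.
(* Each of the m coordinate changes may cost e'; the successor keeps the divisor nonzero when m =
   0. *)
move=> oU Uy su e0; pose e' := e / m.+1%:R.
have e'0 : 0 < e' by rewrite divr_gt0 ?ltr0n.
have [d0 d00 dU] := open_norm_ball oU Uy.
have [d d_gt0 dd] : exists2 d : R, 0 < d &
    forall j z, `|z - y| < d -> `|pderiv j u z - pderiv j u y| < e'.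
  have H j : exists d : R, 0 < d /\
      forall z, `|z - y| < d -> `|pderiv j u z - pderiv j u y| < e'.
    have [|d] := @continuous_norm_ball (pderiv j u) y e' _ e'0; last by exists d.
    exact: smooth_continuous (smooth_pderiv j su) Uy.
  have [dj Hdj] := choice H.
  exists (\big[Num.min/1]_j dj j).
    by rewrite lt_bigmin // => j _; have [] := Hdj j.
  move=> j z zy; have [_] := Hdj j; apply.
  by apply: lt_le_trans zy _; exact: bigmin_le_cond.
exists (Num.min d0 d); first by rewrite lt_min d00.
move=> h; rewrite lt_min => /andP[hd0 hd].
have main k : (k <= m)%N ->
    `|u (y + partial_sum k h) - u y -
      \sum_(j < m | (j < k)%N) h 0 j * pderiv j u y| <= k%:R * (e' * `|h|).
  elim: k => [_|k IH km].
    rewrite big_pred0 // mul0r subr0 (_ : partial_sum 0 h = 0) ?addr0 ?subrr ?normr0 //.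
    by apply/rowP => j; rewrite !mxE.
  pose ko := Ordinal km.
  have inb (s : R) : `|s| <= `|h 0 ko| ->
      `|y + partial_sum k h + s *: delta_mx 0 ko - y| <= `|h|.
    by move=> /(@partial_sum_step_le ko) H; rewrite -[y + _ + _]addrA [y + _]addrC addrK.
  have [s|s sh E] := @mean_value_coord u (y + partial_sum k h) ko (h 0 ko).
    move=> /inb sh; apply: (smooth_derivable su); apply: dU.
    exact: le_lt_trans sh hd0.
  have -> : \sum_(j < m | (j < k.+1)%N) h 0 j * pderiv j u y =
      \sum_(j < m | (j < k)%N) h 0 j * pderiv j u y + h 0 ko * pderiv ko u y.
    rewrite (bigD1 ko) //= addrC; congr (_ + _); apply: eq_bigl => j.
    rewrite ltnS [in RHS]ltn_neqAle andbC; congr (_ && _).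
  rewrite (partial_sumS ko) addrA.
  set P := y + _ in E *; set S := \sum_(_ < _ | _) _.
  have -> : u (P + h 0 ko *: delta_mx 0 ko) - u y - (S + h 0 ko * pderiv ko u y) =
      (u P - u y - S) + h 0 ko * (pderiv ko u (P + s *: delta_mx 0 ko) - pderiv ko u y).
    by move: E; rewrite mulrBr; lra.
  rewrite (le_trans (ler_normD _ _)) // -natr1 mulrDl mul1r lerD //.
    by apply: IH; exact: ltnW.
  rewrite normrM mulrC ler_pM //; last exact: coord_le_norm.
  by apply/ltW/dd/(le_lt_trans _ hd)/inb.
have := main m (leqnn m).
have -> : partial_sum m h = h by apply/rowP => j; rewrite !mxE ltn_ord.
have -> : \sum_(j < m | (j < m)%N) h 0 j * pderiv j u y = linear_form (gradient u y) h.
  rewrite /linear_form mxE; apply: eq_big => [j|j _]; first by rewrite ltn_ord.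
  by rewrite !mxE.
rewrite [y + h]addrC => /le_trans; apply.
rewrite mulrA ler_wpM2r // /e' mulrCA ger_pMr // ler_pdivrMr ?ltr0n // mul1r.
by rewrite ler_nat.
Qed.

Lemma smooth_diff U u y : open U -> U y -> smooth_on U u ->
  differentiable u y /\ 'd u y = linear_form (gradient u y) :> (_ -> _).
Proof.
move=> oU Uy su.
have E : u \o shift y = cst (u y) + linear_form (gradient u y) +o_ (0 : 'rV[R]_m) id.
  apply/eqaddoP => e e0.
  have [d d0 dh] := gradient_approx oU Uy su e0.
  apply/nbhs_ballP; exists d => //= h; rewrite -ball_normE /ball_ /= sub0r normrN.
  move=> /dh; rewrite /cst /=.
  by rewrite opprD addrA.
have D := diff_unique (@linear_form_continuous (gradient u y)) E.
split=> //; apply/diff_locallyP; rewrite D; split=> //.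
exact: linear_form_continuous.
Qed.

Lemma smooth_differentiable U u y : open U -> U y -> smooth_on U u ->
  differentiable u y.
Proof. by move=> oU Uy su; case: (smooth_diff oU Uy su). Qed.

Lemma derive_pderiv U u y (X : 'rV[R]_m) : open U -> U y -> smooth_on U u ->
  'D_X u y = \sum_j X 0 j * pderiv j u y.
Proof.
move=> oU Uy su; have [du D] := smooth_diff oU Uy su.
rewrite deriveE // D /linear_form mxE; apply: eq_bigr => j _; by rewrite mxE.
Qed.

Lemma second_difference U u y (d s : R) i j : smooth_on U u ->
  (forall z, `|z - y| < d -> U z) -> 0 < s -> s + s < d ->
  exists2 z, `|z - y| <= s + s &
  u (y + s *: delta_mx 0 i + s *: delta_mx 0 j) - u (y + s *: delta_mx 0 i)
  - u (y + s *: delta_mx 0 j) + u y = s ^+ 2 * pderiv j (pderiv i u) z.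
Proof.
move=> su dU s0 sd.
have bnd (a b : R) : `|a| <= `|s| -> `|b| <= `|s| ->
    `|y + a *: delta_mx 0 i + b *: delta_mx 0 j - y| <= s + s.
  move=> als bls; rewrite -[y + _ + _]addrA [y + _]addrC addrK (le_trans (ler_normD _ _)) //.
  rewrite (gtr0_norm s0) in als bls.
  by rewrite lerD // (le_trans (norm_delta_le _ _)).
have s_le : `|s| <= `|s| by [].
have z_le : `|0 : R| <= `|s| by rewrite normr0.
have inU (a b : R) : `|a| <= `|s| -> `|b| <= `|s| ->
    U (y + a *: delta_mx 0 i + b *: delta_mx 0 j).
  by move=> ha hb; apply: dU; apply: le_lt_trans (bnd _ _ ha hb) sd.
pose w z := u (z + s *: delta_mx 0 j) - u z.
have [a ha|a ha Ea] := @mean_value_coord w y i s.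
  apply: derivableB.
    apply: derivable_shift; apply: (smooth_derivable su); exact: inU.
  apply: (smooth_derivable su).
  by have := inU a 0 ha z_le; rewrite scale0r addr0.
have Ua : U (y + a *: delta_mx 0 i).
  by have := inU a 0 ha z_le; rewrite scale0r addr0.
have [b hb|b hb Eb] := @mean_value_coord (pderiv i u) (y + a *: delta_mx 0 i) j s.
  apply: (smooth_derivable (smooth_pderiv i su)); exact: inU.
exists (y + a *: delta_mx 0 i + b *: delta_mx 0 j); first exact: bnd.
rewrite expr2 -mulrA -Eb -pderiv_shift.
have -> : pderiv i (fun z => u (z + s *: delta_mx 0 j)) (y + a *: delta_mx 0 i) -
   pderiv i u (y + a *: delta_mx 0 i) = pderiv i w (y + a *: delta_mx 0 i).
  rewrite /pderiv deriveB //.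
    apply: derivable_shift; apply: (smooth_derivable su); exact: inU.
  exact: (smooth_derivable su).
by rewrite -Ea /w; ring.
Qed.

Lemma no_common_half (a b c : R) :
  `|c - a| < `|a - b| / 2 -> `|c - b| < `|a - b| / 2 -> False.
Proof. by have := ler_distD c a b; rewrite (distrC a c); lra. Qed.

(** If the mixed derivatives differed at y, by continuity their values near y would stay apart; but
    the symmetric second difference makes a value of one near y equal to a value of the other near
    y. *)
Lemma schwarz U u y i j : open U -> U y -> smooth_on U u ->
  pderiv j (pderiv i u) y = pderiv i (pderiv j u) y.
Proof.
move=> oU Uy su; apply/eqP/negPn/negP => ne.
set a := pderiv j _ _ in ne; set b := pderiv i _ _ in ne.
have e0 : 0 < `|a - b| / 2 by rewrite divr_gt0 ?normr_gt0 ?subr_eq0.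
have [d0 d00 dU] := open_norm_ball oU Uy.
have [|d1 d10 D1] := @continuous_norm_ball (pderiv j (pderiv i u)) y _ _ e0.
  exact: smooth_continuous (smooth_pderiv j (smooth_pderiv i su)) Uy.
have [|d2 d20 D2] := @continuous_norm_ball (pderiv i (pderiv j u)) y _ _ e0.
  exact: smooth_continuous (smooth_pderiv i (smooth_pderiv j su)) Uy.
pose d := Num.min d0 (Num.min d1 d2).
have dp : 0 < d by rewrite !lt_min d00 d10.
pose s := d / 3.
have s0 : 0 < s by rewrite divr_gt0.
have sd : s + s < d by rewrite /s; lra.
have sd' : s + s < d0 /\ (s + s < d1 /\ s + s < d2).
  by move: sd; rewrite !lt_min => /andP[-> /andP[-> ->]].
have [p pb Ep] := second_difference i j su dU s0 sd'.1.
have [q qb Eq] := second_difference j i su dU s0 sd'.1.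
have pq : pderiv j (pderiv i u) p = pderiv i (pderiv j u) q.
  have s2 : s ^+ 2 != 0 by rewrite expf_neq0 // gt_eqF.
  apply: (mulfI s2); refine (etrans (esym Ep) (etrans _ Eq)).
  have -> : y + s *: delta_mx 0 i + s *: delta_mx 0 j =
            y + s *: delta_mx 0 j + s *: delta_mx 0 i by exact: addrAC.
  move: (u (y + _ + _)) (u (y + s *: delta_mx 0 i)) (u (y + s *: delta_mx 0 j)) => A B C.
  by rewrite [A - B - C]addrAC.
have h1 := D1 p (le_lt_trans pb sd'.2.1).
have h2 := D2 q (le_lt_trans qb sd'.2.2).
rewrite pq in h1.
exact: (no_common_half h1 h2).
Qed.

End C1Differentiable.

Lemma pderivE (R : realType) m j (u : 'rV[R]_m -> R) y :
  pderiv j u y = 'D_(delta_mx 0 j) u y.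
Proof. by []. Qed.

Lemma pderiv_ext (R : realType) m j (u v : 'rV[R]_m -> R) y :
  (forall z, u z = v z) -> pderiv j u y = pderiv j v y.
Proof. by move=> /funext ->. Qed.

Global Opaque pderiv.

(** * Matrix-valued functions *)

HB.lock Definition pdmx (R : realType) m p q (j : 'I_m)
  (A : 'rV[R]_m -> 'M[R]_(p, q)) (y : 'rV[R]_m) : 'M[R]_(p, q) :=
  \matrix_(a, b) pderiv j (fun z => A z a b) y.

Section MatrixCalculus.
Variables (R : realType) (m : nat) (U : set 'rV[R]_m).
Hypothesis oU : open U.
Local Notation pt := ('rV[R]_m).

Lemma pdmxE p q j (A : pt -> 'M[R]_(p, q)) y a b :
  pdmx j A y a b = pderiv j (fun z => A z a b) y.
Proof. by rewrite pdmx.unlock mxE. Qed.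

Lemma smooth_mx_cst p q (A : 'M[R]_(p, q)) : smooth_mx_on U (fun=> A).
Proof. by move=> a b; exact: smooth_cst. Qed.

Lemma smooth_mxD p q (A B : pt -> 'M[R]_(p, q)) :
  smooth_mx_on U A -> smooth_mx_on U B -> smooth_mx_on U (fun z => A z + B z).
Proof.
move=> sA sB a b; apply: smooth_eq_on (smoothD oU (sA a b) (sB a b)) => // z _.
by rewrite mxE.
Qed.

Lemma smooth_mxN p q (A : pt -> 'M[R]_(p, q)) :
  smooth_mx_on U A -> smooth_mx_on U (fun z => - A z).
Proof.
by move=> sA a b; apply: smooth_eq_on (smoothN oU (sA a b)) => // z _; rewrite mxE.
Qed.

Lemma smooth_mxB p q (A B : pt -> 'M[R]_(p, q)) :
  smooth_mx_on U A -> smooth_mx_on U B -> smooth_mx_on U (fun z => A z - B z).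
Proof. by move=> sA sB; apply: smooth_mxD => //; exact: smooth_mxN. Qed.

Lemma smooth_mxM p q r (A : pt -> 'M[R]_(p, q)) (B : pt -> 'M[R]_(q, r)) :
  smooth_mx_on U A -> smooth_mx_on U B -> smooth_mx_on U (fun z => A z *m B z).
Proof.
move=> sA sB a b; apply: smooth_eq_on (smooth_sum (F := fun k z => A z a k * B z k b)
  _ oU _) => [//|z _|k _]; first by rewrite mxE.
exact: smoothM.
Qed.

Lemma smooth_mxT p q (A : pt -> 'M[R]_(p, q)) :
  smooth_mx_on U A -> smooth_mx_on U (fun z => (A z)^T).
Proof. by move=> sA a b; apply: smooth_eq_on (sA b a) => // z _; rewrite mxE. Qed.

Lemma smooth_mxZ p q (c : R) (A : pt -> 'M[R]_(p, q)) :
  smooth_mx_on U A -> smooth_mx_on U (fun z => c *: A z).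
Proof.
move=> sA a b; apply: smooth_eq_on (smoothM oU (smooth_cst U c) (sA a b)) => // z _.
by rewrite mxE.
Qed.

Lemma smooth_trace p (A : pt -> 'M[R]_p) :
  smooth_mx_on U A -> smooth_on U (fun z => \tr (A z)).
Proof. by move=> sA; apply: smooth_sum => // i _; exact: sA. Qed.

Lemma smooth_det p (A : pt -> 'M[R]_p) :
  smooth_mx_on U A -> smooth_on U (fun z => \det (A z)).
Proof.
move=> sA; apply: smooth_sum => // s _; apply: smoothM => //; first exact: smooth_cst.
by apply: smooth_prod => // i _; exact: sA.
Qed.

Lemma smooth_mx_pdmx p q j (A : pt -> 'M[R]_(p, q)) :
  smooth_mx_on U A -> smooth_mx_on U (pdmx j A).
Proof.
move=> sA a b; apply: smooth_eq_on (smooth_pderiv j (sA a b)) => // z _.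
by rewrite pdmxE.
Qed.

(** Cramer's rule: cofactors are polynomials in the entries, and the determinant does not vanish. *)
Lemma smooth_invmx p (A : pt -> 'M[R]_p) : (forall z, U z -> A z \in unitmx) ->
  smooth_mx_on U A -> smooth_mx_on U (fun z => invmx (A z)).
Proof.
move=> uA sA a b.
apply: (@smooth_eq_on _ _ _ (fun z => (\det (A z))^-1 * \adj (A z) a b)) => //.
  by move=> z /uA uAz; rewrite /invmx uAz [RHS]mxE.
apply: smoothM => //.
  apply: smoothV => //; last exact: smooth_det.
  by move=> z /uA; rewrite unitmxE unitfE.
have -> : (fun z => \adj (A z) a b) =
    fun z => (-1) ^+ (b + a) * \det (row' b (col' a (A z))).
  by apply/funext => z; rewrite mxE.
apply: smoothM => //; first exact: smooth_cst.
apply: smooth_det => i k; apply: smooth_eq_on (sA (lift b i) (lift a k)) => // z _.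
by rewrite !mxE.
Qed.

Section At.
Variables (y : pt) (j : 'I_m).
Hypothesis Uy : U y.

Lemma pdmx_eq_on p q (A B : pt -> 'M[R]_(p, q)) :
  (forall z, U z -> A z = B z) -> pdmx j A y = pdmx j B y.
Proof.
by move=> AB; apply/matrixP => a b; rewrite !pdmxE; apply: (pderiv_eq_on _ oU Uy) => z /AB ->.
Qed.

Lemma pdmx_cst p q (A : 'M[R]_(p, q)) : pdmx j (fun=> A) y = 0.
Proof. by apply/matrixP => a b; rewrite pdmxE mxE pderiv_cst. Qed.

Lemma pdmxD p q (A B : pt -> 'M[R]_(p, q)) :
  smooth_mx_on U A -> smooth_mx_on U B ->
  pdmx j (fun z => A z + B z) y = pdmx j A y + pdmx j B y.
Proof.
move=> sA sB; apply/matrixP => a b; rewrite mxE !pdmxE -(pderivD j Uy (sA a b) (sB a b)).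
by apply: pderiv_ext => z; rewrite mxE.
Qed.

Lemma pdmxN p q (A : pt -> 'M[R]_(p, q)) : smooth_mx_on U A ->
  pdmx j (fun z => - A z) y = - pdmx j A y.
Proof.
move=> sA; apply/matrixP => a b; rewrite mxE !pdmxE -(pderivN j Uy (sA a b)).
by apply: pderiv_ext => z; rewrite mxE.
Qed.

Lemma pdmxB p q (A B : pt -> 'M[R]_(p, q)) :
  smooth_mx_on U A -> smooth_mx_on U B ->
  pdmx j (fun z => A z - B z) y = pdmx j A y - pdmx j B y.
Proof. by move=> sA sB; rewrite pdmxD ?pdmxN //; exact: smooth_mxN. Qed.

Lemma pdmxM p q r (A : pt -> 'M[R]_(p, q)) (B : pt -> 'M[R]_(q, r)) :
  smooth_mx_on U A -> smooth_mx_on U B ->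
  pdmx j (fun z => A z *m B z) y = pdmx j A y *m B y + A y *m pdmx j B y.
Proof.
move=> sA sB; apply/matrixP => a b; rewrite !mxE -big_split pdmxE /=.
rewrite (_ : (fun z => _) = fun z => \sum_k A z a k * B z k b); last first.
  by apply/funext => z; rewrite mxE.
rewrite (pderiv_sum _ Uy) //; last by move=> k _; exact: smoothM.
by apply: eq_bigr => k _; rewrite (pderivM _ Uy) // !pdmxE.
Qed.

Lemma pdmxT p q (A : pt -> 'M[R]_(p, q)) :
  pdmx j (fun z => (A z)^T) y = (pdmx j A y)^T.
Proof.
apply/matrixP => a b; rewrite [RHS]mxE !pdmxE; by apply: pderiv_ext => z; rewrite mxE.
Qed.

Lemma pdmxZ p q (c : R) (A : pt -> 'M[R]_(p, q)) : smooth_mx_on U A ->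
  pdmx j (fun z => c *: A z) y = c *: pdmx j A y.
Proof.
move=> sA; apply/matrixP => a b; rewrite mxE !pdmxE.
rewrite (_ : (fun z => _) = fun z => c * A z a b); last first.
  by apply/funext => z; rewrite mxE.
by rewrite (pderivM _ Uy (smooth_cst U c)) // pderiv_cst mul0r add0r.
Qed.

Lemma pderiv_trace p (A : pt -> 'M[R]_p) : smooth_mx_on U A ->
  pderiv j (fun z => \tr (A z)) y = \tr (pdmx j A y).
Proof.
move=> sA; rewrite /mxtrace (pderiv_sum j Uy _ oU (fun i _ => sA i i)).
by apply: eq_bigr => i _; rewrite pdmxE.
Qed.

Lemma pdmx_invmx p (A : pt -> 'M[R]_p) : (forall z, U z -> A z \in unitmx) ->
  smooth_mx_on U A ->
  pdmx j (fun z => invmx (A z)) y = - (invmx (A y) *m pdmx j A y *m invmx (A y)).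
Proof.
move=> uA sA; have sV := smooth_invmx uA sA.
have : pdmx j (fun z => invmx (A z) *m A z) y = 0.
  rewrite -[RHS](@pdmx_cst p p 1%:M); apply: pdmx_eq_on => z Uz.
  by rewrite mulVmx // uA.
rewrite pdmxM // => /eqP; rewrite addr_eq0 => /eqP E.
by rewrite -[LHS](mulmxK (uA _ Uy)) E mulNmx.
Qed.

(** Each summand is kept as a full product with one factor replaced, so that in [pderiv_det] it is
    again a term of the permutation expansion of a determinant. *)
Lemma pderiv_prod (I : finType) (F : I -> pt -> R) (P : pred I) :
  (forall i, P i -> smooth_on U (F i)) ->
  pderiv j (fun z => \prod_(i | P i) F i z) y =
  \sum_(i | P i) \prod_(k | P k) (if k == i then pderiv j (F k) y else F k y).
Proof.
have [n] := ubnP #|P|; elim: n P => // n IH P Pn sF.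
have [i Pi|P0] := pickP P; last first.
  rewrite big_pred0 // (_ : (fun z => _) = fun=> 1) ?pderiv_cst //.
  by apply/funext => z; rewrite big_pred0.
rewrite (_ : (fun z => _) = fun z => F i z * \prod_(k | P k && (k != i)) F k z); last first.
  by apply/funext => z; exact: (bigD1 i Pi).
have sF' k : P k && (k != i) -> smooth_on U (F k) by move=> /andP[/sF].
rewrite (pderivM _ Uy) ?sF //; last exact: smooth_prod.
rewrite IH //; last first.
  rewrite ltnS in Pn; apply: leq_trans Pn; apply/proper_card/properP; split.
    by apply/fintype.subsetP => k /andP[].
  by exists i; rewrite // unfold_in eqxx andbF.
rewrite [RHS](bigD1 i) //=; congr (_ + _).
  rewrite [RHS](bigD1 i) //= eqxx; congr (_ * _).
  by apply: eq_bigr => k /andP[_ /negPf ->].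
rewrite big_distrr /=; apply: eq_bigr => k /andP[Pk ki].
by rewrite [RHS](bigD1 i) //= eq_sym (negPf ki).
exact: sF.
Qed.

Lemma pderiv_det p (A : pt -> 'M[R]_p) : smooth_mx_on U A ->
  pderiv j (fun z => \det (A z)) y = \tr (\adj (A y) *m pdmx j A y).
Proof.
move=> sA; rewrite /determinant (pderiv_sum _ Uy) //; last first.
  move=> s _; apply: smoothM => //; first exact: smooth_cst.
  by apply: smooth_prod => // i _; exact: sA.
under eq_bigr => s _.
  rewrite (pderivM _ Uy (smooth_cst U _)); last by apply: smooth_prod => // i _; exact: sA.
  rewrite pderiv_cst mul0r add0r pderiv_prod; last by move=> i _; exact: sA.
  rewrite big_distrr /=.
  over.
rewrite exchange_big /= mxtrace_mulC; apply: eq_bigr => i _.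
(* [A] with row i differentiated; expansion along that row has the cofactors of [A] as coefficients,
   which gives Jacobi's formula. *)
pose B := \matrix_(k, l) (if k == i then pdmx j A y k l else A y k l).
transitivity (\det B).
  apply: eq_bigr => s _; congr (_ * _); apply: eq_bigr => k _.
  by rewrite !mxE pdmxE.
rewrite (expand_det_row B i) mxE; apply: eq_bigr => l _.
rewrite !mxE eqxx; congr (_ * _); rewrite /cofactor; congr (_ * \det _).
apply/matrixP => a b; rewrite !mxE.
by rewrite eq_sym (negPf (neq_lift _ _)).
Qed.

Lemma pderiv_det_unit p (A : pt -> 'M[R]_p) : smooth_mx_on U A -> A y \in unitmx ->
  pderiv j (fun z => \det (A z)) y = \det (A y) * \tr (invmx (A y) *m pdmx j A y).
Proof.
move=> sA uA; rewrite pderiv_det // -mxtraceZ scalemxAl; congr (\tr (_ *m _)).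
rewrite /invmx uA scalerA mulfV ?scale1r //.
by rewrite -unitfE -unitmxE.
Qed.

End At.

Lemma schwarz_mx p q (A : pt -> 'M[R]_(p, q)) i j y : U y -> smooth_mx_on U A ->
  pdmx j (pdmx i A) y = pdmx i (pdmx j A) y.
Proof.
move=> Uy sA; apply/matrixP => a b; rewrite !pdmxE.
have E k l : pderiv k (fun z => pdmx l A z a b) y =
             pderiv k (pderiv l (fun z => A z a b)) y.
  by apply: pderiv_ext => z; rewrite pdmxE.
by rewrite !E; apply: (schwarz _ _ oU Uy).
Qed.

End MatrixCalculus.

(** * The Levi-Civita connection of a hyperkaehler chart *)

Section TensorAlgebra.
Variables (R : realFieldType) (V : Type) (i j : V -> V).

(* [aI], [aJ], [aK] stand for the covariant derivatives of the three Kaehler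
   forms, in the order (direction, argument, argument). *)
Lemma closed_triple_parallel (aI aJ aK : V -> V -> V -> R) :
  (forall X Y Z, aI X Z Y = - aI X Y Z) ->
  (forall X Y Z, aJ X Z Y = - aJ X Y Z) ->
  (forall X Y Z, aK X Z Y = - aK X Y Z) ->
  (forall X Y Z, aI X Y Z + aI Y Z X + aI Z X Y = 0) ->
  (forall X Y Z, aJ X Y Z + aJ Y Z X + aJ Z X Y = 0) ->
  (forall X Y Z, aK X Y Z + aK Y Z X + aK Z X Y = 0) ->
  (forall X Y Z, aI X (i Y) Z = aI X Y (i Z)) ->
  (forall X Y Z, aK X Y Z = aJ X (i Y) Z - aI X Y (j Z)) ->
  (forall X Y Z, aJ X (i (i Y)) Z = - aJ X Y Z) ->
  (forall X Y Z, aI X Y (i (i Z)) = - aI X Y Z) ->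
  (forall X Y Z, aI (i (i X)) Y Z = - aI X Y Z) ->
  (forall X Y Z, aI X Y (i (j Z)) = - aI X Y (j (i Z))) ->
  (forall X Y Z, aI X Y (j (j Z)) = - aI X Y Z) ->
  forall X Y Z, aI X Y Z = 0.
Proof.
move=> antiI antiJ antiK cycI cycJ cycK swap relK iiJ iiI ii1 ij jj.
(* [B] will be symmetric in its first two arguments and antisymmetric in its last two, and such a
   tensor vanishes. The symmetry appears first with j Z in the last slot, where [relK] expresses [B]
   by aJ and aK, whose cyclic identities apply. *)
pose B X Y Z := aI (i X) Y Z + aI X (i Y) Z.
have symj X Y Z : B X Y (j Z) = B Y X (j Z).
  rewrite /B.
  move: (relK (i X) Y Z) (relK X (i Y) Z) (relK (i Y) X Z) (relK Y (i X) Z).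
  move: (iiJ X Y Z) (iiJ Y X Z) (cycJ (i X) (i Y) Z) (antiJ (i Y) (i X) Z).
  move: (cycJ X Y Z) (antiJ Y X Z) (cycK (i X) Y Z) (antiK Y (i X) Z).
  move: (cycK X (i Y) Z) (antiK (i Y) X Z) (relK Z (i X) Y) (relK Z X (i Y)).
  move: (iiJ Z X Y) (swap Z X (j Y)) (ij Z X Y).
  lra.
have sym X Y Z : B X Y Z = B Y X Z.
  have := symj X Y (j Z); rewrite /B !jj; lra.
have anti X Y Z : B X Z Y = - B X Y Z.
  by move: (antiI (i X) Y Z) (antiI X (i Y) Z) (swap X Y Z) (swap X Z Y); rewrite /B;
     move: (antiI X Y (i Z)); lra.
have B0 X Y Z : B X Y Z = 0.
  move: (sym X Y Z) (anti Y X Z) (sym Y Z X) (anti Z Y X) (sym Z X Y) (anti X Y Z).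
  lra.
(* Now aI (i X) Y Z = - aI X (i Y) Z. Replacing (Y, Z) by (i Y, i Z) in the cyclic identity
   therefore preserves two of its terms and changes the sign of aI X Y Z; the difference is twice
   that term. *)
move=> X Y Z.
move: (cycI Y Z X) (cycI (i Y) (i Z) X).
move: (B0 Y (i Z) X) (B0 Z X (i Y)) (B0 Z X Y) (swap Z X Y).
move: (swap Y (i Z) X) (iiI Y Z X) (antiI Y Z X) (antiI Y X (i Z)); rewrite /B.
move: (swap X (i Y) Z) (iiI X Y Z) (swap X Y (i Z)).
move: (swap Y Z X) (swap Y Z (i X)) (iiI Y Z X) (antiI Y Z (i (i X))) (antiI X (i Y) Z).
move: (ii1 Y Z X) (ii1 Z X Y) (iiI Z X Y) (swap Z X (i Y)) (swap Z (i X) Y).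
move: (antiI Y (i (i Z)) X) (antiI X Y (i (i Z))).
lra.
Qed.

(** Octahedron argument: the cyclic identity is taken at the four rotations of the arguments, and
    the antisymmetries identify the remaining terms. *)
Lemma curvature_pair_sym (r : V -> V -> V -> V -> R) :
  (forall X Y Z W, r Y X Z W = - r X Y Z W) ->
  (forall X Y Z W, r X Y W Z = - r X Y Z W) ->
  (forall X Y Z W, r X Y Z W + r Y Z X W + r Z X Y W = 0) ->
  forall X Y Z W, r X Y Z W = r Z W X Y.
Proof.
move=> a12 a34 b X Y Z W.
move: (b X Y Z W) (b Y Z W X) (b Z W X Y) (b W X Y Z).
move: (a12 X Y Z W) (a12 Y Z X W) (a12 Z X Y W) (a12 Z W Y X) (a12 W Y Z X) (a12 W X Z Y).
move: (a12 X Z W Y) (a12 X Y W Z) (a12 Y W X Z) (a12 Y Z W X) (a12 X Y Z W).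
move: (a34 X Y Z W) (a34 Y Z X W) (a34 Z X Y W) (a34 Z W Y X) (a34 W Y Z X) (a34 W X Z Y).
move: (a34 X Z W Y) (a34 X Y W Z) (a34 Y W X Z) (a34 Y Z W X) (a34 W X Y Z) (a34 Z W X Y).
move: (a34 Y W Z X) (a34 X Z Y W) (a12 Y W Z X) (a12 X Z Y W) (a12 W Y X Z) (a34 W Y X Z).
lra.
Qed.

End TensorAlgebra.

(** Unlike [mxE], these entry rules leave an entry of a matrix product unexpanded. *)
Lemma mx_addE (R : pzRingType) p q (A B : 'M[R]_(p, q)) i j : (A + B) i j = A i j + B i j.
Proof. exact: mxE. Qed.
Lemma mx_oppE (R : pzRingType) p q (A : 'M[R]_(p, q)) i j : (- A) i j = - A i j.
Proof. exact: mxE. Qed.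
Lemma mx_scaleE (R : pzRingType) p q (c : R) (A : 'M[R]_(p, q)) i j :
  (c *: A) i j = c * A i j.
Proof. exact: mxE. Qed.
Lemma mx_0E (R : pzRingType) p q i j : (0 : 'M[R]_(p, q)) i j = 0.
Proof. exact: mxE. Qed.
Lemma mx_trE (R : pzRingType) p q (A : 'M[R]_(p, q)) i j : A^T i j = A j i.
Proof. exact: mxE. Qed.

Definition mx_entryE := (mx_addE, mx_oppE, mx_scaleE, mx_0E).

Lemma trmxD (R : pzRingType) p q (A B : 'M[R]_(p, q)) : (A + B)^T = A^T + B^T.
Proof. exact: linearD. Qed.
Lemma trmxN (R : pzRingType) p q (A : 'M[R]_(p, q)) : (- A)^T = - A^T.
Proof. exact: linearN. Qed.
Lemma trmxZ (R : pzRingType) p q (c : R) (A : 'M[R]_(p, q)) : (c *: A)^T = c *: A^T.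
Proof. exact: linearZ. Qed.

(* [mx_expand_all] followed by [mx_lra] proves noncommutative identities between
   sums of matrix products: the entries of each monomial are atoms for [lra]. *)
Ltac mx_expand_all := rewrite ?(trmx_mul, trmxD, trmxN, trmxZ, trmxK)
  ?(mulmxDl, mulmxDr, mulNmx, mulmxN, mulmxA, mulmx1, mul1mx, mul0mx, mulmx0).
Ltac mx_lra := let a := fresh "a" in let b := fresh "b" in
  apply/matrixP => a b; rewrite ?mx_entryE; lra.

(** For antisymmetric [W], this is dW = 0 in coordinates. *)
Definition pd_cyclic (R : realType) m (W : 'rV[R]_m -> 'M[R]_m) y :=
  forall k i j, pdmx k W y i j + pdmx i W y j k + pdmx j W y k i = 0.

Record kahler_endo (R : realType) m (U : set 'rV[R]_m) (g L : 'rV[R]_m -> 'M[R]_m) : Prop :=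
  KahlerEndo {
  ke_smooth : smooth_mx_on U L;
  ke_sqr : forall y, U y -> L y *m L y = - 1%:M;
  ke_herm : forall y, U y -> L y *m g y *m (L y)^T = g y;
  ke_closed : forall y, U y -> pd_cyclic (fun z => L z *m g z) y }.

(** The interface between the manifold and the local analysis. The relation IJ = K replaces IJK =
    -1, to which it is equivalent given the squares. *)
Record hyperkahler_chart (R : realType) m (U : set 'rV[R]_m)
    (g I J K : 'rV[R]_m -> 'M[R]_m) : Prop := HyperkahlerChart {
  hk_open : open U;
  hk_smooth : smooth_mx_on U g;
  hk_sym : forall y, U y -> (g y)^T = g y;
  hk_unit : forall y, U y -> g y \in unitmx;
  hk_I : kahler_endo U g I;
  hk_J : kahler_endo U g J;
  hk_K : kahler_endo U g K;
  hk_IJ : forall y, U y -> I y *m J y = K y }.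

Definition lowered_christoffel (R : realType) m (g : 'rV[R]_m -> 'M[R]_m) k
    (y : 'rV[R]_m) : 'M[R]_m :=
  \matrix_(i, p) ((pdmx k g y i p + pdmx i g y k p - pdmx p g y k i) / 2).

(* The entry (i, q) of [christoffel g k y] is the Christoffel symbol with lower
   indices k, i and upper index q. *)
HB.lock Definition christoffel (R : realType) m (g : 'rV[R]_m -> 'M[R]_m) k
    (y : 'rV[R]_m) : 'M[R]_m :=
  lowered_christoffel g k y *m invmx (g y).

(** Minus the commutator of the operators \partial_k - \Gamma_k acting on columns of covector
    components, whence the signs of the quadratic terms. *)
HB.lock Definition curvature (R : realType) m (g : 'rV[R]_m -> 'M[R]_m) k l
    (y : 'rV[R]_m) : 'M[R]_m :=
  pdmx k (christoffel g l) y - pdmx l (christoffel g k) y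
  - christoffel g k y *m christoffel g l y + christoffel g l y *m christoffel g k y.

Section LeviCivita.
Variables (R : realType) (m : nat) (U : set 'rV[R]_m).
Variable (g : 'rV[R]_m -> 'M[R]_m).
Hypotheses (oU : open U) (sg : smooth_mx_on U g).
Hypothesis g_sym : forall y, U y -> (g y)^T = g y.
Hypothesis g_unit : forall y, U y -> g y \in unitmx.
Local Notation pt := ('rV[R]_m).

Local Notation lowered_christoffel := (lowered_christoffel g).
Local Notation christoffel := (christoffel g).
Local Notation curvature := (curvature g).

(** Covariant derivatives of tensors of three variances: endomorphisms, covariant 2-tensors and, for
    [nabla_cobil], contravariant 2-tensors such as inverse metrics. *)
Definition nabla_endo k (L : pt -> 'M[R]_m) y :=
  pdmx k L y - christoffel k y *m L y + L y *m christoffel k y.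
Definition nabla_bil k (B : pt -> 'M[R]_m) y :=
  pdmx k B y - christoffel k y *m B y - B y *m (christoffel k y)^T.
Definition nabla_cobil k (P : pt -> 'M[R]_m) y :=
  pdmx k P y + (christoffel k y)^T *m P y + P y *m christoffel k y.

Lemma pd_metric_sym k y i j : U y -> pdmx k g y i j = pdmx k g y j i.
Proof.
move=> Uy; rewrite -[RHS]mx_trE -pdmxT.
by rewrite (pdmx_eq_on oU k Uy (B := g)).
Qed.

Lemma lowered_christoffel_sym k i p y : U y ->
  lowered_christoffel k y i p = lowered_christoffel i y k p.
Proof. by move=> Uy; rewrite !mxE (pd_metric_sym p k i Uy); lra. Qed.

Lemma christoffel_sym k i q y : U y -> christoffel k y i q = christoffel i y k q.
Proof.
move=> Uy; rewrite christoffel.unlock mxE [RHS]mxE; apply: eq_bigr => p _.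
by rewrite lowered_christoffel_sym.
Qed.

Lemma smooth_christoffel k : smooth_mx_on U (christoffel k).
Proof.
rewrite christoffel.unlock; apply: smooth_mxM => //; last exact: smooth_invmx.
have sp j a b := smooth_mx_pdmx oU j sg a b.
move=> i p.
apply: (@smooth_eq_on _ _ _ (fun y => (pdmx k g y i p + pdmx i g y k p - pdmx p g y k i) / 2)) => //.
  by move=> z _; rewrite mxE.
apply: smoothM => //; last exact: smooth_cst.
by apply: smoothB => //; apply: smoothD.
Qed.

Lemma pdmx_metric k y : U y ->
  pdmx k g y = christoffel k y *m g y + g y *m (christoffel k y)^T.
Proof.
move=> Uy; have gu := g_unit Uy.
rewrite christoffel.unlock trmx_mul trmx_inv g_sym // mulmxA mulmxV // mul1mx.
rewrite -mulmxA mulVmx // mulmx1.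
apply/matrixP => i p; rewrite !mxE (pd_metric_sym k p i Uy); lra.
Qed.

Lemma pdmx_inv_metric k y : U y ->
  pdmx k (fun z => invmx (g z)) y =
  - (invmx (g y) *m christoffel k y) - (christoffel k y)^T *m invmx (g y).
Proof.
move=> Uy; have gu := g_unit Uy.
rewrite (pdmx_invmx oU k Uy g_unit sg) pdmx_metric // mulmxDr mulmxDl.
by rewrite [_ *m (_ *m g y)]mulmxA mulmxK // !mulmxA mulVmx // mul1mx opprD.
Qed.

Lemma curvature_anti k l y : curvature l k y = - curvature k l y.
Proof. by rewrite curvature.unlock; mx_lra. Qed.

(** The second derivatives of g, computed by differentiating metric compatibility, must commute; the
    terms of first order cancel and the skewness remains. *)
Lemma curvature_skew k l y : U y ->
  curvature k l y *m g y = - (g y *m (curvature k l y)^T).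
Proof.
move=> Uy; have sG := smooth_christoffel.
have E a b : pdmx b (pdmx a g) y =
   pdmx b (christoffel a) y *m g y + christoffel a y *m pdmx b g y
   + (pdmx b g y *m (christoffel a y)^T + g y *m (pdmx b (christoffel a) y)^T).
  rewrite (pdmx_eq_on oU b Uy (@pdmx_metric a)).
  have sGT := smooth_mxT oU (sG a).
  rewrite (pdmxD _ Uy (smooth_mxM oU (sG a) sg) (smooth_mxM oU sg sGT)).
  by rewrite (pdmxM oU _ Uy (sG a) sg) (pdmxM oU _ Uy sg sGT) pdmxT.
have := schwarz_mx oU k l Uy sg; rewrite !E !pdmx_metric // curvature.unlock.
mx_expand_all => /matrixP H; apply/matrixP => a b; move: (H a b).
rewrite !mx_entryE; lra.
Qed.

(** Integrability condition of \nabla L = 0, again from the equality of mixed second derivatives. *)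
Lemma curvature_commute L k l y : U y -> smooth_mx_on U L ->
  (forall a z, U z -> nabla_endo a L z = 0) ->
  curvature k l y *m L y = L y *m curvature k l y.
Proof.
move=> Uy sL nL; have sG := smooth_christoffel.
have pL a z : U z -> pdmx a L z = christoffel a z *m L z - L z *m christoffel a z.
  move=> /(nL a) /eqP; rewrite /nabla_endo addr_eq0 => /eqP H.
  by rewrite -[LHS](subrK (christoffel a z *m L z)) H addrC.
have E a b : pdmx b (pdmx a L) y =
   pdmx b (christoffel a) y *m L y + christoffel a y *m pdmx b L y
   - (pdmx b L y *m christoffel a y + L y *m pdmx b (christoffel a) y).
  rewrite (pdmx_eq_on oU b Uy (pL a)).
  rewrite (pdmxB oU _ Uy (smooth_mxM oU (sG a) sL) (smooth_mxM oU sL (sG a))).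
  by rewrite (pdmxM oU _ Uy (sG a) sL) (pdmxM oU _ Uy sL (sG a)).
have := schwarz_mx oU k l Uy sL; rewrite !E !pL // curvature.unlock.
mx_expand_all => /matrixP H; apply/matrixP => a b; move: (H a b).
rewrite !mx_entryE; lra.
Qed.

Lemma curvature_bianchi k l i q y : U y ->
  curvature k l y i q + curvature l i y k q + curvature i k y l q = 0.
Proof.
move=> Uy.
have pS a b c : pdmx a (christoffel b) y c q = pdmx a (christoffel c) y b q.
  rewrite !pdmxE; apply: (pderiv_eq_on _ oU Uy) => z Uz.
  exact: christoffel_sym.
have mS a b c : (christoffel a y *m christoffel b y) c q =
                (christoffel c y *m christoffel b y) a q.
  by rewrite mxE [RHS]mxE; apply: eq_bigr => p _; rewrite christoffel_sym.
rewrite curvature.unlock !mx_entryE.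
move: (pS k l i) (pS l k i) (pS i k l) (mS k l i) (mS l k i) (mS l i k); lra.
Qed.

(** The connection is torsion-free, so the Christoffel terms cancel in the cyclic sum and closedness
    can be read on covariant derivatives. *)
Lemma nabla_bil_cyclic (W : pt -> 'M[R]_m) y : U y ->
  (W y)^T = - W y -> pd_cyclic W y ->
  forall k i j, nabla_bil k W y i j + nabla_bil i W y j k + nabla_bil j W y k i = 0.
Proof.
move=> Uy Wa Wc k i j.
have T a b c : (W y *m (christoffel a y)^T) b c = - (christoffel a y *m W y) c b.
  rewrite -[LHS]mx_trE trmx_mul trmxK Wa mulmxN mx_oppE; by [].
have S a b c : (christoffel a y *m W y) b c = (christoffel b y *m W y) a c.
  by rewrite mxE [RHS]mxE; apply: eq_bigr => p _; rewrite christoffel_sym.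
rewrite /nabla_bil !mx_entryE !T.
move: (Wc k i j) (S k i j) (S k j i) (S i j k); lra.
Qed.

Lemma nabla_bil_endo k (L B : pt -> 'M[R]_m) y : U y ->
  smooth_mx_on U L -> smooth_mx_on U B ->
  nabla_bil k (fun z => L z *m B z) y = nabla_endo k L y *m B y + L y *m nabla_bil k B y.
Proof.
by move=> Uy sL sB; rewrite /nabla_bil /nabla_endo (pdmxM oU _ Uy sL sB); mx_expand_all; mx_lra.
Qed.

Lemma nabla_endoM k (L M : pt -> 'M[R]_m) y : U y ->
  smooth_mx_on U L -> smooth_mx_on U M ->
  nabla_endo k (fun z => L z *m M z) y = nabla_endo k L y *m M y + L y *m nabla_endo k M y.
Proof.
by move=> Uy sL sB; rewrite /nabla_endo (pdmxM oU _ Uy sL sB); mx_expand_all; mx_lra.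
Qed.

Lemma nabla_metric k y : U y -> nabla_bil k g y = 0.
Proof. by move=> Uy; rewrite /nabla_bil pdmx_metric //; mx_lra. Qed.

End LeviCivita.

Section Trilinear.
Variables (R : realType) (m : nat).

Lemma rotate_sum3 (F : 'I_m -> 'I_m -> 'I_m -> R) :
  \sum_k \sum_i \sum_j F i j k = \sum_k \sum_i \sum_j F k i j.
Proof.
by rewrite exchange_big; apply: eq_bigr => i _; rewrite exchange_big.
Qed.

(** Turns a family of matrices into a function of three vectors, in which X *m L may be substituted
    for X; the abstract lemmas on tensors are stated for such functions. *)
Definition trilinear (T : 'I_m -> 'M[R]_m) (X Y Z : 'rV[R]_m) : R :=
  \sum_k X 0 k * (Y *m T k *m Z^T) 0 0.

Lemma bilinearE (B : 'M[R]_m) (X Y : 'rV[R]_m) :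
  (X *m B *m Y^T) 0 0 = \sum_i \sum_j X 0 i * Y 0 j * B i j.
Proof.
rewrite mxE exchange_big; apply: eq_bigr => j _.
rewrite !mxE big_distrl; apply: eq_bigr => i _; rewrite /=; ring.
Qed.

Lemma trilinearE T X Y Z :
  trilinear T X Y Z = \sum_k \sum_i \sum_j X 0 k * (Y 0 i * Z 0 j * T k i j).
Proof.
apply: eq_bigr => k _; rewrite bilinearE big_distrr; apply: eq_bigr => i _.
by rewrite big_distrr.
Qed.

Lemma trilinear_cyclic (T : 'I_m -> 'M[R]_m) :
  (forall k i j, T k i j + T i j k + T j k i = 0) ->
  forall X Y Z, trilinear T X Y Z + trilinear T Y Z X + trilinear T Z X Y = 0.
Proof.
move=> cT X Y Z; rewrite !trilinearE.
rewrite -[X in _ + X + _]rotate_sum3 -[X in _ + X]rotate_sum3 -[X in _ + X]rotate_sum3.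
rewrite -!big_split big1 // => k _ /=; rewrite -!big_split big1 // => i _ /=.
rewrite -!big_split big1 // => j _ /=.
rewrite -[RHS](mulr0 (X 0 k * Y 0 i * Z 0 j)) -(cT k i j); ring.
Qed.

Lemma trilinear_anti (T : 'I_m -> 'M[R]_m) : (forall k, (T k)^T = - T k) ->
  forall X Y Z, trilinear T X Z Y = - trilinear T X Y Z.
Proof.
move=> aT X Y Z; rewrite /trilinear -sumrN; apply: eq_bigr => k _.
rewrite -mulrN -[(Z *m _ *m _) 0 0]mx_trE !trmx_mul trmxK aT mulNmx mulmxN mulmxA.
by rewrite mx_oppE.
Qed.

Lemma trilinear_mid (T : 'I_m -> 'M[R]_m) A X Y Z :
  trilinear T X (Y *m A) Z = trilinear (fun k => A *m T k) X Y Z.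
Proof. by apply: eq_bigr => k _; rewrite !mulmxA. Qed.

Lemma trilinear_last (T : 'I_m -> 'M[R]_m) A X Y Z :
  trilinear T X Y (Z *m A) = trilinear (fun k => T k *m A^T) X Y Z.
Proof. by apply: eq_bigr => k _; rewrite trmx_mul !mulmxA. Qed.

Lemma trilinearN (T : 'I_m -> 'M[R]_m) X Y Z :
  trilinear (fun k => - T k) X Y Z = - trilinear T X Y Z.
Proof.
by rewrite /trilinear -sumrN; apply: eq_bigr => k _; rewrite mulmxN mulNmx mx_oppE mulrN.
Qed.

Lemma trilinearD (T T' : 'I_m -> 'M[R]_m) X Y Z :
  trilinear (fun k => T k + T' k) X Y Z = trilinear T X Y Z + trilinear T' X Y Z.
Proof.
rewrite /trilinear -big_split; apply: eq_bigr => k _ /=.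
by rewrite mulmxDr mulmxDl mx_addE mulrDr.
Qed.

Lemma eq_trilinear (T T' : 'I_m -> 'M[R]_m) X Y Z : (forall k, T k = T' k) ->
  trilinear T X Y Z = trilinear T' X Y Z.
Proof. by move=> TT'; apply: eq_bigr => k _; rewrite TT'. Qed.

Lemma trilinear_eq0 (T : 'I_m -> 'M[R]_m) :
  (forall X Y Z, trilinear T X Y Z = 0) -> forall k, T k = 0.
Proof.
move=> T0 k; apply/matrixP => i j; have := T0 (delta_mx 0 k) (delta_mx 0 i) (delta_mx 0 j).
rewrite /trilinear (bigD1 k) //= big1 ?addr0 => [|l /negPf lk]; last first.
  by rewrite mxE lk andbF mul0r.
by rewrite mxE !eqxx mul1r -rowE trmx_delta -colE !mxE.
Qed.

Lemma trilinearN1 (T : 'I_m -> 'M[R]_m) X Y Z :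
  trilinear T (- X) Y Z = - trilinear T X Y Z.
Proof.
by rewrite /trilinear -sumrN; apply: eq_bigr => k _; rewrite mx_oppE mulNr.
Qed.

Lemma trilinearN2 (T : 'I_m -> 'M[R]_m) X Y Z :
  trilinear T X (- Y) Z = - trilinear T X Y Z.
Proof.
by rewrite /trilinear -sumrN; apply: eq_bigr => k _; rewrite !mulNmx mx_oppE mulrN.
Qed.

Lemma trilinearN3 (T : 'I_m -> 'M[R]_m) X Y Z :
  trilinear T X Y (- Z) = - trilinear T X Y Z.
Proof.
by rewrite /trilinear -sumrN; apply: eq_bigr => k _; rewrite trmxN mulmxN mx_oppE mulrN.
Qed.

End Trilinear.

(** * Parallelism of I, J and K *)

Section HyperkahlerParallel.
Variables (R : realType) (m : nat).
Local Notation pt := ('rV[R]_m).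

Lemma kahler_form_anti (U : set pt) (g L : pt -> 'M[R]_m) y : U y ->
  (g y)^T = g y -> kahler_endo U g L -> g y *m (L y)^T = - (L y *m g y).
Proof.
move=> Uy gs kL; have := congr1 (mulmx (L y)) (ke_herm kL Uy).
by rewrite !mulmxA (ke_sqr kL Uy) !mulNmx mul1mx => /eqP; rewrite eqr_oppLR => /eqP.
Qed.

Lemma quaternion_rel (I J K : 'M[R]_m) : I *m I = - 1%:M -> J *m J = - 1%:M ->
  K *m K = - 1%:M -> I *m J = K ->
  [/\ J *m I = - K, J *m K = I, K *m J = - I, K *m I = J & I *m K = - J].
Proof.
move=> II JJ KK IJ.
have KJ : K *m J = - I by rewrite -IJ -mulmxA JJ mulmxN mulmx1.
have IK : I *m K = - J by rewrite -IJ mulmxA II mulNmx mul1mx.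
have JK : J *m K = I.
  have : I *m (K *m K) = - I by rewrite KK mulmxN mulmx1.
  by rewrite mulmxA IK mulNmx => /oppr_inj.
have JI : J *m I = - K by rewrite -JK mulmxA JJ mulNmx mul1mx.
by split=> //; rewrite -IJ -mulmxA JI mulmxN IK opprK.
Qed.

Lemma hyperkahler_chart_quaternion (U : set pt) (g I J K : pt -> 'M[R]_m) y : U y ->
  hyperkahler_chart U g I J K ->
  [/\ J y *m I y = - K y, J y *m K y = I y, K y *m J y = - I y, K y *m I y = J y
    & I y *m K y = - J y].
Proof.
move=> Uy [oU sg gs gu kI kJ kK IJ].
by apply: quaternion_rel; [exact: ke_sqr kI _ Uy|exact: ke_sqr kJ _ Uy|
  exact: ke_sqr kK _ Uy|exact: IJ].
Qed.

(** Whatever is proved for the first structure then holds for the other two. *)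
Lemma hyperkahler_chart_rotate (U : set pt) (g I J K : pt -> 'M[R]_m) :
  hyperkahler_chart U g I J K -> hyperkahler_chart U g J K I.
Proof.
move=> hk; have [oU sg gs gu kI kJ kK IJ] := hk; split=> // y Uy.
by have [] := hyperkahler_chart_quaternion Uy hk.
Qed.

(** Since g is parallel, the covariant derivative of the Kähler form of L is (\nabla L) g.
    Antisymmetry and closedness of the three forms, with the derivatives of L^2 = -1 and IJ = K, are
    the hypotheses of [closed_triple_parallel]. *)
Lemma hyperkahler_parallel_first (U : set pt) (g I J K : pt -> 'M[R]_m) k y :
  hyperkahler_chart U g I J K -> U y -> nabla_endo g k I y = 0.
Proof.
move=> hk Uy; have [oU sg gs gu kI kJ kK IJ] := hk.
have [JI JK KJ KI IK] := hyperkahler_chart_quaternion Uy hk.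
have gy := gs y Uy; have ku := gu y Uy.
pose A L k := nabla_bil g k (fun z => L z *m g z) y.
have AE L : kahler_endo U g L -> forall k, A L k = nabla_endo g k L y *m g y.
  move=> kL l; rewrite /A (nabla_bil_endo g oU l Uy (ke_smooth kL) sg).
  by rewrite (nabla_metric oU gs gu) // mulmx0 addr0.
have anti L : kahler_endo U g L -> forall z, U z -> (L z *m g z)^T = - (L z *m g z).
  by move=> kL z Uz; rewrite trmx_mul (gs z Uz) (kahler_form_anti Uz (gs z Uz) kL).
have cA L : kahler_endo U g L -> forall X Y Z,
    trilinear (A L) X Y Z + trilinear (A L) Y Z X + trilinear (A L) Z X Y = 0.
  move=> kL; apply: trilinear_cyclic; apply: (nabla_bil_cyclic oU) => //.
    exact: anti.
  exact: ke_closed kL _ Uy.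
have tA L : kahler_endo U g L -> forall X Y Z,
    trilinear (A L) X Z Y = - trilinear (A L) X Y Z.
  move=> kL; apply: trilinear_anti => l.
  have sLg := smooth_mxM oU (ke_smooth kL) sg.
  have pT : (pdmx l (fun z => L z *m g z) y)^T = - pdmx l (fun z => L z *m g z) y.
    by rewrite -pdmxT -(pdmxN l Uy sLg); apply: (pdmx_eq_on oU l Uy) => z /(anti _ kL).
  rewrite /A /nabla_bil !(trmxD, trmxN) pT trmx_mul [((_ *m _) *m _)^T]trmx_mul trmxK (anti _ kL _ Uy).
  by rewrite mulNmx mulmxN; mx_lra.
(* Differentiating L^2 = -1 shows that L and \nabla L anticommute; moving L across g costs a second
   sign. *)
have swap L : kahler_endo U g L -> forall k, L y *m A L k = A L k *m (L y)^T.
  move=> kL l; rewrite AE // -[RHS]mulmxA (kahler_form_anti Uy gy kL) mulmxN !mulmxA -mulNmx.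
  congr (_ *m _); apply/eqP; rewrite -addr_eq0 addrC; apply/eqP.
  rewrite -(nabla_endoM g oU l Uy (ke_smooth kL) (ke_smooth kL)) /nabla_endo.
  rewrite (pdmx_eq_on oU l Uy (B := fun=> - 1%:M)) => [|z Uz]; last exact: ke_sqr kL _ Uz.
  rewrite pdmx_cst (ke_sqr kL Uy) mulmxN mulNmx mulmx1 mul1mx; mx_lra.
(* The derivative of K = IJ, with J g = - g J^T. *)
have relK l : A K l = I y *m A J l - A I l *m (J y)^T.
  rewrite !AE // -[X in _ - X]mulmxA (kahler_form_anti Uy gy kJ) mulmxN opprK !mulmxA -mulmxDl.
  congr (_ *m _); rewrite addrC.
  rewrite -(nabla_endoM g oU l Uy (ke_smooth kI) (ke_smooth kJ)) /nabla_endo.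
  rewrite (IJ _ Uy); congr (_ - _ + _); apply: (pdmx_eq_on oU l Uy) => z Uz.
  by rewrite IJ.
have II := ke_sqr kI Uy; have JJ := ke_sqr kJ Uy.
have II2 (X : 'rV[R]_m) : X *m I y *m I y = - X by rewrite -mulmxA II mulmxN mulmx1.
have JJ2 (X : 'rV[R]_m) : X *m J y *m J y = - X by rewrite -mulmxA JJ mulmxN mulmx1.
have A0 := @closed_triple_parallel _ _ (fun X => X *m I y) (fun X => X *m J y)
  (trilinear (A I)) (trilinear (A J)) (trilinear (A K))
  (tA _ kI) (tA _ kJ) (tA _ kK) (cA _ kI) (cA _ kJ) (cA _ kK).
have {}A0 : A I k = 0.
  apply: trilinear_eq0; apply: A0 => X Y Z.
  - by rewrite trilinear_mid trilinear_last; apply: eq_trilinear => l; exact: swap.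
  - rewrite trilinear_mid trilinear_last -trilinearN -trilinearD.
    by apply: eq_trilinear => l; rewrite relK.
  - by rewrite II2 trilinearN2.
  - by rewrite II2 trilinearN3.
  - by rewrite II2 trilinearN1.
  - by rewrite -!mulmxA IJ // JI mulmxN trilinearN3.
  - by rewrite JJ2 trilinearN3.
by apply: (can_inj (mulmxK ku)); rewrite /= -AE // A0 mul0mx.
Qed.

Lemma hyperkahler_parallel (U : set pt) (g I J K : pt -> 'M[R]_m) k y :
  hyperkahler_chart U g I J K -> U y ->
  [/\ nabla_endo g k I y = 0, nabla_endo g k J y = 0 & nabla_endo g k K y = 0].
Proof.
move=> hk Uy; have hk1 := hyperkahler_chart_rotate hk.
have hk2 := hyperkahler_chart_rotate hk1.
by split; [exact: hyperkahler_parallel_first hk Uy|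
  exact: hyperkahler_parallel_first hk1 Uy|exact: hyperkahler_parallel_first hk2 Uy].
Qed.

Lemma hyperkahler_curvature_commute (U : set pt) (g I J K : pt -> 'M[R]_m) k l y :
  hyperkahler_chart U g I J K -> U y ->
  curvature g k l y *m I y = I y *m curvature g k l y /\
  curvature g k l y *m J y = J y *m curvature g k l y.
Proof.
move=> hk Uy; have [oU sg gs gu kI kJ kK IJ] := hk.
have nI a z : U z -> nabla_endo g a I z = 0.
  by move=> Uz; have [] := hyperkahler_parallel a hk Uz.
have nJ a z : U z -> nabla_endo g a J z = 0.
  by move=> Uz; have [] := hyperkahler_parallel a hk Uz.
by split; [exact: (curvature_commute oU sg gu k l Uy (ke_smooth kI) nI)|
  exact: (curvature_commute oU sg gu k l Uy (ke_smooth kJ) nJ)].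
Qed.

Lemma bilinear_ext (A B : 'M[R]_m) :
  (forall x y : 'rV[R]_m, (x *m A *m y^T) 0 0 = (x *m B *m y^T) 0 0) -> A = B.
Proof.
move=> AB; apply/matrixP => i j; have := AB (delta_mx 0 i) (delta_mx 0 j).
by rewrite -!rowE trmx_delta -!colE !mxE.
Qed.

(** * Contraction of the curvature with invariant tensors *)

Section Contraction.
Variables (U : set pt) (g I J K : pt -> 'M[R]_m) (y : pt).
Hypotheses (hk : hyperkahler_chart U g I J K) (Uy : U y).

Definition riemann (X Y Z W : 'rV[R]_m) : R :=
  \sum_k X 0 k * trilinear (fun l => curvature g k l y *m g y) Y Z W.

(** Two partial evaluations of the same tensor: with W and the first index frozen, Bianchi becomes
    [trilinear_cyclic]; with Z and W frozen ([riemann12]), antisymmetry in the first pair becomes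
    that of a matrix. *)
Definition riemann23 (W : 'rV[R]_m) k : 'M[R]_m :=
  \matrix_(l, i) (curvature g k l y *m (g y *m W^T)) i 0.

Definition riemann12 (Z W : 'rV[R]_m) : 'M[R]_m :=
  \matrix_(k, l) (Z *m (curvature g k l y *m g y) *m W^T) 0 0.

Lemma riemann12E Z W k l :
  riemann12 Z W k l = (Z *m (curvature g k l y *m g y) *m W^T) 0 0.
Proof. by rewrite mxE. Qed.

Lemma riemannE12 X Y Z W : riemann X Y Z W = (X *m riemann12 Z W *m Y^T) 0 0.
Proof.
rewrite bilinearE; apply: eq_bigr => k _; rewrite big_distrr; apply: eq_bigr => l _.
by rewrite /= !mxE mulrA.
Qed.

Lemma riemannE23 X Y Z W : riemann X Y Z W = trilinear (riemann23 W) X Y Z.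
Proof.
apply: eq_bigr => k _; rewrite bilinearE; congr (_ * _); apply: eq_bigr => l _.
rewrite -!mulmxA mxE big_distrr; apply: eq_bigr => i _.
by rewrite [riemann23 _ _ _ _]mxE; exact: mulrA.
Qed.

Lemma riemann_anti12 X Y Z W : riemann Y X Z W = - riemann X Y Z W.
Proof.
have A : (riemann12 Z W)^T = - riemann12 Z W.
  apply/matrixP => k l; rewrite mx_oppE mx_trE !riemann12E curvature_anti.
  by rewrite mulNmx mulmxN mulNmx mx_oppE.
rewrite !riemannE12 -[LHS]mx_trE !trmx_mul trmxK mulmxA A mulmxN mulNmx mx_oppE.
by [].
Qed.

Lemma riemann_anti34 X Y Z W : riemann X Y W Z = - riemann X Y Z W.
Proof.
have [oU sg gs gu _ _ _ _] := hk.
rewrite /riemann -sumrN; apply: eq_bigr => k _; rewrite -mulrN; congr (_ * _).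
apply: trilinear_anti => l; rewrite trmx_mul gs //.
by rewrite (curvature_skew oU sg gs gu) // opprK.
Qed.

Lemma riemann_bianchi X Y Z W :
  riemann X Y Z W + riemann Y Z X W + riemann Z X Y W = 0.
Proof.
have [oU sg gs gu _ _ _ _] := hk.
rewrite !riemannE23; apply: trilinear_cyclic => k l i; rewrite !mxE -!big_split /=.
rewrite big1 // => q _; rewrite -!mulrDl.
by rewrite (curvature_bianchi oU gs) // mul0r.
Qed.

Lemma riemann_commute X Y Z W L : kahler_endo U g L ->
  (forall k l, curvature g k l y *m L y = L y *m curvature g k l y) ->
  riemann X Y (Z *m L y) (W *m L y) = riemann X Y Z W.
Proof.
move=> kL cL; rewrite !riemannE12; congr ((_ *m _ *m _) 0 0).
apply/matrixP => k l; rewrite !riemann12E; congr (fun_of_matrix _ 0 0).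
rewrite trmx_mul !mulmxA -[Z *m _ *m _]mulmxA -cL.
by rewrite -!mulmxA [L y *m (_ *m (_ *m _))]mulmxA [L y *m _ *m _]mulmxA (ke_herm kL Uy).
Qed.

Lemma riemann_pair_sym X Y Z W : riemann X Y Z W = riemann Z W X Y.
Proof.
exact: (curvature_pair_sym riemann_anti12 riemann_anti34 riemann_bianchi).
Qed.

(* With c the contraction over a, b with P, Bianchi turns 2 c(R(X, a, b, W)) into
   c(R(aI, b, X, WI)), and replacing (a, b) by (aJ, bJ) changes the sign of the
   latter, as IJ = -JI and R(aJ, bJ, ., .) = R(a, b, ., .). *)
Lemma curvature_contraction (P : 'M[R]_m) k q : P^T = P ->
  (I y)^T *m P *m I y = P -> (J y)^T *m P *m J y = P ->
  \sum_i (P *m curvature g k i y) i q = 0.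
Proof.
move=> Ps PI PJ; have [oU sg gs gu kI kJ kK IJ] := hk.
have cI k' l : curvature g k' l y *m I y = I y *m curvature g k' l y.
  by have [] := hyperkahler_curvature_commute k' l hk Uy.
have cJ k' l : curvature g k' l y *m J y = J y *m curvature g k' l y.
  by have [] := hyperkahler_curvature_commute k' l hk Uy.
have [JI _ _ _ _] := hyperkahler_chart_quaternion Uy hk.
pose X : 'rV[R]_m := delta_mx 0 k.
(* With this [W] the metric inside [riemann] cancels, so that R(., ., ., W) reads column q of the
   curvature matrices. *)
pose W : 'rV[R]_m := (invmx (g y) *m delta_mx q 0)^T.
pose beta := riemann23 W k.
have betaE Y Z : riemann X Y Z W = (Y *m beta *m Z^T) 0 0.
  rewrite riemannE23 /trilinear (bigD1 k) //= big1 ?addr0 => [|l /negPf lk].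
    by rewrite mxE !eqxx mul1r.
  by rewrite mxE lk andbF mul0r.
pose gamma := riemann12 X (W *m I y).
have contr (L B : 'M[R]_m) : L^T *m P *m L = P -> \tr (P *m (L *m B *m L^T)) = \tr (P *m B).
  move=> PL; rewrite -{2}PL !mulmxA mxtrace_mulC !mulmxA.
  by [].
have II (Z : 'rV[R]_m) : Z *m I y *m I y = - Z.
  by rewrite -mulmxA (ke_sqr kI Uy) mulmxN mulmx1.
have r4N A B C D : riemann A B C (- D) = - riemann A B C D.
  rewrite /riemann -sumrN; apply: eq_bigr => l _; by rewrite trilinearN3 mulrN.
have E1 : I y *m beta *m (I y)^T = I y *m gamma - beta^T.
  apply: bilinear_ext => a b.
  rewrite mulmxDr mulmxDl mx_addE mulmxN mulNmx mx_oppE.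
  have -> : (a *m (I y *m beta *m (I y)^T) *m b^T) 0 0 = riemann X (a *m I y) (b *m I y) W.
    by rewrite betaE trmx_mul !mulmxA.
  have -> : (a *m (I y *m gamma) *m b^T) 0 0 = riemann (a *m I y) b X (W *m I y).
    by rewrite riemannE12 !mulmxA.
  have -> : (a *m beta^T *m b^T) 0 0 = riemann X b a W.
    by rewrite betaE -[LHS]mx_trE !trmx_mul !trmxK mulmxA.
  have h1 : riemann X (a *m I y) (b *m I y) W = - riemann X (a *m I y) b (W *m I y).
    by rewrite -(riemann_commute X (a *m I y) (b *m I y) W kI cI) II -[LHS]opprK -r4N
               (riemann_anti34 _ _ _ (- b)) !r4N -riemann_anti34 opprK.
  have h2 := riemann_bianchi X (a *m I y) b (W *m I y).
  have h3 : riemann b X (a *m I y) (W *m I y) = riemann b X a W by exact: riemann_commute.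
  have h4 := riemann_anti12 X b a W.
  move: h1 h2 h3 h4; lra.
have E2 : J y *m (I y *m gamma) *m (J y)^T = - (I y *m gamma).
  rewrite mulmxA JI -IJ // !mulNmx; congr (- _); rewrite -!mulmxA; congr (_ *m _).
  rewrite mulmxA; apply: bilinear_ext => a b.
  have -> : (a *m (J y *m gamma *m (J y)^T) *m b^T) 0 0 =
    riemann (a *m J y) (b *m J y) X (W *m I y) by rewrite riemannE12 trmx_mul !mulmxA.
  by rewrite riemann_pair_sym riemann_commute // riemann_pair_sym riemannE12.
have T2 : \tr (P *m (I y *m gamma)) = 0.
  by have := contr (J y) (I y *m gamma) PJ; rewrite E2 mulmxN linearN /=; lra.
have T1 : \tr (P *m beta) = 0.
  have := contr (I y) beta PI; rewrite E1 mulmxDr mulmxN linearD linearN /= T2.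
  have -> : \tr (P *m beta^T) = \tr (P *m beta).
    by rewrite -mxtrace_tr trmx_mul trmxK Ps mxtrace_mulC.
  lra.
have -> : \sum_i (P *m curvature g k i y) i q = \tr (P *m beta^T).
  apply: eq_bigr => i _; rewrite !mxE; apply: eq_bigr => j _; congr (_ * _).
  rewrite mx_trE [RHS]mxE /W trmxK mulKVmx ?gu // -colE.
  by rewrite [RHS]mxE.
by rewrite -mxtrace_tr trmx_mul trmxK Ps mxtrace_mulC.
Qed.

End Contraction.
End HyperkahlerParallel.

(** * The Bochner inequality *)

HB.lock Definition hess (R : realType) m (g : 'rV[R]_m -> 'M[R]_m) (u : 'rV[R]_m -> R)
    (y : 'rV[R]_m) : 'M[R]_m :=
  \matrix_(k, i) (pderiv k (pderiv i u) y - \sum_q christoffel g k y i q * pderiv q u y).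

HB.lock Definition nabla_hess (R : realType) m (g : 'rV[R]_m -> 'M[R]_m)
    (u : 'rV[R]_m -> R) i (y : 'rV[R]_m) : 'M[R]_m := nabla_bil g i (hess g u) y.

Section Hessian.
Variables (R : realType) (m : nat) (U : set 'rV[R]_m) (g : 'rV[R]_m -> 'M[R]_m).
Hypotheses (oU : open U) (sg : smooth_mx_on U g).
Hypothesis g_sym : forall y, U y -> (g y)^T = g y.
Hypothesis g_unit : forall y, U y -> g y \in unitmx.
Local Notation pt := ('rV[R]_m).
Local Notation Gamma := (christoffel g).

Local Notation hess := (hess g).
Local Notation nabla_hess := (nabla_hess g).

Variable u : pt -> R.
Hypothesis su : smooth_on U u.

Lemma hessE y k i :
  hess u y k i = pderiv k (pderiv i u) y - \sum_q Gamma k y i q * pderiv q u y.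
Proof. by rewrite hess.unlock mxE. Qed.

Lemma hess_sym y : U y -> (hess u y)^T = hess u y.
Proof.
move=> Uy; apply/matrixP => k i; rewrite mx_trE !hessE (schwarz _ _ oU Uy su).
by congr (_ - _); apply: eq_bigr => q _; rewrite (christoffel_sym oU g_sym).
Qed.

Lemma smooth_hess : smooth_mx_on U (hess u).
Proof.
move=> k i; apply: (@smooth_eq_on _ _ _ (fun y =>
  pderiv k (pderiv i u) y - \sum_q Gamma k y i q * pderiv q u y)) => //.
  by move=> z _; rewrite hessE.
apply: smoothB => //; first by do 2!apply: smooth_pderiv.
apply: smooth_sum => // q _; apply: smoothM => //; last exact: smooth_pderiv.
exact: smooth_christoffel.
Qed.

Lemma smooth_gradient : smooth_mx_on U (gradient u).
Proof.
move=> i j; apply: smooth_eq_on (smooth_pderiv i su) => // z _.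
by rewrite mxE.
Qed.

(** Row i of the Hessian as the covariant derivative of the column du, a form to which the matrix
    rules of differentiation apply. *)
Definition hess_row i (y : pt) : 'cV[R]_m :=
  pdmx i (gradient u) y - Gamma i y *m gradient u y.

Lemma hess_rowE i y j : hess_row i y j 0 = hess u y i j.
Proof.
rewrite mx_addE mx_oppE pdmxE hessE [(_ *m _) j 0]mxE; congr (_ - _).
  by apply: pderiv_ext => z; rewrite mxE.
by apply: eq_bigr => q _; rewrite [gradient _ _ _ _]mxE.
Qed.

(** The Ricci identity for the covector du. *)
Lemma nabla_hess_commutator k i j y : U y ->
  nabla_hess u k y i j - nabla_hess u i y k j
  = - (curvature g k i y *m gradient u y) j 0.
Proof.
move=> Uy; have sG := smooth_christoffel oU sg g_unit; have sp := smooth_gradient.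
have T a b : (hess u y *m (Gamma a y)^T) b j = (Gamma a y *m hess_row b y) j 0.
  rewrite mxE [RHS]mxE; apply: eq_bigr => q _.
  by rewrite hess_rowE mx_trE mulrC.
have S a b : (Gamma a y *m hess u y) b j = (Gamma b y *m hess u y) a j.
  by rewrite mxE [RHS]mxE; apply: eq_bigr => p _; rewrite (christoffel_sym oU g_sym).
have D a b : pdmx a (hess u) y b j = pdmx a (hess_row b) y j 0.
  by rewrite !pdmxE; apply: pderiv_ext => z; rewrite hess_rowE.
have E a b : pdmx a (hess_row b) y = pdmx a (pdmx b (gradient u)) y
    - (pdmx a (Gamma b) y *m gradient u y + Gamma b y *m pdmx a (gradient u) y).
  rewrite (pdmxB oU _ Uy (smooth_mx_pdmx oU b sp) (smooth_mxM oU (sG b) sp)).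
  by rewrite (pdmxM oU _ Uy (sG b) sp).
have SW := schwarz_mx oU k i Uy sp.
rewrite nabla_hess.unlock /nabla_bil !(mx_addE, mx_oppE) !T !D !E (S k i) /hess_row SW curvature.unlock.
by mx_expand_all; rewrite !mx_entryE; lra.
Qed.

Lemma nabla_hess_sym i y : U y -> (nabla_hess u i y)^T = nabla_hess u i y.
Proof.
move=> Uy; rewrite nabla_hess.unlock /nabla_bil !(trmxD, trmxN) !trmx_mul trmxK hess_sym //.
have -> : (pdmx i (hess u) y)^T = pdmx i (hess u) y.
  by rewrite -pdmxT; apply: (pdmx_eq_on oU i Uy) => z /hess_sym.
by mx_lra.
Qed.

Lemma smooth_nabla_hess i : smooth_mx_on U (nabla_hess u i).
Proof.
have sG := smooth_christoffel oU sg g_unit i; have sh := smooth_hess.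
rewrite nabla_hess.unlock.
apply: smooth_mxB => //; last by apply: smooth_mxM => //; exact: smooth_mxT.
by apply: smooth_mxB => //; [exact: smooth_mx_pdmx|exact: smooth_mxM].
Qed.

Definition nabla2_hess l i (y : pt) : 'M[R]_m :=
  pdmx l (nabla_hess u i) y - \sum_q Gamma l y i q *: nabla_hess u q y
  - Gamma l y *m nabla_hess u i y - nabla_hess u i y *m (Gamma l y)^T.

Lemma nabla2_hess_sym l i y : U y -> (nabla2_hess l i y)^T = nabla2_hess l i y.
Proof.
move=> Uy; rewrite /nabla2_hess !(trmxD, trmxN) !trmx_mul trmxK nabla_hess_sym //.
have -> : (pdmx l (nabla_hess u i) y)^T = pdmx l (nabla_hess u i) y.
  by rewrite -pdmxT; apply: (pdmx_eq_on oU l Uy) => z /nabla_hess_sym.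
have -> : (\sum_q Gamma l y i q *: nabla_hess u q y)^T = \sum_q Gamma l y i q *: nabla_hess u q y.
  apply/matrixP => a b; rewrite mx_trE !summxE; apply: eq_bigr => q _.
  by rewrite !mx_scaleE -[_ b a]mx_trE nabla_hess_sym.
by mx_lra.
Qed.

Lemma nabla2_hess_commutator l i y : U y ->
  nabla2_hess l i y - nabla2_hess i l y =
  - (curvature g l i y *m hess u y + hess u y *m (curvature g l i y)^T).
Proof.
move=> Uy; have sG := smooth_christoffel oU sg g_unit; have sh := smooth_hess.
have E a b : pdmx a (nabla_hess u b) y = pdmx a (pdmx b (hess u)) y
    - (pdmx a (Gamma b) y *m hess u y + Gamma b y *m pdmx a (hess u) y)
    - (pdmx a (hess u) y *m (Gamma b y)^T + hess u y *m (pdmx a (Gamma b) y)^T).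
  rewrite nabla_hess.unlock.
  have sGT := smooth_mxT oU (sG b).
  have s1 := smooth_mx_pdmx oU b sh; have s2 := smooth_mxM oU (sG b) sh.
  have s3 := smooth_mxM oU sh sGT.
  rewrite (pdmxB oU _ Uy (smooth_mxB oU s1 s2) s3) (pdmxB oU _ Uy s1 s2).
  by rewrite (pdmxM oU _ Uy (sG b) sh) (pdmxM oU _ Uy sh sGT) pdmxT.
have SW := schwarz_mx oU l i Uy sh.
have Q : \sum_q Gamma l y i q *: nabla_hess u q y = \sum_q Gamma i y l q *: nabla_hess u q y.
  by apply: eq_bigr => q _; rewrite (christoffel_sym oU g_sym).
rewrite /nabla2_hess Q !E SW /= nabla_hess.unlock /nabla_bil curvature.unlock.
by mx_expand_all; mx_lra.
Qed.

(** Leibniz rule for the divergence \sum_i (P \nabla_i S)_ik, S being the Hessian: the left side is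
    its covariant derivative in direction l, as a covector in k. *)
Lemma divergence_contraction (P : pt -> 'M[R]_m) l k y : U y -> smooth_mx_on U P ->
  pderiv l (fun z => \sum_i (P z *m nabla_hess u i z) i k) y
  - \sum_q Gamma l y k q * (\sum_i (P y *m nabla_hess u i y) i q)
  = \sum_i (nabla_cobil g l P y *m nabla_hess u i y) i k
    + \sum_i (P y *m nabla2_hess l i y) i k.
Proof.
move=> Uy sP; have sN := smooth_nabla_hess.
have sPN i := smooth_mxM oU sP (sN i).
rewrite (pderiv_sum l Uy _ oU (fun i _ => sPN i i k)).
have D i : pderiv l (fun z => (P z *m nabla_hess u i z) i k) y =
   (pdmx l P y *m nabla_hess u i y) i k + (P y *m pdmx l (nabla_hess u i) y) i k.
  by rewrite -pdmxE (pdmxM oU _ Uy sP (sN i)) mx_addE.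
under eq_bigr do rewrite D.
have E i : (P y *m nabla2_hess l i y) i k = (P y *m pdmx l (nabla_hess u i) y) i k
   - \sum_q Gamma l y i q * (P y *m nabla_hess u q y) i k
   - (P y *m Gamma l y *m nabla_hess u i y) i k
   - (P y *m nabla_hess u i y *m (Gamma l y)^T) i k.
  rewrite /nabla2_hess !mulmxDr !mulmxN !mulmxA !mx_entryE; congr (_ - _ - _ - _).
  rewrite mulmx_sumr summxE; apply: eq_bigr => q _.
  by rewrite -scalemxAr mx_scaleE.
under [X in _ = _ + X]eq_bigr do rewrite E.
have F i : (nabla_cobil g l P y *m nabla_hess u i y) i k =
   (pdmx l P y *m nabla_hess u i y) i k + ((Gamma l y)^T *m (P y *m nabla_hess u i y)) i k
   + (P y *m Gamma l y *m nabla_hess u i y) i k.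
  by rewrite /nabla_cobil !mulmxDl !mulmxA !mx_addE.
under [X in _ = X + _]eq_bigr do rewrite F.
rewrite !big_split /= !sumrN.
have A : \sum_i ((Gamma l y)^T *m (P y *m nabla_hess u i y)) i k =
   \sum_i \sum_q Gamma l y i q * (P y *m nabla_hess u q y) i k.
  rewrite [RHS]exchange_big; apply: eq_bigr => q _; rewrite mxE; apply: eq_bigr => i _.
  by rewrite mx_trE.
have B : \sum_q Gamma l y k q * (\sum_i (P y *m nabla_hess u i y) i q) =
   \sum_i (P y *m nabla_hess u i y *m (Gamma l y)^T) i k.
  under eq_bigr do rewrite big_distrr /=.
  rewrite exchange_big; apply: eq_bigr => i _; rewrite [RHS]mxE; apply: eq_bigr => q _.
  by rewrite mx_trE mulrC.
rewrite A B; lra.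
Qed.

End Hessian.

(** * Averaging over the quaternionic structure *)

Section QuaternionicAverage.
Variables (R : realType) (m : nat) (I J K : 'M[R]_m).
Hypotheses (II : I *m I = - 1%:M) (JJ : J *m J = - 1%:M) (KK : K *m K = - 1%:M).
Hypothesis IJ : I *m J = K.

Definition quat_avg (S : 'M[R]_m) : 'M[R]_m :=
  4^-1 *: (S + I *m S *m I^T + J *m S *m J^T + K *m S *m K^T).

(** The condition for contravariant tensors; [quat_hermitian] is the corresponding one for covariant
    tensors, and inversion exchanges them. *)
Definition quat_invariant (P : 'M[R]_m) : Prop :=
  [/\ I^T *m P *m I = P, J^T *m P *m J = P & K^T *m P *m K = P].

Definition quat_hermitian (B : 'M[R]_m) : Prop :=
  [/\ I *m B *m I^T = B, J *m B *m J^T = B & K *m B *m K^T = B].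

(** Conjugation by a unit moves onto P under the trace and fixes it. Hence a trace against g^-1 or
    h^-1 does not distinguish the Hessian from its average. *)
Lemma trace_quat_avg P S : quat_invariant P -> \tr (P *m quat_avg S) = \tr (P *m S).
Proof.
case=> PI PJ PK.
have T L : L^T *m P *m L = P -> \tr (P *m (L *m S *m L^T)) = \tr (P *m S).
  by move=> PL; rewrite -{2}PL !mulmxA mxtrace_mulC !mulmxA.
rewrite /quat_avg -scalemxAr linearZ /= !mulmxDr !raddfD /= !T //; lra.
Qed.

Lemma conj_inv_endo (L B : 'M[R]_m) : L *m L = - 1%:M -> B \in unitmx ->
  L *m B *m L^T = B -> L^T *m invmx B *m L = invmx B.
Proof.
move=> LL uB LB.
have LTT : L^T *m L^T = - 1%:M by rewrite -trmx_mul LL trmxN trmx1.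
have E : L *m B = - (B *m L^T).
  have := congr1 (mulmx^~ L^T) LB; rewrite /= -!mulmxA LTT !mulmxN mulmx1 => <-.
  by rewrite opprK.
rewrite -[LHS](mulmxK uB) -[RHS]mul1mx; congr (_ *m _).
have -> : L^T *m invmx B *m L *m B = L^T *m invmx B *m (L *m B) by rewrite !mulmxA.
by rewrite E mulmxN mulmxA mulmxKV // LTT opprK.
Qed.

Lemma quat_invariant_inv B : B \in unitmx -> quat_hermitian B ->
  quat_invariant (invmx B).
Proof. by move=> uB [BI BJ BK]; split; exact: conj_inv_endo. Qed.

Lemma quat_avg_hermitian S : quat_hermitian (quat_avg S).
Proof.
have [JI JK KJ KI IK] := quaternion_rel II JJ KK IJ.
have T (L M N : 'M[R]_m) : L *m M = N \/ L *m M = - N -> L *m (M *m S *m M^T) *m L^T = N *m S *m N^T.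
  move=> H; rewrite -!mulmxA -trmx_mul !mulmxA.
  by case: H => ->; rewrite // trmxN mulmxN !mulNmx opprK.
have T1 L : L *m L = - 1%:M -> L *m (L *m S *m L^T) *m L^T = S.
  by move=> LL; rewrite (T L L 1%:M) ?trmx1 ?mulmx1 ?mul1mx //; right.
rewrite /quat_hermitian /quat_avg -!scalemxAr -!scalemxAl !mulmxDr !mulmxDl.
split; rewrite T1 //; congr (_ *: _).
- by rewrite (T I J K) ?(T I K J); [rewrite addrAC [X in X + _]addrC; mx_lra|right|left].
- by rewrite (T J I K) ?(T J K I); [mx_lra|left|right].
- by rewrite (T K I J) ?(T K J I); [mx_lra|right|left].
Qed.

Lemma quat_avg_sym S : S^T = S -> (quat_avg S)^T = quat_avg S.
Proof.
move=> Ss; rewrite /quat_avg trmxZ !trmxD !trmx_mul !trmxK Ss.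
by rewrite !mulmxA.
Qed.

(** Raising both indices of a hermitian tensor with an invariant one. The derivative of h^-1 has
    this shape. *)
Lemma quat_invariant_sandwich P A : quat_invariant P -> quat_hermitian A ->
  quat_invariant (P *m A *m P).
Proof.
have T L : L *m L = - 1%:M -> L^T *m P *m L = P -> L *m A *m L^T = A ->
    L^T *m (P *m A *m P) *m L = P *m A *m P.
  move=> LL PL AL.
  have E : L^T *m P = - (P *m L).
    have := congr1 (mulmx^~ L) PL; rewrite /= -!mulmxA LL !mulmxN mulmx1 => <-.
    by rewrite opprK.
  have E' : P *m L = - (L^T *m P) by rewrite E opprK.
  have -> : L^T *m (P *m A *m P) *m L = (L^T *m P) *m A *m (P *m L) by rewrite !mulmxA.
  rewrite E !mulNmx.
  have -> : P *m L *m A *m (P *m L) = - (P *m L *m A *m (L^T *m P)) by rewrite -mulmxN -E'.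
  rewrite opprK.
  have -> : P *m L *m A *m (L^T *m P) = P *m (L *m A *m L^T) *m P by rewrite !mulmxA.
  by rewrite AL.
by case=> PI PJ PK [AI AJ AK]; split; apply: T.
Qed.

End QuaternionicAverage.

(** * Differentiating the equation twice *)

Section Bochner.
Variables (R : realType) (m : nat) (U : set 'rV[R]_m).
Variables (g I J K : 'rV[R]_m -> 'M[R]_m).
Local Notation pt := ('rV[R]_m).
Hypothesis hk : hyperkahler_chart U g I J K.
Variables (phi f : pt -> R).
Hypotheses (sphi : smooth_on U phi) (sf : smooth_on U f).

Let oU := hk_open hk.
Let sg := hk_smooth hk.
Let gs := hk_sym hk.
Let gu := hk_unit hk.

Let avg (A : pt -> 'M[R]_m) y := quat_avg (I y) (J y) (K y) (A y).

Lemma nabla_bil_conj L B k y : U y -> kahler_endo U g L -> nabla_endo g k L y = 0 ->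
  smooth_mx_on U B ->
  nabla_bil g k (fun z => L z *m B z *m (L z)^T) y = L y *m nabla_bil g k B y *m (L y)^T.
Proof.
move=> Uy kL nL sB; have sL := ke_smooth kL.
have pL : pdmx k L y = christoffel g k y *m L y - L y *m christoffel g k y.
  move/eqP: nL; rewrite /nabla_endo addr_eq0 => /eqP H.
  by rewrite -[LHS](subrK (christoffel g k y *m L y)) H addrC.
rewrite /nabla_bil (pdmxM oU _ Uy (smooth_mxM oU sL sB) (smooth_mxT oU sL)).
rewrite (pdmxM oU _ Uy sL sB) pdmxT pL.
by mx_expand_all; mx_lra.
Qed.

Lemma smooth_avg B : smooth_mx_on U B -> smooth_mx_on U (avg B).
Proof.
move=> sB; have sL L : kahler_endo U g L -> smooth_mx_on U (fun z => L z *m B z *m (L z)^T).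
  move=> /ke_smooth sL; apply: smooth_mxM => //; last exact: smooth_mxT.
  exact: smooth_mxM.
apply: smooth_mxZ => //.
by do 3 (apply: smooth_mxD => //; last by apply: sL; case: hk).
Qed.

Lemma nabla_bil_avg B k y : U y -> smooth_mx_on U B ->
  nabla_bil g k (avg B) y = quat_avg (I y) (J y) (K y) (nabla_bil g k B y).
Proof.
move=> Uy sB; have [nI nJ nK] := hyperkahler_parallel k hk Uy.
have [_ _ _ _ kI kJ kK _] := hk.
have sL L : kahler_endo U g L -> smooth_mx_on U (fun z => L z *m B z *m (L z)^T).
  move=> /ke_smooth sL; apply: smooth_mxM => //; last exact: smooth_mxT.
  exact: smooth_mxM.
rewrite /quat_avg -!nabla_bil_conj // /nabla_bil /avg /quat_avg.
have s1 := smooth_mxD oU sB (sL _ kI).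
have s2 := smooth_mxD oU s1 (sL _ kJ).
have s3 := smooth_mxD oU s2 (sL _ kK).
rewrite (pdmxZ _ Uy _ s3) (pdmxD _ Uy s2 (sL _ kK)) (pdmxD _ Uy s1 (sL _ kJ)).
rewrite (pdmxD _ Uy sB (sL _ kI)).
rewrite -!scalemxAr -!scalemxAl; mx_expand_all.
by mx_lra.
Qed.

(** Exchanging the indices costs the curvature applied to du, contracted with P, hence nothing. As a
    divergence, the expression is ready for the second commutation of derivatives. *)
Lemma trace_nabla_hess (P : 'M[R]_m) (u : pt -> R) k y : U y -> smooth_on U u ->
  P^T = P -> quat_invariant (I y) (J y) (K y) P ->
  \tr (P *m nabla_hess g u k y) = \sum_i (P *m nabla_hess g u i y) i k.
Proof.
move=> Uy su Ps [PI PJ _]; apply/eqP; rewrite -subr_eq0; apply/eqP.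
rewrite -sumrB.
have E i : (P *m nabla_hess g u k y) i i - (P *m nabla_hess g u i y) i k =
    - (P *m curvature g k i y *m gradient u y) i 0.
  rewrite -mulmxA !mxE -sumrB -sumrN; apply: eq_bigr => j _; rewrite -mulrBr -mulrN.
  congr (_ * _); rewrite -(nabla_hess_commutator oU sg gs gu su) //.
  by congr (_ - _); rewrite -[LHS]mx_trE (nabla_hess_sym oU gs su).
under eq_bigr do rewrite E mxE.
rewrite sumrN exchange_big /= big1 ?oppr0 // => q _.
by rewrite -big_distrl /= (curvature_contraction hk Uy) // mul0r.
Qed.

Lemma pderiv_trace_metric u k y : U y -> smooth_on U u ->
  pderiv k (fun z => \tr (invmx (g z) *m hess g u z)) y =
  \tr (invmx (g y) *m nabla_hess g u k y).
Proof.
move=> Uy su; have sh := smooth_hess oU sg gu su.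
have sV := smooth_invmx oU gu sg.
rewrite (pderiv_trace oU k Uy (smooth_mxM oU sV sh)) (pdmxM oU _ Uy sV sh).
rewrite (pdmx_inv_metric oU sg gs gu) // nabla_hess.unlock /nabla_bil.
mx_expand_all; rewrite !raddfD /= !raddfN /=.
rewrite -[(christoffel g k y)^T *m _ *m _]mulmxA [\tr ((christoffel g k y)^T *m _)]mxtrace_mulC.
lra.
Qed.

(** The left side is the logarithmic derivative of det B. The Christoffel term does not involve B,
    so it cancels when the determinants of h and g are compared. *)
Lemma trace_inv_pdmx (B : pt -> 'M[R]_m) k y : B y \in unitmx ->
  \tr (invmx (B y) *m pdmx k B y) =
  \tr (invmx (B y) *m nabla_bil g k B y) + 2 * \tr (christoffel g k y).
Proof.
move=> uB; have -> : pdmx k B y =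
    nabla_bil g k B y + christoffel g k y *m B y + B y *m (christoffel g k y)^T.
  by rewrite /nabla_bil; mx_lra.
rewrite !mulmxDr !raddfD /= mulKmx // mxtrace_tr.
by rewrite [\tr (_ *m (_ *m B y))]mxtrace_mulC mulmxK //; lra.
Qed.

Lemma pderiv_expR (u : pt -> R) k y : U y -> smooth_on U u ->
  pderiv k (fun z => expR (u z)) y = expR (u y) * pderiv k u y.
Proof.
move=> Uy su; have du := smooth_differentiable oU Uy su.
have de : differentiable (@expR R) (u y) by apply/derivable1_diffP; exact: derivable_expR.
rewrite !pderivE !deriveE //; last exact: differentiable_comp.
rewrite (_ : (fun z => expR (u z)) = @expR R \o u) // diff_comp //= deriv1E.
  by rewrite derive1E derive_val /GRing.scale /= mulrC.
exact: derivable_expR.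
Qed.

Let h y := g y + avg (hess g phi) y.

Hypothesis h_unit : forall y, U y -> h y \in unitmx.
Hypothesis MA : forall y, U y -> \det (h y) = expR (4 * f y) * \det (g y).

Let P y := invmx (h y).
Let sS := smooth_hess oU sg gu sphi.
Let sH : smooth_mx_on U h := smooth_mxD oU sg (smooth_avg sS).
Let sP : smooth_mx_on U P := smooth_invmx oU h_unit sH.

Lemma perturbed_sym y : U y -> (h y)^T = h y.
Proof.
by move=> Uy; rewrite /h trmxD gs // /avg quat_avg_sym // (hess_sym oU gs sphi).
Qed.

Lemma metric_hermitian y : U y -> quat_hermitian (I y) (J y) (K y) (g y).
Proof.
move=> Uy; have [_ _ _ _ kI kJ kK _] := hk.
by split; [exact: (ke_herm kI Uy)|exact: (ke_herm kJ Uy)|exact: (ke_herm kK Uy)].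
Qed.

Lemma quat_hermitianD A B y : quat_hermitian (I y) (J y) (K y) A ->
  quat_hermitian (I y) (J y) (K y) B -> quat_hermitian (I y) (J y) (K y) (A + B).
Proof.
by move=> [a1 a2 a3] [b1 b2 b3]; split; rewrite mulmxDr mulmxDl; congr (_ + _).
Qed.

Lemma sqr_endo y : U y -> [/\ I y *m I y = - 1%:M, J y *m J y = - 1%:M
  & K y *m K y = - 1%:M].
Proof.
move=> Uy; have [_ _ _ _ kI kJ kK _] := hk.
by split; [exact: (ke_sqr kI Uy)|exact: (ke_sqr kJ Uy)|exact: (ke_sqr kK Uy)].
Qed.

Lemma avg_hermitian A y : U y -> quat_hermitian (I y) (J y) (K y) (avg A y).
Proof.
move=> Uy; have [II JJ KK] := sqr_endo Uy.
exact: quat_avg_hermitian II JJ KK (hk_IJ hk Uy) _.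
Qed.

Lemma perturbed_invariant y : U y -> quat_invariant (I y) (J y) (K y) (P y).
Proof.
move=> Uy; have [II JJ KK] := sqr_endo Uy; apply: quat_invariant_inv => //; first exact: h_unit.
by apply: quat_hermitianD; [exact: metric_hermitian|exact: avg_hermitian].
Qed.

Lemma metric_invariant y : U y -> quat_invariant (I y) (J y) (K y) (invmx (g y)).
Proof.
move=> Uy; have [II JJ KK] := sqr_endo Uy; apply: quat_invariant_inv => //; first exact: gu.
exact: metric_hermitian.
Qed.

Lemma P_sym y : U y -> (P y)^T = P y.
Proof. by move=> Uy; rewrite /P trmx_inv perturbed_sym. Qed.

Lemma nabla_perturbed k y : U y -> nabla_bil g k h y = avg (nabla_hess g phi k) y.
Proof.
move=> Uy; have := nabla_bil_avg k Uy sS; rewrite /avg nabla_hess.unlock => <-.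
rewrite /nabla_bil (pdmxD _ Uy sg (smooth_avg sS)) (pdmx_metric oU gs gu) // /h.
by mx_expand_all; mx_lra.
Qed.

(** Logarithmic derivative of the determinant equation. The covariant derivative of h is the
    averaged one of the Hessian, and the invariance of h^-1 removes the average. *)
Lemma first_variation k y : U y -> \tr (P y *m nabla_hess g phi k y) = 4 * pderiv k f y.
Proof.
move=> Uy; have d0 : \det (h y) != 0 by rewrite -unitfE -unitmxE h_unit.
have g0 z : U z -> \det (g z) != 0 by move=> Uz; rewrite -unitfE -unitmxE gu.
have sE : smooth_on U (fun z => expR (4 * f z)).
  apply: (smooth_eq_on oU _ (smoothM oU (smooth_det oU sH) (smoothV oU g0 (smooth_det oU sg)))).
  by move=> z Uz; rewrite /= MA // mulfK // g0.
have := pderiv_eq_on k oU Uy MA.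
rewrite (pderiv_det_unit oU k Uy sH (h_unit Uy)).
rewrite (pderivM k Uy sE (smooth_det oU sg)) (pderiv_det_unit oU k Uy sg (gu Uy)).
rewrite (pderiv_expR k Uy (smoothM oU (smooth_cst U 4) sf)).
rewrite (pderivM k Uy (smooth_cst U 4) sf) pderiv_cst mul0r add0r.
rewrite (trace_inv_pdmx k (h_unit Uy)) (trace_inv_pdmx k (gu Uy)).
rewrite (nabla_metric oU gs gu) // mulmx0 linear0 add0r nabla_perturbed //.
rewrite /avg trace_quat_avg; last exact: perturbed_invariant.
have -> : expR (4 * f y) * (4 * pderiv k f y) * \det (g y) +
   expR (4 * f y) * (\det (g y) * (2 * \tr (christoffel g k y))) =
   \det (h y) * (4 * pderiv k f y + 2 * \tr (christoffel g k y)) by rewrite MA //; ring.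
by move/(mulfI d0)/addIr.
Qed.

Let N i y := nabla_hess g phi i y.
Let M l i y := nabla2_hess g phi l i y.

Lemma nabla_cobil_perturbed l y : U y ->
  nabla_cobil g l P y = - (P y *m avg (N l) y *m P y).
Proof.
move=> Uy; have uh := h_unit Uy; rewrite -nabla_perturbed // /nabla_cobil.
rewrite (pdmx_invmx oU l Uy h_unit sH) /nabla_bil /P.
move: (pdmx l h y) (h y) uh => D X uX; mx_expand_all.
rewrite mulmxK // mulVmx // mul1mx; mx_lra.
Qed.

(** The fourth derivatives of phi are contracted with g^-1 and h^-1 in the two possible orders. The
    difference is a commutator, the curvature acting on the two slots of the Hessian: one slot
    produces a contraction of the curvature with g^-1, the other with h^-1, and both vanish. *)
Lemma sum_curvature_hess y : U y ->
  \sum_k \sum_l P y k l * (\sum_i (invmx (g y) *m M l i y) i k) =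
  \sum_k \sum_l invmx (g y) k l * (\sum_i (P y *m M l i y) i k).
Proof.
move=> Uy; set G := invmx (g y).
have symE (A : 'M[R]_m) a b : A^T = A -> A a b = A b a.
  by move=> AT; rewrite -{1}AT mx_trE.
have Gs : G^T = G by rewrite /G trmx_inv gs.
have Ps := P_sym Uy.
have [GI GJ _] := metric_invariant Uy; have [PI PJ _] := perturbed_invariant Uy.
(* Relabelling with the symmetry of G, P and each M l i exchanges the roles of G and P, at the price
   of exchanging the two derivative directions. *)
have rhs : \sum_k \sum_l G k l * (\sum_i (P y *m M l i y) i k) =
    \sum_k \sum_l P y k l * (\sum_i (G *m M i l y) i k).
  transitivity (\sum_k \sum_l \sum_i \sum_j G k l * P y i j * M l i y j k).
    apply: eq_bigr => k _; apply: eq_bigr => l _; rewrite big_distrr; apply: eq_bigr => i _.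
    by rewrite [(_ *m _) i k]mxE big_distrr; apply: eq_bigr => j _; exact: mulrA.
  transitivity (\sum_j \sum_i \sum_l \sum_k G k l * P y i j * M l i y j k).
    rewrite exchange_big /=.
    under eq_bigr do rewrite exchange_big /=.
    under eq_bigr do under eq_bigr do rewrite exchange_big /=.
    under eq_bigr do rewrite exchange_big /=.
    rewrite exchange_big /=.
    under eq_bigr do rewrite exchange_big /=.
    under eq_bigr do under eq_bigr do rewrite exchange_big /=.
    rewrite exchange_big /=.
    by [].
  apply: eq_bigr => j _; apply: eq_bigr => i _; rewrite big_distrr; apply: eq_bigr => l _.
  rewrite [(_ *m _) l j]mxE big_distrr; apply: eq_bigr => k _ /=.
  rewrite (symE G) // (symE (P y)) // (symE (M l i y)); last exact: (nabla2_hess_sym oU gs sphi).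
  by rewrite mulrA [P _ _ _ * G _ _]mulrC.
rewrite rhs; apply/eqP; rewrite -subr_eq0; apply/eqP.
transitivity (\sum_k \sum_l P y k l * (\sum_i (G *m (M l i y - M i l y)) i k)).
  rewrite -sumrB; apply: eq_bigr => k _; rewrite -sumrB; apply: eq_bigr => l _.
  rewrite -mulrBr -sumrB; congr (_ * _); apply: eq_bigr => i _.
  have D (A1 A2 : 'M[R]_m) : (G *m A1) i k - (G *m A2) i k = (G *m (A1 - A2)) i k.
    by rewrite mulmxDr mulmxN mx_addE mx_oppE.
  exact: D.
have E l k : \sum_i (G *m (M l i y - M i l y)) i k =
    - \sum_i (G *m hess g phi y *m (curvature g l i y)^T) i k.
  under eq_bigr do rewrite /M (nabla2_hess_commutator oU sg gs gu) // mulmxN mulmxDr !mulmxA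
    mx_oppE mx_addE opprD.
  rewrite big_split /= !sumrN.
  have -> : \sum_i (G *m curvature g l i y *m hess g phi y) i k = 0; last by rewrite oppr0 add0r.
  under eq_bigr do rewrite mxE.
  rewrite exchange_big big1 // => q _; rewrite -big_distrl /=.
  by rewrite (curvature_contraction hk Uy) // mul0r.
under eq_bigr do under eq_bigr do rewrite E mulrN.
transitivity (- \sum_i \sum_q (G *m hess g phi y) i q *
    (\sum_l (P y *m curvature g l i y) l q)).
  rewrite -sumrN; under eq_bigr do rewrite sumrN.
  rewrite !sumrN; congr (- _).
  under eq_bigr do under eq_bigr do rewrite big_distrr /=.
  under eq_bigr do rewrite exchange_big /=.
  rewrite exchange_big /=; apply: eq_bigr => i _.
  transitivity (\sum_l \sum_k \sum_q P y k l * ((G *m hess g phi y) i q * curvature g l i y k q)).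
    rewrite exchange_big; apply: eq_bigr => l _; apply: eq_bigr => k _ /=.
    rewrite mxE big_distrr; apply: eq_bigr => q _; by rewrite mx_trE.
  under [RHS]eq_bigr do rewrite big_distrr /=.
  rewrite [RHS]exchange_big; apply: eq_bigr => l _ /=.
  under [RHS]eq_bigr do rewrite [(P y *m _) _ _]mxE big_distrr /=.
  rewrite [RHS]exchange_big; apply: eq_bigr => k _; apply: eq_bigr => q _ /=.
  by rewrite (symE (P y)) // mulrCA.
rewrite big1 ?oppr0 // => i _; rewrite big1 // => q _.
have -> : \sum_l (P y *m curvature g l i y) l q = - \sum_l (P y *m curvature g i l y) l q.
  by rewrite -sumrN; apply: eq_bigr => l _; rewrite curvature_anti mulmxN mx_oppE.
by rewrite (curvature_contraction hk Uy) // oppr0 mulr0.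
Qed.

(** With X_b = \sum_k B_bk A_k, the sum is that of the squared Euclidean norms of the symmetric
    matrices C X_b C^T. *)
Lemma weighted_square_ge0 (B C : 'M[R]_m) (A : 'I_m -> 'M[R]_m) :
  (forall k, (A k)^T = A k) ->
  0 <= \sum_k \sum_l (B^T *m B) k l *
         \tr (C^T *m C *m A l *m (C^T *m C) *m A k).
Proof.
move=> As.
pose X b := \sum_k B b k *: A k.
have Xs b : (X b)^T = X b.
  by rewrite /X raddf_sum; apply: eq_bigr => k _ /=; rewrite trmxZ As.
have -> : \sum_k \sum_l (B^T *m B) k l * \tr (C^T *m C *m A l *m (C^T *m C) *m A k) =
    \sum_b \tr (C^T *m C *m X b *m (C^T *m C) *m X b).
  have E b : \tr (C^T *m C *m X b *m (C^T *m C) *m X b) =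
      \sum_k \sum_l B b k * B b l * \tr (C^T *m C *m A l *m (C^T *m C) *m A k).
    rewrite {2}/X mulmx_sumr raddf_sum; apply: eq_bigr => k _ /=.
    rewrite -scalemxAr mxtraceZ /X mulmx_sumr !mulmx_suml raddf_sum big_distrr.
    apply: eq_bigr => l _ /=; rewrite -scalemxAr -!scalemxAl mxtraceZ; exact: mulrA.
  under [RHS]eq_bigr do rewrite E.
  rewrite [RHS]exchange_big; apply: eq_bigr => k _ /=.
  rewrite [RHS]exchange_big; apply: eq_bigr => l _ /=.
  by rewrite mxE big_distrl; apply: eq_bigr => b _; rewrite /= mx_trE.
apply: sumr_ge0 => b _; set Y := C *m X b *m C^T.
have Ys : Y^T = Y by rewrite /Y !trmx_mul trmxK Xs mulmxA.
have -> : \tr (C^T *m C *m X b *m (C^T *m C) *m X b) = \tr (Y *m Y^T).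
  rewrite Ys /Y.
  have -> : C *m X b *m C^T *m (C *m X b *m C^T) = (C *m X b *m C^T *m C *m X b) *m C^T.
    by rewrite !mulmxA.
  by rewrite [RHS]mxtrace_mulC !mulmxA.
apply: sumr_ge0 => i _; rewrite mxE; apply: sumr_ge0 => j _.
by rewrite mx_trE -expr2 sqr_ge0.
Qed.

Let v z := \tr (invmx (g z) *m hess g phi z).

(** [B] and [C] are square roots of the inverse metrics, supplied later by frames; they serve to
    recognise the third-order term as a square. *)
Lemma bochner_inequality (B C : 'M[R]_m) y : U y ->
  invmx (g y) = B^T *m B -> P y = C^T *m C ->
  4 * \tr (invmx (g y) *m hess g f y) <= \tr (P y *m hess g v y).
Proof.
move=> Uy GB PC; have sV := smooth_invmx oU gu sg.
have trE (A S : 'M[R]_m) : S^T = S -> \tr (A *m S) = \sum_k \sum_l A k l * S l k.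
  by move=> _; apply: eq_bigr => k _; rewrite mxE.
have vE k z : U z -> \sum_i (invmx (g z) *m N i z) i k = pderiv k v z.
  move=> Uz; rewrite pderiv_trace_metric // trace_nabla_hess //.
    by rewrite trmx_inv gs.
  exact: metric_invariant.
have wE k z : U z -> \sum_i (P z *m N i z) i k = 4 * pderiv k f z.
  move=> Uz; rewrite -first_variation // trace_nabla_hess //; first exact: P_sym.
  exact: perturbed_invariant.
(* g^-1 is parallel, so the derivative falls on the Hessian alone. *)
have Hv l k : hess g v y l k = \sum_i (invmx (g y) *m M l i y) i k.
  rewrite hessE -(pderiv_eq_on l oU Uy (fun z Uz => vE k z Uz)).
  under eq_bigr do rewrite -vE //.
  rewrite (divergence_contraction oU sg gu sphi) //.
  have -> : nabla_cobil g l (fun z => invmx (g z)) y = 0.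
    by rewrite /nabla_cobil (pdmx_inv_metric oU sg gs gu) //; mx_lra.
  by rewrite big1 ?add0r // => i _; rewrite mul0mx mxE.
(* Here the derivative also falls on P = h^-1; \nabla_l P = - P avg(N l) P gives the term quadratic
   in third derivatives. *)
have Hf l k : 4 * hess g f y l k =
    \sum_i (P y *m M l i y) i k - \tr (P y *m avg (N l) y *m P y *m avg (N k) y).
  have d4 z : U z -> 4 * pderiv k f z = \sum_i (P z *m N i z) i k by move=> /wE.
  have -> : 4 * hess g f y l k = pderiv l (fun z => 4 * pderiv k f z) y -
      \sum_q christoffel g l y k q * (\sum_i (P y *m N i y) i q).
    rewrite hessE (pderivM l Uy (smooth_cst U 4) (smooth_pderiv k sf)) pderiv_cst mul0r add0r.
    rewrite mulrBr; congr (_ - _); rewrite big_distrr; apply: eq_bigr => q _ /=.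
    by rewrite wE // mulrCA.
  rewrite (pderiv_eq_on l oU Uy d4) (divergence_contraction oU sg gu sphi) // addrC.
  congr (_ + _); rewrite nabla_cobil_perturbed //.
  (* Invariance is what allows the quadratic term to return from divergence to trace form and its
     last factor to be averaged. *)
  have inv2 : quat_invariant (I y) (J y) (K y) (P y *m avg (N l) y *m P y).
    have [II JJ KK] := sqr_endo Uy.
    apply: quat_invariant_sandwich => //; first exact: perturbed_invariant.
    exact: avg_hermitian.
  have sNl : (avg (N l) y)^T = avg (N l) y by rewrite /avg quat_avg_sym // (nabla_hess_sym oU gs sphi).
  rewrite /avg trace_quat_avg // trace_nabla_hess //; last first.
    by rewrite !trmx_mul P_sym // sNl mulmxA.
  by rewrite -sumrN; apply: eq_bigr => i _; rewrite mulNmx mx_oppE.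
have sv : smooth_on U v.
  by apply: smooth_trace => //; apply: smooth_mxM => //; exact: sS.
rewrite !trE ?(hess_sym oU gs) // big_distrr /=.
have -> : \sum_k \sum_l P y k l * hess g v y l k =
    \sum_k \sum_l invmx (g y) k l * (\sum_i (P y *m M l i y) i k).
  rewrite -sum_curvature_hess //; apply: eq_bigr => k _; apply: eq_bigr => l _.
  by rewrite Hv.
rewrite -subr_ge0 -sumrB.
have -> : \sum_k (\sum_l invmx (g y) k l * (\sum_i (P y *m M l i y) i k)
     - 4 * \sum_l invmx (g y) k l * hess g f y l k) =
   \sum_k \sum_l (B^T *m B) k l *
         \tr (C^T *m C *m avg (N l) y *m (C^T *m C) *m avg (N k) y).
  apply: eq_bigr => k _; rewrite big_distrr -sumrB; apply: eq_bigr => l _ /=.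
  by rewrite mulrCA Hf -GB -PC; ring.
apply: weighted_square_ge0 => k.
by rewrite /avg quat_avg_sym // (nabla_hess_sym oU gs sphi).
Qed.

End Bochner.

(** * The maximum principle *)

Section SecondDerivativeTest.
Variables (R : realType) (m : nat) (U : set 'rV[R]_m) (y : 'rV[R]_m).
Hypotheses (oU : open U) (Uy : U y).
Implicit Types (X : 'rV[R]_m) (u : 'rV[R]_m -> R).

Definition dir_deriv X u (z : 'rV[R]_m) : R := \sum_j X 0 j * pderiv j u z.

Lemma smooth_dir_deriv X u : smooth_on U u -> smooth_on U (dir_deriv X u).
Proof.
move=> su; apply: smooth_sum => // j _; apply: smoothM => //; first exact: smooth_cst.
exact: smooth_pderiv.
Qed.

Lemma positive_near_line u X : smooth_on U u -> 0 < u y ->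
  exists2 h : R, 0 < h & forall s : R, `|s| <= h -> U (y + s *: X) /\ 0 < u (y + s *: X).
Proof.
move=> su uy0; have [d d0 dU] := open_norm_ball oU Uy.
have [d' d'0 du] := continuous_norm_ball (smooth_continuous su Uy) uy0.
pose D := Num.min d d'; have D0 : 0 < D by rewrite lt_min d0.
have X0 : 0 < `|X| + 1 by rewrite ltr_wpDl.
(* The added 1 allows X = 0; the factor 1/2 makes the inequality strict. *)
exists (D / 2 / (`|X| + 1)); first by rewrite !divr_gt0.
move=> s sh.
have : `|y + s *: X - y| < D.
  rewrite [y + _]addrC addrK normrZ.
  have : `|s| * `|X| <= D / 2 / (`|X| + 1) * (`|X| + 1) by rewrite ler_pM // lerDl.
  rewrite divfK ?gt_eqF // => /le_lt_trans; apply.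
  by rewrite ltr_pdivrMr // ltr_pMr // ltr1n.
rewrite lt_min => /andP[yd yd']; split; first exact: dU.
have := du _ yd'; have := ler_norm (- (u (y + s *: X) - u y)); rewrite normrN; lra.
Qed.

Lemma mean_value_pos u X (h : R) : smooth_on U u -> 0 < h ->
  (forall s : R, `|s| <= h -> U (y + s *: X)) ->
  exists2 s : R, 0 < s < h & u (y + h *: X) - u y = h * dir_deriv X u (y + s *: X).
Proof.
move=> su h0 hU.
have df (s : R) : `|s| <= h ->
    is_derive s 1 (fun t : R => u (y + t *: X)) (dir_deriv X u (y + s *: X)).
  move=> /hU Us; rewrite /dir_deriv -(derive_pderiv _ oU Us su).
  apply: is_derive_line; apply: diff_derivable; exact: smooth_differentiable oU Us su.
have ab (s : R) : s \in `[0, h] -> `|s| <= h.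
  by rewrite in_itv /= => /andP[s0 sh]; rewrite ger0_norm.
have cf : {within `[0, h], continuous (fun t : R => u (y + t *: X))}.
  apply: derivable_within_continuous => t /ab /df; exact: @ex_derive.
have [s|s sI E] := MVT (df := fun s => dir_deriv X u (y + s *: X)) h0 _ cf.
  by move=> sI; apply/df/ab; exact: subset_itv_oo_cc sI.
exists s; first by move: sI; rewrite in_itv.
  by move: E; rewrite scale0r addr0 subr0 mulrC.
Qed.

Variable q : 'rV[R]_m -> R.
Hypothesis sq : smooth_on U q.
Hypothesis qmax : forall z, U z -> q z <= q y.

Lemma max_dir_deriv_le0 X : dir_deriv X q y <= 0.
Proof.
rewrite leNgt; apply/negP => r0.
have [h h0 hU] := positive_near_line X (smooth_dir_deriv X sq) r0.
have [s|s /andP[s0 sh] E] := @mean_value_pos q X h sq h0; first by move=> /hU[].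
have [_ rs] : U (y + s *: X) /\ 0 < dir_deriv X q (y + s *: X).
  by apply: hU; rewrite gtr0_norm // ltW.
have [Uh _] : U (y + h *: X) /\ 0 < dir_deriv X q (y + h *: X).
  by apply: hU; rewrite gtr0_norm.
by have := qmax Uh; rewrite -subr_le0 E leNgt mulr_gt0.
Qed.

Lemma max_pderiv_eq0 j : pderiv j q y = 0.
Proof.
have E (c : R) : dir_deriv (c *: delta_mx 0 j) q y = c * pderiv j q y.
  rewrite /dir_deriv (bigD1 j) //= big1 ?addr0 => [|k /negPf kj].
    by rewrite !mxE !eqxx mulr1.
  by rewrite !mxE kj andbF mulr0 mul0r.
have := max_dir_deriv_le0 (1 *: delta_mx 0 j).
have := max_dir_deriv_le0 ((-1) *: delta_mx 0 j).
by rewrite !E; lra.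
Qed.

(** If the second derivative along X were positive at y, it would be positive near y; the first
    derivative vanishes at y, so it would be positive just beyond, and q would exceed its maximum.
    Two mean values replace a Taylor expansion. *)
Lemma max_second_deriv_le0 X : \sum_l \sum_k X 0 l * X 0 k * pderiv l (pderiv k q) y <= 0.
Proof.
have E : dir_deriv X (dir_deriv X q) y = \sum_l \sum_k X 0 l * X 0 k * pderiv l (pderiv k q) y.
  apply: eq_bigr => l _.
  have sk k : smooth_on U (fun z => X 0 k * pderiv k q z).
    by apply: smoothM => //; [exact: smooth_cst|exact: smooth_pderiv].
  rewrite (pderiv_sum l Uy _ oU (fun k _ => sk k)) big_distrr; apply: eq_bigr => k _ /=.
  by rewrite (pderivM l Uy (smooth_cst U _) (smooth_pderiv k sq)) pderiv_cst mul0r add0r mulrA.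
rewrite -E leNgt; apply/negP => w0.
have sr := smooth_dir_deriv X sq.
have [h h0 hU] := positive_near_line X (smooth_dir_deriv X sr) w0.
have [s|s /andP[s0 sh] Es] := @mean_value_pos q X h sq h0; first by move=> /hU[].
have [t|t /andP[t0 ts] Et] := @mean_value_pos (dir_deriv X q) X s sr s0.
  by move=> tS; have [] := hU t (le_trans tS (ltW sh)).
have r0 : dir_deriv X q y = 0.
  by rewrite /dir_deriv big1 // => j _; rewrite max_pderiv_eq0 mulr0.
have [_ wt] : U (y + t *: X) /\ 0 < dir_deriv X (dir_deriv X q) (y + t *: X).
  by apply: hU; rewrite gtr0_norm // ltW // (lt_trans ts).
have [Uh _] : U (y + h *: X) /\ 0 < dir_deriv X (dir_deriv X q) (y + h *: X).
  by apply: hU; rewrite gtr0_norm.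
have rs : 0 < dir_deriv X q (y + s *: X).
  by move: Et; rewrite r0 subr0 => ->; exact: mulr_gt0.
by have := qmax Uh; rewrite -subr_le0 Es leNgt mulr_gt0.
Qed.

End SecondDerivativeTest.

(** * Simultaneous quaternionic diagonalisation *)

Section Rayleigh.
Variable R : realType.

Definition bform r (A : 'M[R]_r) (x y : 'rV[R]_r) : R := (x *m A *m y^T) 0 0.
Definition qform r (A : 'M[R]_r) (x : 'rV[R]_r) : R := bform A x x.
Definition posdef r (A : 'M[R]_r) : Prop := forall x, x != 0 -> 0 < qform A x.

Lemma qform_continuous r (A : 'M[R]_r) : continuous (qform A).
Proof.
have -> : qform A = fun x => \sum_i \sum_j x 0 i * x 0 j * A i j.
  by apply/funext => x; rewrite /qform /bform bilinearE.
move=> x; do 2!apply: continuous_sum => ?.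
apply: continuousM; last exact: cst_continuous.
by apply: continuousM; exact: coord_continuous.
Qed.

Lemma qformZ r (A : 'M[R]_r) c x : qform A (c *: x) = c ^+ 2 * qform A x.
Proof.
by rewrite /qform /bform linearZ /= -!scalemxAl -scalemxAr scalerA mx_scaleE expr2.
Qed.

Lemma sym_bilinear r (A : 'M[R]_r) x y : A^T = A ->
  bform A x y = bform A y x.
Proof. by move=> AT; rewrite /bform -[LHS]mx_trE !trmx_mul trmxK AT mulmxA. Qed.

Lemma qformD r (A : 'M[R]_r) x y : A^T = A ->
  qform A (x + y) = qform A x + 2 * bform A x y + qform A y.
Proof.
move=> AT; rewrite /qform /bform trmxD !(mulmxDl, mulmxDr) !mx_addE -/(bform A y x) (sym_bilinear y
  x AT) /bform.
by lra.
Qed.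

(** The form is tested on x + t y, with t of the sign that makes the cross term negative. *)
Lemma psd_kernel r (A : 'M[R]_r) x : A^T = A -> (forall y, 0 <= qform A y) ->
  qform A x = 0 -> forall y, bform A x y = 0.
Proof.
move=> AT A0 x0 y; set b := bform A x y.
(* Minimising would require t = -b / q(y); the added 1 covers q(y) = 0, and the value of the form is
   still - (c + 2) (b / (c + 1))^2, with c = q(y). *)
have := A0 (x + (- b / (qform A y + 1)) *: y).
rewrite qformD // x0 add0r qformZ [bform A x (_ *: y)](_ : _ = - b / (qform A y + 1) * b);
  last by rewrite /bform linearZ /= -scalemxAr mx_scaleE.
have c0 := A0 y; set c := qform A y in c0 *; have c1 : c + 1 != 0 by rewrite gt_eqF //; lra.
have -> : 2 * (- b / (c + 1) * b) + (- b / (c + 1)) ^+ 2 * c =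
  - ((c + 2) * (b / (c + 1)) ^+ 2) by field.
rewrite oppr_ge0 => H; have : (b / (c + 1)) ^+ 2 <= 0.
  by rewrite -(pmulr_rle0 _ (_ : 0 < c + 2)) //; lra.
rewrite le_eqVlt ltNge sqr_ge0 orbF expf_eq0 /= mulf_eq0 invr_eq0 (negPf c1) orbF.
by move/eqP.
Qed.

(** The norm is the supremum norm. This sphere serves as well as the round one, since the Rayleigh
    quotient is homogeneous of degree 0 and only a compact set meeting every ray is wanted. *)
Lemma unit_sphere_compact r : compact [set x : 'rV[R]_r | `|x| = 1].
Proof.
apply: bounded_closed_compact.
  exists 1; split=> [//|M M1 x /= ->]; exact: ltW.
have -> : [set x : 'rV[R]_r | `|x| = 1] = (fun x => `|x|) @^-1` [set (1 : R)] by [].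
apply: preimage_closed => [x _|]; first exact: norm_continuous.
exact: closed_eq.
Qed.

(** At a maximum x of the Rayleigh quotient h / g, with value mu, the form mu g - h is positive
    semidefinite and vanishes at x, so x lies in its kernel. *)
Lemma relative_eigenvector r (g h : 'M[R]_r) : (0 < r)%N -> g^T = g -> h^T = h ->
  posdef g -> exists2 x, x != 0 &
    exists mu, forall y, bform h x y = mu * bform g x y.
Proof.
case: r g h => // r g h _ gT hT gp.
pose S := [set x : 'rV[R]_r.+1 | `|x| = 1].
have Sn0 x : S x -> x != 0 by move=> Sx; rewrite -normr_eq0 Sx oner_eq0.
have scaleS x : x != 0 -> S (`|x|^-1 *: x).
  by move=> x0; rewrite /S /= normrZ normfV normr_id mulVf // normr_eq0.
pose f x := qform h x / qform g x.
have S0 : S !=set0.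
  pose c1 : 'rV[R]_r.+1 := const_mx 1.
  exists (`|c1|^-1 *: c1); apply: scaleS.
  by apply/eqP => /matrixP /(_ 0 0); rewrite !mxE => /eqP; rewrite oner_eq0.
have fc : {within S, continuous f}.
  apply: continuous_in_subspaceT => x; rewrite inE => /Sn0 x0.
  apply: continuousM; first exact: qform_continuous.
  by apply: continuousV; [rewrite gt_eqF // gp|exact: qform_continuous].
have [x xS xmax] := EVT_max_rV S0 (@unit_sphere_compact _) fc.
rewrite inE in xS; have x0 := Sn0 _ xS; exists x => //; exists (f x) => y.
pose A := f x *: g - h.
have qA z : qform A z = f x * qform g z - qform h z.
  by rewrite /qform /bform /A mulmxBr mulmxBl -scalemxAr -scalemxAl mx_addE mx_oppE mx_scaleE.
have AT : A^T = A by rewrite /A trmxD trmxN trmxZ gT hT.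
have A0 z : 0 <= qform A z.
  have [->|z0] := eqVneq z 0.
    by rewrite /qform /bform mul0mx mul0mx mxE.
  have : f (`|z|^-1 *: z) <= f x by apply: xmax; rewrite inE; exact: scaleS.
  rewrite /f !qformZ -mulf_div divff ?mul1r; last by rewrite expf_neq0 // invr_eq0 normr_eq0.
  by rewrite qA ler_pdivrMr ?gp // => H; rewrite subr_ge0.
have Ax : qform A x = 0 by rewrite qA /f divfK ?subrr // gt_eqF // gp.
have := psd_kernel AT A0 Ax y.
rewrite /bform /A mulmxBr mulmxBl -scalemxAr -scalemxAl mx_addE mx_oppE mx_scaleE.
by move/eqP; rewrite subr_eq0 => /eqP.
Qed.

Lemma conj_sym p q (B : 'M[R]_(q, p)) (A : 'M[R]_p) : A^T = A ->
  (B *m A *m B^T)^T = B *m A *m B^T.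
Proof. by move=> AT; rewrite !trmx_mul trmxK AT mulmxA. Qed.

(** Both forms are restricted to the space v C = 0 through a row basis of it; having fewer columns
    than rows, [C] leaves a nonzero space. *)
Lemma relative_eigenvector_in m p (g h : 'M[R]_m) (C : 'M[R]_(m, p)) :
  (p < m)%N -> g^T = g -> h^T = h -> posdef g ->
  exists2 v : 'rV[R]_m, v != 0 /\ v *m C = 0 &
    exists mu, forall w, w *m C = 0 ->
      bform h v w = mu * bform g v w.
Proof.
move=> pm gT hT gp; pose B := row_base (kermx C).
have r0 : (0 < \rank (kermx C))%N.
  by rewrite mxrank_ker subn_gt0 (leq_ltn_trans (rank_leq_col C)).
have BC : B *m C = 0.
  by apply/eqP; rewrite -sub_kermx eq_row_base.
have Bfree : row_free B by exact: row_base_free.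
have gB := conj_sym B gT; have hB := conj_sym B hT.
have pB : posdef (B *m g *m B^T).
  move=> x x0; have : x *m B != 0.
    by apply: contra_neq x0 => xB; apply/eqP; rewrite -(mulmx_free_eq0 _ Bfree) xB.
  by move/gp; rewrite /qform /bform trmx_mul !mulmxA.
have [x x0 [mu E]] := relative_eigenvector r0 gB hB pB.
exists (x *m B).
  split; last by rewrite -mulmxA BC mulmx0.
  by apply: contra_neq x0 => xB; apply/eqP; rewrite -(mulmx_free_eq0 _ Bfree) xB.
exists mu => w wC; have : (w <= B)%MS by rewrite eq_row_base sub_kermx wC.
by move=> /submxP[y ->]; have := E y; rewrite /bform !trmx_mul !mulmxA.
Qed.

End Rayleigh.

(** * Quaternionic frames *)

Section QuaternionicFrame.
Variables (R : realType) (m : nat) (I J K g h : 'M[R]_m).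
Hypotheses (II : I *m I = - 1%:M) (JJ : J *m J = - 1%:M) (KK : K *m K = - 1%:M).
Hypothesis IJ : I *m J = K.
Hypotheses (gT : g^T = g) (hT : h^T = h) (gp : posdef g).
Hypotheses (gH : quat_hermitian I J K g) (hH : quat_hermitian I J K h).

Definition quat_unit (q : 'I_4) : 'M[R]_m := tnth [tuple 1%:M; I; J; K] q.

(** The sign with which a unit passes to the other argument of a hermitian form: the imaginary units
    are skew. *)
Definition quat_sign (q : 'I_4) : R := if q == 0 then 1 else -1.

Lemma ord4_ind (P : 'I_4 -> Prop) :
  P (inord 0) -> P (inord 1) -> P (inord 2) -> P (inord 3) -> forall q, P q.
Proof.
move=> P0 P1 P2 P3 q; rewrite -[q]inord_val.
by case: q => [[|[|[|[|]]]]].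
Qed.

Lemma quat_unitE : [/\ quat_unit (inord 0) = 1%:M, quat_unit (inord 1) = I,
  quat_unit (inord 2) = J & quat_unit (inord 3) = K].
Proof. by split; rewrite /quat_unit (tnth_nth 0) inordK. Qed.

Lemma quat_signE : [/\ quat_sign (inord 0) = 1, quat_sign (inord 1) = -1,
  quat_sign (inord 2) = -1 & quat_sign (inord 3) = -1].
Proof. by split; rewrite /quat_sign -val_eqE /= inordK. Qed.

Lemma quat_unitM q q' : exists s p, quat_unit q *m quat_unit q' = s *: quat_unit p.
Proof.
have [JI JK KJ KI IK] := quaternion_rel II JJ KK IJ.
have [E0 E1 E2 E3] := quat_unitE.
have pos (A B : 'M[R]_m) p : A = B -> quat_unit p = B -> exists s p, A = s *: quat_unit p.
  by move=> -> <-; exists 1, p; rewrite scale1r.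
have neg (A B : 'M[R]_m) p : A = - B -> quat_unit p = B -> exists s p, A = s *: quat_unit p.
  by move=> -> <-; exists (-1), p; rewrite scaleN1r.
move: q q'; apply: ord4_ind; apply: ord4_ind;
  rewrite ?E0 ?E1 ?E2 ?E3 ?mul1mx ?mulmx1;
  first [ by exists 1, (inord 0); rewrite E0 scale1r | by exists 1, (inord 1); rewrite E1 scale1r
        | by exists 1, (inord 2); rewrite E2 scale1r | by exists 1, (inord 3); rewrite E3 scale1r
        | by exists 1, (inord 1); rewrite E1 scale1r JK | by exists 1, (inord 2); rewrite E2 scale1r KI
        | by exists 1, (inord 3); rewrite E3 scale1r IJ
        | by exists (-1), (inord 0); rewrite E0 scaleN1r ?II ?JJ ?KK
        | by exists (-1), (inord 1); rewrite E1 scaleN1r ?KJ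
        | by exists (-1), (inord 2); rewrite E2 scaleN1r ?IK
        | by exists (-1), (inord 3); rewrite E3 scaleN1r ?JI ].
Qed.

Lemma hermitian_swap (A L : 'M[R]_m) x y : L *m L = - 1%:M -> L *m A *m L^T = A ->
  bform A (x *m L) y = - bform A x (y *m L).
Proof.
move=> LL AL.
have E : L *m A = - (A *m L^T).
  have LTT : L^T *m L^T = - 1%:M by rewrite -trmx_mul LL trmxN trmx1.
  have := congr1 (mulmx^~ L^T) AL; rewrite /= -!mulmxA LTT !mulmxN mulmx1 => <-.
  by rewrite opprK.
by rewrite /bform trmx_mul -[x *m L *m A]mulmxA E mulmxN mulNmx mx_oppE !mulmxA.
Qed.

Lemma quat_unit_swap A q x y : quat_hermitian I J K A ->
  bform A (x *m quat_unit q) y = quat_sign q * bform A x (y *m quat_unit q).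
Proof.
case=> AI AJ AK; have [E0 E1 E2 E3] := quat_unitE; have [S0 S1 S2 S3] := quat_signE.
move: q; apply: ord4_ind; rewrite ?E0 ?E1 ?E2 ?E3 ?S0 ?S1 ?S2 ?S3 ?mulN1r ?mul1r ?mulmx1 //.
- exact: hermitian_swap.
- exact: hermitian_swap.
- exact: hermitian_swap.
Qed.

Lemma bformC (A : 'M[R]_m) x y : A^T = A -> bform A x y = bform A y x.
Proof. exact: sym_bilinear. Qed.

Lemma bformNr (A : 'M[R]_m) x y : bform A x (- y) = - bform A x y.
Proof. by rewrite /bform trmxN mulmxN mx_oppE. Qed.

Lemma bformZr (A : 'M[R]_m) c x y : bform A x (c *: y) = c * bform A x y.
Proof. by rewrite /bform trmxZ -scalemxAr mx_scaleE. Qed.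

Lemma bformZl (A : 'M[R]_m) c x y : bform A (c *: x) y = c * bform A x y.
Proof. by rewrite /bform -!scalemxAl mx_scaleE. Qed.

Lemma bformDr (A : 'M[R]_m) x y z : bform A x (y + z) = bform A x y + bform A x z.
Proof. by rewrite /bform trmxD mulmxDr mx_addE. Qed.

Lemma bform_sumr (A : 'M[R]_m) x (T : Type) (r : seq T) (F : T -> 'rV[R]_m) :
  bform A x (\sum_(i <- r) F i) = \sum_(i <- r) bform A x (F i).
Proof. by rewrite /bform raddf_sum mulmx_sumr summxE. Qed.

Lemma quat_unit_orthogonal v q q' : qform g v = 1 ->
  bform g (v *m quat_unit q) (v *m quat_unit q') = (q == q')%:R.
Proof.
move=> v1; have [JI JK KJ KI IK] := quaternion_rel II JJ KK IJ.
have [E0 E1 E2 E3] := quat_unitE; have [S0 S1 S2 S3] := quat_signE.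
have [gI gJ gK] := gH.
have z L : L *m L = - 1%:M -> L *m g *m L^T = g -> bform g v (v *m L) = 0.
  move=> LL gL; have := hermitian_swap v v LL gL; rewrite bformC //; lra.
have {}v1 : bform g v v = 1 by [].
have zI := z _ II gI; have zJ := z _ JJ gJ; have zK := z _ KK gK.
have ne a b : (a < 4)%N -> (b < 4)%N -> ((inord a : 'I_4) == inord b) = (a == b).
  by move=> a4 b4; rewrite -val_eqE /= !inordK.
rewrite quat_unit_swap //.
by move: q q'; apply: ord4_ind; apply: ord4_ind;
  rewrite ?E0 ?E1 ?E2 ?E3 ?S0 ?S1 ?S2 ?S3 ?mulmx1 ne //= -?mulmxA
    ?II ?JJ ?KK ?IJ ?JI ?JK ?KJ ?KI ?IK ?mulmxN ?mulmx1 ?bformNr ?zI ?zJ ?zK ?v1; lra.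
Qed.

(** One vector per quaternionic line: its images under 1, I, J, K complete the real frame. The
    eigenvector equation holds against every w, so it survives enlarging the frame. Only the indices
    below k are meaningful. *)
Record quat_frame (k : nat) (e : nat -> 'rV[R]_m) (lam : nat -> R) : Prop := QuatFrame {
  qf_orth : forall j j' q q', (j < k)%N -> (j' < k)%N ->
    bform g (e j *m quat_unit q) (e j' *m quat_unit q') = ((j == j') && (q == q'))%:R;
  qf_diag : forall j w, (j < k)%N -> bform h (e j) w = lam j * bform g (e j) w }.

Lemma qf_diag_unit k e lam j q w : quat_frame k e lam -> (j < k)%N ->
  bform h (e j *m quat_unit q) w = lam j * bform g (e j *m quat_unit q) w.
Proof. by move=> F jk; rewrite !quat_unit_swap // (qf_diag F) // mulrCA. Qed.

(** The new vector is an eigenvector on the g-orthogonal complement of the frame, normalised; its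
    images under the units are again orthogonal to the old lines. *)
Lemma quat_frame_step k e lam : (4 * k < m)%N -> quat_frame k e lam ->
  exists e' lam', quat_frame k.+1 e' lam'.
Proof.
move=> km F.
(* The 4 k real vectors of the frame: r has quotient j and remainder q by 4. The columns of [C]
   express g-orthogonality to them. *)
pose b r := e (r %/ 4)%N *m quat_unit (inord (r %% 4)).
pose C : 'M[R]_(m, 4 * k) := \matrix_(i, r) (g *m (b r)^T) i 0.
have kerP v : v *m C = 0 <-> forall j q, (j < k)%N -> bform g v (e j *m quat_unit q) = 0.
  have entry (r : 'I_(4 * k)) : (v *m C) 0 r = bform g v (b r).
    by rewrite /bform -mulmxA !mxE; apply: eq_bigr => i _; rewrite [C _ _]mxE.
  split=> [vC j q jk|H].
    have rk : (j * 4 + q < 4 * k)%N.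
      by rewrite mulnC; apply: leq_trans (_ : 4 * j.+1 <= _)%N; rewrite ?leq_pmul2l // mulnS addnC ltn_add2r.
    have := entry (Ordinal rk); rewrite vC mxE /b /= divnMDl // modnMDl.
    by rewrite (divn_small (ltn_ord q)) addn0 (modn_small (ltn_ord q)) inord_val => <-.
  apply/rowP => r; rewrite entry [RHS]mxE /b H //.
  by rewrite ltn_divLR // [X in (_ < X)%N]mulnC; exact: ltn_ord.
have [v [v0 vC] [mu E]] := relative_eigenvector_in C km gT hT gp.
have vo := (kerP v).1 vC.
(* w is split into its projection p on the span of the frame and a remainder in the complement. v is
   g-orthogonal to p, hence also h-orthogonal, because the frame diagonalises h. *)
have Eall w : bform h v w = mu * bform g v w.
  pose p := \sum_(j < k) \sum_q bform g w (e j *m quat_unit q) *: (e j *m quat_unit q).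
  have pw : (w - p) *m C = 0.
    apply/kerP => j q jk; rewrite bformC // bformDr bformNr bform_sumr.
    rewrite (bigD1 (Ordinal jk)) //= [X in - (_ + X)]big1 ?addr0 => [|i /negPf ij]; last first.
      rewrite bform_sumr big1 // => q' _; rewrite bformZr (qf_orth F) //.
      by rewrite [j == i]eq_sym -[i == j :> nat]/(i == Ordinal jk) ij mulr0.
    rewrite bform_sumr (bigD1 q) //= big1 ?addr0 => [|q' /negPf qq']; last first.
      by rewrite bformZr (qf_orth F) // [q == q']eq_sym qq' andbF mulr0.
    by rewrite bformZr (qf_orth F) // !eqxx mulr1 bformC // subrr.
  have pz A : (forall j q, (j < k)%N -> bform A v (e j *m quat_unit q) = 0) -> bform A v p = 0.
    move=> Az; rewrite bform_sumr big1 // => j _; rewrite bform_sumr big1 // => q _.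
    by rewrite bformZr Az ?mulr0.
  have := E _ pw; rewrite !bformDr !bformNr !pz ?subr0 //.
  move=> j q jk; rewrite bformC // (qf_diag_unit _ _ F) // bformC // vo // mulr0.
  by [].
have gv := gp v0; set c := Num.sqrt (qform g v).
have c0 : 0 < c by rewrite sqrtr_gt0.
pose x := c^-1 *: v.
have x1 : qform g x = 1.
  by rewrite qformZ exprVn sqr_sqrtr ?ltW // mulVf // gt_eqF.
(* Moving q to the other side leaves a multiple of e_j times a single unit, to which v is already
   orthogonal. *)
have xo j q q' : (j < k)%N -> bform g (x *m quat_unit q) (e j *m quat_unit q') = 0.
  move=> jk; have [s [p qq]] := quat_unitM q' q.
  by rewrite quat_unit_swap // -mulmxA qq -scalemxAr bformZr bformZl vo // !mulr0.
exists (fun j => if j == k then x else e j), (fun j => if j == k then mu else lam j).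
split=> [j j' q q'|j w]; rewrite !ltnS.
  case: (eqVneq j k) => [->|jk]; case: (eqVneq j' k) => [->|jk'] // lj lj'.
  - exact: quat_unit_orthogonal.
  - rewrite xo; last by rewrite ltn_neqAle jk'.
    by rewrite ?[k == j']eq_sym ?(negPf jk').
  - rewrite bformC // xo; last by rewrite ltn_neqAle jk.
    by rewrite ?(negPf jk).
  - by rewrite (qf_orth F) // ltn_neqAle ?jk ?jk'.
case: (eqVneq j k) => [->|jk] lj; first by rewrite !bformZl Eall mulrCA.
by rewrite (qf_diag F) // ltn_neqAle jk.
Qed.

Lemma quat_frame_exists k : (4 * k <= m)%N -> exists e lam, quat_frame k e lam.
Proof.
elim: k => [_|k IH km]; first by exists (fun=> 0), (fun=> 0); split.
have km' : (4 * k < m)%N by apply: leq_trans km; rewrite ltn_pmul2l.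
have [e [lam F]] := IH (ltnW km').
exact: quat_frame_step km' F.
Qed.

End QuaternionicFrame.

Lemma big_block4 (T : Type) (idx : T) (op : Monoid.com_law idx) n (F : nat -> T) :
  \big[op/idx]_(r < 4 * n) F (r %/ 4)%N =
  \big[op/idx]_(j < n) op (op (F j) (F j)) (op (F j) (F j)).
Proof.
rewrite -(big_mkord xpredT (fun r => F (r %/ 4)%N)).
rewrite -(big_mkord xpredT (fun j => op (op (F j) (F j)) (op (F j) (F j)))).
elim: n => [|n IH]; first by rewrite muln0 !big_geq.
rewrite mulnS addnC !addnS addn0 !big_nat_recr //= IH.
have d i : (i < 4)%N -> ((4 * n + i) %/ 4 = n)%N.
  by move=> i4; rewrite mulnC divnMDl // divn_small // addn0.
have := d 0%N isT; rewrite addn0 => ->; have := d 1%N isT; rewrite addn1 => ->.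
have := d 2%N isT; rewrite addn2 => ->; have := d 3%N isT; rewrite addn3 => ->.
by rewrite !Monoid.mulmA.
Qed.

Lemma sum_block4 (R : realType) n m (F : nat -> R) : m = (4 * n)%N ->
  \sum_(r < m) F (r %/ 4)%N = 4 * \sum_(j < n) F j.
Proof. by move=> ->; rewrite big_block4 mulr_sumr; apply: eq_bigr => j _ /=; lra. Qed.

Lemma prod_block4 (R : realType) n m (F : nat -> R) : m = (4 * n)%N ->
  \prod_(r < m) F (r %/ 4)%N = (\prod_(j < n) F j) ^+ 4.
Proof. by move=> ->; rewrite big_block4 -prodrXl; apply: eq_bigr => j _ /=; ring. Qed.

Lemma orthonormal_inverse (R : realType) m (A E : 'M[R]_m) : E *m A *m E^T = 1%:M ->
  [/\ A \in unitmx, invmx A = E^T *m E & E \in unitmx].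
Proof.
move=> H.
have [uEA uT] := mulmx1_unit H.
move: uEA; rewrite unitmx_mul => /andP[uE uA]; split=> //.
have := congr1 (fun X => invmx E *m X *m E) H; rewrite /= mulmx1 mulVmx // !mulmxA mulVmx // mul1mx -mulmxA.
by move=> e; rewrite -[LHS]mulmx1 -e mulKmx.
Qed.

(** * Traces and determinants in a diagonalising frame *)

Section DiagonalFrame.
Variables (R : realType) (n m : nat) (mE : m = (4 * n)%N) (I J K g h : 'M[R]_m) (e : nat ->
  'rV[R]_m) (lam : nat -> R).
Hypotheses (II : I *m I = - 1%:M) (JJ : J *m J = - 1%:M) (KK : K *m K = - 1%:M).
Hypothesis hp : posdef h.
Hypotheses (gH : quat_hermitian I J K g) (hH : quat_hermitian I J K h).
Hypothesis F : quat_frame I J K g h n e lam.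

Definition frame_mx : 'M[R]_m :=
  \matrix_(r < m) (e (r %/ 4)%N *m quat_unit I J K (inord (r %% 4))).

Let ltn_block (r : 'I_m) : (r %/ 4 < n)%N.
Proof. by move: r; rewrite mE => r; rewrite ltn_divLR // [X in (_ < X)%N]mulnC; exact: ltn_ord. Qed.

Lemma frame_mx_bform (A : 'M[R]_m) r s : (frame_mx *m A *m frame_mx^T) r s =
  bform A (row r frame_mx) (row s frame_mx).
Proof. by rewrite /bform tr_row -row_mul !mxE; apply: eq_bigr => k _; rewrite !mxE. Qed.

Lemma frame_mx_metric : frame_mx *m g *m frame_mx^T = 1%:M.
Proof.
apply/matrixP => r s; rewrite frame_mx_bform !rowK (qf_orth F) ?ltn_block // mxE; congr ((nat_of_bool _)%:R).
rewrite -!val_eqE /= !inordK ?ltn_pmod //; apply/andP/eqP => [[/eqP a /eqP b]|->]; last by rewrite !eqxx.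
by rewrite (divn_eq r 4) (divn_eq s 4) a b.
Qed.

Lemma frame_mx_form :
  frame_mx *m h *m frame_mx^T = diag_mx (\row_(r < m) lam (r %/ 4)%N).
Proof.
apply/matrixP => r s; rewrite frame_mx_bform !rowK (qf_diag_unit II JJ KK gH hH _ _ F) ?ltn_block //.
have := congr1 (fun X : 'M[R]_m => X r s) frame_mx_metric; rewrite /= frame_mx_bform !rowK => ->.
by rewrite !mxE mulr_natr.
Qed.

Lemma frame_pos j : (j < n)%N -> 0 < lam j.
Proof.
move=> jn; have := qf_orth F (inord 0) (inord 0) jn jn; rewrite !eqxx.
have [-> _ _ _] := quat_unitE I J K; rewrite mulmx1 /= => e1.
have e0 : e j != 0.
  by apply/eqP => e0; move/eqP: e1; rewrite e0 /bform mul0mx mul0mx mxE eq_sym oner_eq0.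
by have := hp e0; rewrite /qform (qf_diag F) // e1 mulr1.
Qed.

Let lamb (r : 'I_m) := lam (r %/ 4)%N.
Let lamb_pos r : 0 < lamb r. Proof. exact/frame_pos/ltn_block. Qed.

Lemma frame_inv_metric : invmx g = frame_mx^T *m frame_mx.
Proof. by case: (orthonormal_inverse frame_mx_metric). Qed.

(** The same frame rescaled to be orthonormal for h; its Gram product is the square-root
    factorisation of h^-1. *)
Definition perturbed_frame_mx : 'M[R]_m :=
  diag_mx (\row_(r < m) (Num.sqrt (lam (r %/ 4)%N))^-1) *m frame_mx.

Lemma perturbed_frame_mx_form :
  perturbed_frame_mx *m h *m perturbed_frame_mx^T = 1%:M.
Proof.
rewrite /perturbed_frame_mx trmx_mul -!mulmxA [frame_mx *m _]mulmxA [_ *m (frame_mx^T *m _)]mulmxA.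
rewrite frame_mx_form tr_diag_mx !mulmx_diag.
apply/matrixP => r s; rewrite !mxE; case: eqP => //= _.
rewrite mulrCA -invfM -expr2 sqr_sqrtr ?ltW ?mulfV ?gt_eqF //; exact: lamb_pos.
Qed.

Lemma frame_inv_form : h \in unitmx /\ invmx h = perturbed_frame_mx^T *m perturbed_frame_mx.
Proof. by case: (orthonormal_inverse perturbed_frame_mx_form). Qed.

(** Each eigenvalue has real multiplicity 4; the unknown factor (det E)^2, E being the frame matrix,
    is eliminated by comparison with g. *)
Lemma frame_det : \det h = (\prod_(j < n) lam j) ^+ 4 * \det g.
Proof.
have D A : \det (frame_mx *m A *m frame_mx^T) = (\det frame_mx) ^+ 2 * \det A.
  by rewrite !det_mulmx det_tr mulrAC expr2.
have dg := D g; rewrite frame_mx_metric det1 in dg.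
have dh := D h; rewrite frame_mx_form det_diag in dh.
rewrite -(prod_block4 _ mE).
have e0 : (\det frame_mx) ^+ 2 != 0.
  by apply: contra_eqN dg => /eqP ->; rewrite mul0r oner_eq0.
apply: (mulfI e0); rewrite -dh mulrCA -dg mulr1; apply: eq_bigr => r _; by rewrite !mxE.
Qed.

Lemma frame_trace_inv_metric (A : 'M[R]_m) :
  \tr (invmx g *m A) = \tr (frame_mx *m A *m frame_mx^T).
Proof. by rewrite frame_inv_metric -[X in \tr X = _]mulmxA [LHS]mxtrace_mulC. Qed.

Lemma trace_diag_block (F' : nat -> R) :
  \tr (diag_mx (\row_(r < m) F' (r %/ 4)%N)) = 4 * \sum_(j < n) F' j.
Proof. by rewrite mxtrace_diag -(sum_block4 _ mE); apply: eq_bigr => r _; rewrite mxE. Qed.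

Lemma frame_trace_metric : \tr (invmx g *m h) = 4 * \sum_(j < n) lam j.
Proof. by rewrite frame_trace_inv_metric frame_mx_form trace_diag_block. Qed.

Lemma frame_trace_form : \tr (invmx h *m g) = 4 * \sum_(j < n) (lam j)^-1.
Proof.
have [_ ->] := frame_inv_form; rewrite -mulmxA mxtrace_mulC.
rewrite /perturbed_frame_mx trmx_mul -!mulmxA [frame_mx *m _]mulmxA [_ *m (frame_mx^T *m _)]mulmxA.
rewrite frame_mx_metric mul1mx tr_diag_mx mulmx_diag -(trace_diag_block (fun j => (lam j)^-1)).
congr (\tr (diag_mx _)); apply/rowP => r; rewrite !mxE -invfM -expr2 sqr_sqrtr // ltW //; exact: lamb_pos.
Qed.

Lemma frame_trace_sqr :
  \tr (invmx g *m (h - g) *m invmx g *m (h - g)) = 4 * \sum_(j < n) (lam j - 1) ^+ 2.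
Proof.
rewrite -!mulmxA frame_trace_inv_metric frame_inv_metric !mulmxA.
have -> : frame_mx *m (h - g) *m frame_mx^T = diag_mx (\row_(r < m) (lam (r %/ 4)%N - 1)).
  rewrite mulmxBr mulmxBl frame_mx_metric frame_mx_form.
  by apply/matrixP => r s; rewrite !mxE -mulrnBl.
rewrite -!mulmxA [frame_mx *m _]mulmxA mulmxBr mulmxBl frame_mx_metric frame_mx_form.
rewrite -(trace_diag_block (fun j => (lam j - 1) ^+ 2)).
have -> : diag_mx (\row_(r < m) lam (r %/ 4)%N) - 1%:M = diag_mx (\row_(r < m) (lam (r %/ 4)%N - 1)).
  by apply/matrixP => r s; rewrite !mxE -mulrnBl.
rewrite mulmx_diag; congr (\tr (diag_mx _)); apply/rowP => r; by rewrite !mxE expr2.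
Qed.

End DiagonalFrame.

(** Each inverse is at most c, and lam_j is the whole product times the inverses of the other
    factors. *)
Lemma eigenvalue_bound (R : realType) n (lam : nat -> R) (D c : R) :
  (forall j, (j < n)%N -> 0 < lam j) -> \prod_(j < n) lam j <= D -> 1 <= c ->
  \sum_(j < n) (lam j)^-1 <= c -> forall j, (j < n)%N -> lam j <= D * c ^+ n.
Proof.
move=> lp pD c1 sc j jn.
have inv i : (i < n)%N -> (lam i)^-1 <= c.
  move=> lin; apply: le_trans sc; rewrite (bigD1 (Ordinal lin)) //= lerDl.
  by apply: sumr_ge0 => i' _; rewrite invr_ge0 ltW // lp.
have -> : lam j = (\prod_(i < n) lam i) * \prod_(i < n | i != Ordinal jn) (lam i)^-1.
  rewrite (bigD1 (Ordinal jn)) //= -mulrA -big_split /= big1 ?mulr1 // => i _.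
  by rewrite mulfV // gt_eqF // lp.
have pp : 0 <= \prod_(i < n | i != Ordinal jn) (lam i)^-1.
  by apply: prodr_ge0 => i _; rewrite invr_ge0 ltW // lp.
apply: le_trans (_ : D * \prod_(i < n | i != Ordinal jn) (lam i)^-1 <= _).
  exact: ler_wpM2r.
have D0 : 0 <= D by apply: le_trans pD; apply: prodr_ge0 => i _; rewrite ltW // lp.
apply: ler_wpM2l => //.
apply: le_trans (_ : \prod_(i < n | i != Ordinal jn) c <= _).
  by apply: ler_prod => i _; rewrite invr_ge0 ltW ?lp //= inv.
(* There are n - 1 other factors; 1 <= c permits the exponent n. *)
rewrite prodr_const; apply: ler_weXn2l => //.
by rewrite -[leqRHS]card_ord; exact: max_card.
Qed.

(** * Forms of type (2,0) *)

(** The coefficients of the exterior derivative of the 1-form with components b. *)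
HB.lock Definition curl (R : realType) m (b : 'rV[R]_m -> 'cV[R]_m) (y : 'rV[R]_m) : 'M[R]_m :=
  \matrix_(j, k) (pdmx j b y k 0 - pdmx k b y j 0).

Lemma curlE (R : realType) m (b : 'rV[R]_m -> 'cV[R]_m) y j k :
  curl b y j k = pdmx j b y k 0 - pdmx k b y j 0.
Proof. by rewrite curl.unlock mxE. Qed.

Lemma curl_eq_on (R : realType) m (U : set 'rV[R]_m) (b c : 'rV[R]_m -> 'cV[R]_m) y :
  open U -> U y -> (forall z, U z -> b z = c z) -> curl b y = curl c y.
Proof.
by move=> oU Uy bc; apply/matrixP => j k; rewrite !curlE !(pdmx_eq_on oU _ Uy bc).
Qed.

(** With L parallel, the covariant derivative of L du is L applied to the Hessian, and the symmetric
    Christoffel symbols drop out of the antisymmetrisation. *)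
Lemma curl_endo_gradient (R : realType) m (U : set 'rV[R]_m) (g L : 'rV[R]_m -> 'M[R]_m) u y :
  open U -> (forall z, U z -> (g z)^T = g z) -> smooth_on U u -> smooth_mx_on U L -> U y ->
  (forall k, nabla_endo g k L y = 0) ->
  curl (fun z => L z *m gradient u z) y = hess g u y *m (L y)^T - L y *m hess g u y.
Proof.
move=> oU gs su sL Uy nL.
have sG := smooth_gradient oU su.
have E j k : pdmx j (fun z => L z *m gradient u z) y k 0 =
    (christoffel g j y *m (L y *m gradient u y)) k 0 + (L y *m (hess g u y)^T) k j.
  rewrite (pdmxM oU j Uy sL sG).
  have := nL j; rewrite /nabla_endo => /(canRL (addrK _)); rewrite sub0r => /(canRL (subrK _)) ->.
  have -> : (L y *m (hess g u y)^T) k j =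
     (L y *m (pdmx j (gradient u) y - christoffel g j y *m gradient u y)) k 0.
    rewrite !mxE; apply: eq_bigr => l _; congr (_ * _).
    rewrite mx_trE hessE mx_addE mx_oppE pdmxE [(_ *m gradient u y) l 0]mxE; congr (_ - _).
      by apply: pderiv_ext => z; rewrite mxE.
    by apply: eq_bigr => q _; rewrite [gradient u y q 0]mxE.
  by mx_expand_all; rewrite !mx_entryE; lra.
apply/matrixP => j k; rewrite curlE !E.
have -> : (christoffel g j y *m (L y *m gradient u y)) k 0 =
          (christoffel g k y *m (L y *m gradient u y)) j 0.
  by rewrite ![(christoffel _ _ _ *m _) _ _]mxE; apply: eq_bigr => q _; rewrite (christoffel_sym oU gs).
have hs := hess_sym oU gs su Uy; rewrite mx_addE mx_oppE hs.
have -> : (hess g u y *m (L y)^T) j k = (L y *m hess g u y) k j.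
  by rewrite -[RHS]mx_trE trmx_mul hs.
by lra.
Qed.

(** A complex matrix as a pair of real ones: a complex identity splits into two real ones, within
    reach of [mx_lra]. *)
HB.lock Definition cmx (R : realType) p q (A B : 'M[R]_(p, q)) : 'M[R[i]]_(p, q) :=
  \matrix_(i, j) Complex (A i j) (B i j).

Section ComplexMatrices.
Variable R : realType.
Local Notation C := R[i].
Local Open Scope complex_scope.

Lemma cmxE p q (A B : 'M[R]_(p, q)) i j : cmx A B i j = A i j +i* B i j.
Proof. by rewrite cmx.unlock mxE. Qed.

Lemma sum_complex (I : Type) (r : seq I) (P : pred I) (a b : I -> R) :
  \sum_(i <- r | P i) (a i +i* b i) = (\sum_(i <- r | P i) a i) +i* (\sum_(i <- r | P i) b i).
Proof. by elim/big_rec3: _ => // i x y z _ ->; simpc. Qed.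

Lemma cmxM p q r (A B : 'M[R]_(p, q)) (A' B' : 'M[R]_(q, r)) :
  cmx A B *m cmx A' B' = cmx (A *m A' - B *m B') (A *m B' + B *m A').
Proof.
apply/matrixP => i j; rewrite cmxE !mx_addE mx_oppE !mxE -!sumrN -!big_split /= -sum_complex.
by apply: eq_bigr => k _; rewrite !cmxE; simpc.
Qed.

Lemma cmxT p q (A B : 'M[R]_(p, q)) : (cmx A B)^T = cmx A^T B^T.
Proof. by apply/matrixP => i j; rewrite mxE !cmxE !mxE. Qed.

Lemma cmxD p q (A B A' B' : 'M[R]_(p, q)) : cmx A B + cmx A' B' = cmx (A + A') (B + B').
Proof. by apply/matrixP => i j; rewrite mxE !cmxE !mxE; simpc. Qed.

Lemma cmxN p q (A B : 'M[R]_(p, q)) : - cmx A B = cmx (- A) (- B).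
Proof. by apply/matrixP => i j; rewrite mxE !cmxE !mxE; simpc. Qed.

Lemma cmx_real p q (A : 'M[R]_(p, q)) : cplx A = cmx A 0.
Proof. by apply/matrixP => i j; rewrite cmxE !mxE. Qed.

Lemma cmxZi p q (A B : 'M[R]_(p, q)) : 'i%C *: cmx A B = cmx (- B) A.
Proof. by apply/matrixP => i j; rewrite mxE !cmxE !mxE; simpc. Qed.

Lemma cmxZr p q c (A B : 'M[R]_(p, q)) : c%:C *: cmx A B = cmx (c *: A) (c *: B).
Proof. by apply/matrixP => i j; rewrite mxE !cmxE !mxE; simpc. Qed.

Lemma cmx_conj p q (A B : 'M[R]_(p, q)) : map_mx conjc (cmx A B) = cmx A (- B).
Proof. by apply/matrixP => i j; rewrite mxE !cmxE !mxE. Qed.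

Lemma cmx_decomp p q (Z : 'M[C]_(p, q)) :
  Z = cmx (map_mx (@complex.Re R) Z) (map_mx (@complex.Im R) Z).
Proof. by apply/matrixP => i j; rewrite cmxE !mxE; case: (Z i j). Qed.

Variable m : nat.
Implicit Type L : 'M[R]_m.

Lemma half_complex : 2^-1 = (2^-1 : R)%:C.
Proof. by rewrite fmorphV rmorph_nat. Qed.

Lemma proj10E L (z : 'rV[C]_m) :
  proj10 L z = z *m cmx (2^-1 *: 1%:M) (- (2^-1 *: L)).
Proof.
rewrite (cmx_decomp z) /proj10 cmx_real !cmxM cmxZi cmxN cmxD half_complex cmxZr.
by congr cmx; rewrite !mulmx0 ?mulmxN -!scalemxAr !mulmx1; mx_lra.
Qed.

Lemma proj01E L (z : 'rV[C]_m) :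
  proj01 L z = z *m cmx (2^-1 *: 1%:M) (2^-1 *: L).
Proof.
rewrite (cmx_decomp z) /proj01 cmx_real !cmxM cmxZi cmxD half_complex cmxZr.
by congr cmx; rewrite !mulmx0 -!scalemxAr !mulmx1; mx_lra.
Qed.

End ComplexMatrices.

Section QuaternionicForms.
Variables (R : realType) (m : nat) (I J K : 'M[R]_m).
Hypotheses (II : I *m I = - 1%:M) (JJ : J *m J = - 1%:M) (KK : K *m K = - 1%:M).
Hypothesis IJ : I *m J = K.

Definition omega_mx (h : 'M[R]_m) := cmx (J *m h) (- (K *m h)).

Lemma omega_mxD h h' : omega_mx (h + h') = omega_mx h + omega_mx h'.
Proof. by rewrite /omega_mx cmxD !mulmxDr opprD. Qed.

(** [D L] is the matrix of d(L du) for parallel L, so the middle factor is that of d applied to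
    \partial_J u = -1/2 (J - iK) du. Conjugation by the projection [P] onto T^{1,0} makes all four
    conjugates of S appear. *)
Lemma proj10_hessian (S : 'M[R]_m) : S^T = S ->
  let P := cmx (2^-1 *: 1%:M) (- (2^-1 *: I)) in
  let D L := S *m L^T - L *m S in
  P *m cmx (- (2^-1 *: D J)) (2^-1 *: D K) *m P^T = omega_mx (quat_avg I J K S).
Proof.
move=> ST P D; have [JI JK KJ KI IK] := quaternion_rel II JJ KK IJ.
have tE (A B C : 'M[R]_m) : A *m B = C -> B^T *m A^T = C^T by move=> <-; rewrite trmx_mul.
have ME (L L' L'' B : 'M[R]_m) : L *m L' = L'' -> L *m (L' *m B) = L'' *m B.
  by move=> <-; rewrite !mulmxA.
rewrite /P /D /omega_mx /quat_avg cmxT !cmxM !trmxN !trmxZ trmx1.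
congr cmx.
all: rewrite !(mulmxDl, mulmxDr, mulmxBl, mulmxBr, mulmxN, mulNmx) -!(scalemxAl, scalemxAr).
all: rewrite ?(mulmxDl, mulmxDr, mulmxBl, mulmxBr, mulmxN, mulNmx, mul1mx, mulmx1) -?mulmxA.
all: rewrite ?(tE _ _ _ IJ, tE _ _ _ IK) ?(ME _ _ _ _ IJ, ME _ _ _ _ IK, ME _ _ _ _ JJ, ME _ _ _ _
  JK, ME _ _ _ _ JI, ME _ _ _ _ KI, ME _ _ _ _ KJ, ME _ _ _ _ KK).
all: rewrite ?(mulNmx, mulmxN, mul1mx, mulmx1, trmxN).
all: mx_lra.
Qed.
End QuaternionicForms.

(** * Exterior derivative and bidegree in a chart *)

Section ComplexDerivative.
Variables (R : realType) (m : nat) (U : set 'rV[R]_m).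
Hypothesis oU : open U.
Local Notation pt := 'rV[R]_m.
Local Notation C := R[i].
Local Open Scope complex_scope.

Lemma cderiveE (F : pt -> C) y v : cderive F y v =
  \sum_j v 0 j * (pderiv j (fun z => complex.Re (F z)) y +i* pderiv j (fun z => complex.Im (F z)) y).
Proof. by apply: eq_bigr => j _; rewrite !pderivE. Qed.

Lemma cderive_eq_on (F G : pt -> C) y v : U y -> (forall z, U z -> F z = G z) ->
  cderive F y v = cderive G y v.
Proof.
move=> Uy FG; rewrite !cderiveE; apply: eq_bigr => j _; congr (_ * (_ +i* _)).
  by apply: (pderiv_eq_on j oU Uy) => z /FG ->.
by apply: (pderiv_eq_on j oU Uy) => z /FG ->.
Qed.

Lemma ext_d_eq_on k (a b : kform_field R m k) y X : U y ->
  (forall z Z, U z -> a z Z = b z Z) -> ext_d a y X = ext_d b y X.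
Proof.
by move=> Uy ab; apply: eq_bigr => s _; congr (_ * _); apply: cderive_eq_on => // z; exact: ab.
Qed.

Lemma cderive_real (u : pt -> R) y v :
  cderive (fun z => (u z)%:C) y v = \sum_j v 0 j * (pderiv j u y)%:C.
Proof.
rewrite cderiveE; apply: eq_bigr => j _ /=; congr (_ * (_ +i* _)); exact: pderiv_cst.
Qed.

Lemma cderive_covector (a b : pt -> 'cV[R]_m) (X v : 'rV[C]_m) y : U y ->
  smooth_mx_on U a -> smooth_mx_on U b ->
  cderive (fun z => (X *m cmx (a z) (b z)) 0 0) y v =
  (v *m cmx (\matrix_(j, k) pdmx j a y k 0) (\matrix_(j, k) pdmx j b y k 0) *m X^T) 0 0.
Proof.
move=> Uy sa sb; rewrite cderiveE -mulmxA mxE; apply: eq_bigr => j _; congr (_ * _).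
have E z : (X *m cmx (a z) (b z)) 0 0 =
    (\sum_k (complex.Re (X 0 k) * a z k 0 + (- complex.Im (X 0 k)) * b z k 0)) +i*
    (\sum_k (complex.Im (X 0 k) * a z k 0 + complex.Re (X 0 k) * b z k 0)).
  rewrite mxE -sum_complex; apply: eq_bigr => k _; rewrite cmxE; case: (X 0 k) => x x' /=; simpc.
  by rewrite [x * b z k 0 + _]addrC.
have s c (d : pt -> 'cV[R]_m) k : smooth_mx_on U d -> smooth_on U (fun z => c * d z k 0).
  by move=> sd; exact: (smoothM oU (smooth_cst _ _) (sd k 0)).
have P (p q : 'I_m -> R) :
    pderiv j (fun z => \sum_k (p k * a z k 0 + q k * b z k 0)) y =
    \sum_k (p k * pdmx j a y k 0 + q k * pdmx j b y k 0).
  rewrite (pderiv_sum j Uy _ oU) => [|k _]; last exact: (smoothD oU (s _ _ _ sa) (s _ _ _ sb)).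
  apply: eq_bigr => k _; rewrite (pderivD j Uy (s _ _ _ sa) (s _ _ _ sb)).
  rewrite (pderivM j Uy (smooth_cst _ _) (sa k 0)) (pderivM j Uy (smooth_cst _ _) (sb k 0)).
  by rewrite !pderiv_cst !mul0r !add0r !pdmxE.
rewrite (pderiv_ext j y (fun z => congr1 (@complex.Re R) (E z))) (pderiv_ext j y (fun z => congr1
  (@complex.Im R) (E z))) /= !P.
rewrite mxE -sum_complex; apply: eq_bigr => k _; rewrite cmxE !mxE; case: (X 0 k) => x x' /=; simpc.
by congr (_ +i* _); ring.
Qed.

Lemma ext_d1 (alpha : kform_field R m 1) y X : ext_d alpha y X =
  cderive (fun z => alpha z (fun=> X ord_max)) y (X ord0) -
  cderive (fun z => alpha z (fun=> X ord0)) y (X ord_max).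
Proof.
pose F (s : 'I_2) := (-1) ^+ s * cderive (fun z => alpha z (fun t => X (lift s t))) y (X s).
have -> : ext_d alpha y X = \sum_(s < 2) F s by [].
rewrite big_ord_recl big_ord1 {}/F expr0 expr1 mul1r mulN1r.
have -> : lift ord0 ord0 = ord_max :> 'I_2 by apply/val_inj.
have -> : (fun t : 'I_1 => X (lift ord0 t)) = fun=> X ord_max.
  by apply/funext => t; rewrite [t]ord1; congr X; apply/val_inj.
have -> // : (fun t : 'I_1 => X (lift ord_max t)) = fun=> X ord0.
by apply/funext => t; rewrite [t]ord1; congr X; apply/val_inj.
Qed.

Lemma ext_d_covector (a b : pt -> 'cV[R]_m) (alpha : kform_field R m 1) y X : U y ->
  smooth_mx_on U a -> smooth_mx_on U b ->
  (forall z Z, U z -> alpha z Z = (Z ord0 *m cmx (a z) (b z)) 0 0) ->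
  ext_d alpha y X = mx_form (cmx (curl a y) (curl b y)) X.
Proof.
move=> Uy sa sb aE; pose beta : kform_field R m 1 := fun z Z => (Z ord0 *m cmx (a z) (b z)) 0 0.
rewrite (@ext_d_eq_on 1 alpha beta y X Uy aE) ext_d1 /beta.
rewrite !(cderive_covector _ _ Uy sa sb) /mx_form.
set A := \matrix_(j, k) pdmx j a y k 0; set B := \matrix_(j, k) pdmx j b y k 0.
have -> : cmx (curl a y) (curl b y) = cmx A B - (cmx A B)^T.
  by rewrite cmxT cmxN cmxD; congr cmx; apply/matrixP => j k; rewrite curlE !mxE.
have subE (P Q : 'M[C]_1) : (P - Q) 0 0 = P 0 0 - Q 0 0 by rewrite !mxE.
rewrite mulmxBr mulmxBl subE; congr (_ + - _).
have trE (P : 'M[C]_1) : P^T 0 0 = P 0 0 by rewrite mxE.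
by rewrite -[LHS]trE !trmx_mul trmxK mulmxA.
Qed.

Lemma bidegree0 k L (alpha : kform R m k) X :
  bidegree 0 L alpha X = alpha (fun t => proj01 L (X t)).
Proof.
rewrite /bidegree (big_pred1 finset.set0) => [|S]; last by rewrite cards_eq0.
by congr alpha; apply/funext => t; rewrite finset.in_set0.
Qed.

Lemma bidegree_top k L (alpha : kform R m k) X :
  bidegree k L alpha X = alpha (fun t => proj10 L (X t)).
Proof.
rewrite /bidegree (big_pred1 (finset.setTfor 'I_k)) => [|S].
  by congr alpha; apply/funext => t; rewrite finset.in_setT.
have Sk := max_card (mem S); rewrite card_ord in Sk.
by rewrite [RHS]eqEcard finset.subsetT cardsT card_ord eqn_leq Sk.
Qed.

End ComplexDerivative.

Section HessianForm.
Variables (R : realType) (m : nat) (U : set 'rV[R]_m) (g I J K : 'rV[R]_m -> 'M[R]_m).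
Hypothesis hk : hyperkahler_chart U g I J K.
Variable u : 'rV[R]_m -> R.
Hypothesis su : smooth_on U u.
Local Notation C := R[i].
Local Open Scope complex_scope.

Lemma inv_complex_structure (L : 'M[R]_m) : L *m L = - 1%:M -> invmx L = - L.
Proof.
move=> LL; have E : - L *m L = 1%:M by rewrite mulNmx LL opprK.
by have [_ uL] := mulmx1_unit E; rewrite -[LHS]mul1mx -E mulmxK.
Qed.

Lemma curlZ (b : 'rV[R]_m -> 'cV[R]_m) c y : open U -> U y -> smooth_mx_on U b ->
  curl (fun z => c *: b z) y = c *: curl b y.
Proof.
move=> oU Uy sb; apply/matrixP => j k.
by rewrite mx_scaleE !curlE !(pdmxZ _ Uy _ sb) !mx_scaleE mulrBr.
Qed.

Lemma mx_form_mul (W P : 'M[C]_m) X :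
  mx_form W (fun t => X t *m P) = mx_form (P *m W *m P^T) X.
Proof. by rewrite /mx_form trmx_mul !mulmxA. Qed.

Let re_part z := (- 2^-1) *: (J z *m gradient u z).
Let im_part z := 2^-1 *: (K z *m gradient u z).

(** \partial_J u is the covector -1/2 (J - iK) du; KJ-type products come from composing the (0,1)
    projection with J^-1 = -J. *)
Lemma del_J_function z Z : U z ->
  del_J I J (fun_form u) z Z = (Z ord0 *m cmx (re_part z) (im_part z)) 0 0.
Proof.
move=> Uz; have [oU sg gs gu kI kJ kK IJ] := hk.
have [JI JK KJ KI IK] := hyperkahler_chart_quaternion Uz hk.
rewrite /del_J /delbar /endo_act big_ord1 bidegree0 /ext_d big_ord1 expr0 mul1r.
rewrite (_ : (fun z0 => bidegree _ _ _ _) = fun z => (u z)%:C); last first.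
  by apply/funext => z'; rewrite bidegree0.
rewrite cderive_real (_ : \sum_j _ = (proj01 (I z) (Z ord0 *m cplx (invmx (J z))) *m cmx (gradient
  u z) 0) 0 0); last first.
  by rewrite mxE; apply: eq_bigr => j _; rewrite cmxE !mxE.
rewrite proj01E inv_complex_structure; last exact: ke_sqr kJ _ Uz.
rewrite cmx_real -!mulmxA !cmxM; congr ((_ *m cmx _ _) 0 0).
  rewrite /re_part !mulmx0 !mul0mx; mx_expand_all;
    rewrite -?scalemxAl -?scalemxAr ?mulmx1 ?mul1mx -?scalemxAl; mx_lra.
rewrite /im_part -[K z]opprK -JI.
rewrite !mulmx0 !mul0mx; mx_expand_all; rewrite -?scalemxAl -?scalemxAr ?mulmx1 ?mul1mx -?scalemxAl
  ?mulmxA; mx_lra.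
Qed.

Lemma del_del_J_hess y X : U y ->
  del_del_J I J u y X =
  mx_form (omega_mx (J y) (K y) (quat_avg (I y) (J y) (K y) (hess g u y))) X.
Proof.
move=> Uy; have [oU sg gs gu kI kJ kK IJ] := hk.
have [nI nJ nK] : [/\ forall k, nabla_endo g k (I) y = 0, forall k, nabla_endo g k J y = 0 & forall
  k, nabla_endo g k K y = 0].
  by split=> k; have [] := hyperkahler_parallel k hk Uy.
have sG := smooth_gradient oU su.
have sJ := smooth_mxM oU (ke_smooth kJ) sG; have sK := smooth_mxM oU (ke_smooth kK) sG.
have sa : smooth_mx_on U re_part := smooth_mxZ oU _ sJ.
have sb : smooth_mx_on U im_part := smooth_mxZ oU _ sK.
(* \partial_J u has type (1,0): its (0,1) component vanishes and its (1,0) component is all of it,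
   so one term of [del] survives. *)
have E0 z Z : U z -> bidegree 0 (I z) (del_J I J (fun_form u) z) Z =
    (Z ord0 *m cmx (0 : 'cV[R]_m) 0) 0 0.
  move=> Uz; rewrite bidegree0 del_J_function // proj01E -mulmxA cmxM.
  have [JI JK KJ KI IK] := hyperkahler_chart_quaternion Uz hk.
  congr ((_ *m cmx _ _) 0 0); rewrite /re_part /im_part -!scalemxAr -!scalemxAl !mul1mx -?scalemxAr
    !mulmxA ?IK ?(IJ z Uz) ?mulNmx; mx_lra.
have E1 z Z : U z -> bidegree 1 (I z) (del_J I J (fun_form u) z) Z =
    (Z ord0 *m cmx (re_part z) (im_part z)) 0 0.
  move=> Uz; rewrite bidegree_top del_J_function // proj10E -mulmxA cmxM.
  have [JI JK KJ KI IK] := hyperkahler_chart_quaternion Uz hk.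
  congr ((_ *m cmx _ _) 0 0); rewrite /re_part /im_part ?mulNmx -!scalemxAr -!scalemxAl !mul1mx
    -?scalemxAr !mulmxA ?IK ?(IJ z Uz) ?mulNmx; mx_lra.
have s0 : smooth_mx_on U (fun=> 0 : 'cV[R]_m) by exact: smooth_mx_cst.
pose t0 : kform_field R m 1 := fun z => bidegree 0 (I z) (del_J I J (fun_form u) z).
pose t1 : kform_field R m 1 := fun z => bidegree 1 (I z) (del_J I J (fun_form u) z).
have -> : del_del_J I J u y X = bidegree 1 (I y) (ext_d t0 y) X + bidegree 2 (I y) (ext_d t1 y) X.
  by rewrite /del_del_J /del big_ord_recl big_ord1.
rewrite bidegree_top.
rewrite /bidegree big1 ?add0r => [|S _]; last first.
  rewrite (ext_d_covector oU _ Uy s0 s0 E0) /mx_form.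
  have -> : curl (fun=> (0 : 'cV[R]_m)) y = 0.
    by apply/matrixP => j k; rewrite curlE !pdmx_cst !mxE subrr.
  by rewrite -cmx_real /cplx raddf0 mulmx0 mul0mx mxE.
rewrite (ext_d_covector oU _ Uy sa sb E1) (curlZ _ oU Uy sJ) (curlZ _ oU Uy sK).
rewrite (curl_endo_gradient oU gs su (ke_smooth kJ) Uy nJ) (curl_endo_gradient oU gs su (ke_smooth kK) Uy nK).
rewrite (_ : (fun t => proj10 (I y) (X t)) = fun t => X t *m cmx (2^-1 *: 1%:M) (- (2^-1 *: I y))); last first.
  by apply/funext => t; rewrite proj10E.
rewrite mx_form_mul -(proj10_hessian (ke_sqr kI Uy) (ke_sqr kJ Uy) (ke_sqr kK Uy) (IJ y Uy)
  (hess_sym oU gs su Uy)).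
by rewrite scaleNr.
Qed.

End HessianForm.

Section ClosedForms.
Variables (R : realType) (m : nat) (U : set 'rV[R]_m) (W : 'rV[R]_m -> 'M[R]_m).
Hypothesis oU : open U.
Local Notation C := R[i].
Local Open Scope complex_scope.

Lemma mx_form_delta (V : 'M[C]_m) (X : 'I_2 -> 'rV[C]_m) i j :
  X ord0 = delta_mx 0 i -> X ord_max = delta_mx 0 j -> mx_form V X = V i j.
Proof. by move=> Xi Xj; rewrite /mx_form Xi Xj -rowE trmx_delta -colE !mxE. Qed.

(** dW is evaluated on three coordinate vectors; antisymmetry of W turns the alternating sum into
    the cyclic one. *)
Lemma closed_cyclic y : U y -> smooth_mx_on U W -> (forall z, U z -> (W z)^T = - W z) ->
  (forall X, ext_d (fun z => mx_form (cplx (W z))) y X = 0) -> pd_cyclic W y.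
Proof.
move=> Uy sW Wa dW k i j.
pose d : 'I_3 -> 'I_m := tnth [tuple i; j; k].
pose X t : 'rV[C]_m := delta_mx 0 (d t).
pose T (s : 'I_3) := pdmx (d s) W y (d (lift s ord0)) (d (lift s ord_max)).
pose F (s : 'I_3) : C := (-1) ^+ s * cderive (fun z => mx_form (cplx (W z)) (fun t => X (lift s t))) y (X s).
have FE s : F s = (-1) ^+ s * (T s)%:C.
  rewrite /F; congr (_ * _).
  have -> : (fun z => mx_form (cplx (W z)) (fun t => X (lift s t))) =
            fun z => (W z (d (lift s ord0)) (d (lift s ord_max)))%:C.
    by apply/funext => z; rewrite (mx_form_delta _ (erefl _) (erefl _)) mxE.
  rewrite cderive_real (bigD1 (d s)) //= big1 ?addr0 => [|l /negPf ls].
    by rewrite mxE !eqxx mul1r /T pdmxE.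
  by rewrite mxE ls andbF mul0r.
have := dW X; rewrite (_ : ext_d _ _ _ = \sum_(s < 3) F s) //.
rewrite !big_ord_recl big_ord0 !FE addr0.
rewrite (_ : T ord0 = pdmx i W y j k) // (_ : T (lift ord0 ord0) = pdmx j W y i k) //.
rewrite (_ : T (lift ord0 (lift ord0 ord0)) = pdmx k W y i j) //.
rewrite expr0 expr1 [(-1) ^+ _]sqrrN expr1n !mul1r mulN1r -!(rmorphN, rmorphD) /= => /(congr1
  (@complex.Re R)) /= E.
have -> : pdmx j W y k i = - pdmx j W y i k.
  rewrite -(mx_oppE (pdmx j W y)) -(pdmxN j Uy sW) -(pdmx_eq_on oU j Uy Wa).
  by rewrite pdmxT mx_trE.
by rewrite -E; lra.
Qed.
End ClosedForms.

(** * Pairings of vectors of type (1,0) *)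

Section PointwiseForms.
Variables (R : realType) (m : nat) (I J K : 'M[R]_m).
Hypotheses (II : I *m I = - 1%:M) (JJ : J *m J = - 1%:M) (KK : K *m K = - 1%:M).
Hypothesis IJ : I *m J = K.
Local Notation C := R[i].
Local Open Scope complex_scope.

Definition vec10 (X : 'rV[R]_m) : 'rV[C]_m := cmx (2^-1 *: X) (- (2^-1 *: (X *m I))).

Lemma vec10_type X : vec10 X *m cplx I = 'i%C *: vec10 X.
Proof.
rewrite /vec10 cmx_real cmxM cmxZi; congr cmx; rewrite !mulmx0 ?subr0 ?add0r ?mulNmx -!scalemxAl -?mulmxA ?II;
  mx_expand_all; mx_lra.
Qed.

Lemma vec10_conj X : map_mx conjc (vec10 X) *m cplx J = cmx (2^-1 *: (X *m J)) (2^-1 *: (X *m K)).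
Proof.
rewrite /vec10 cmx_conj cmx_real cmxM; congr cmx; rewrite !mulmx0 ?opprK -!scalemxAl -?mulmxA ?IJ; mx_lra.
Qed.

Lemma vec10_neq0 X : X != 0 -> vec10 X != 0.
Proof.
apply: contra_neq => X0; apply/rowP => j; have := congr1 (fun A : 'rV[C]_m => complex.Re (A 0 j)) X0.
by rewrite /vec10 /= cmxE !mxE /= => H; lra.
Qed.

(** This is \bar z J for z = [vec10 X], the second argument in the definition of positivity; see
    [vec10_conj]. *)
Definition vec10J (X : 'rV[R]_m) : 'rV[C]_m := cmx (2^-1 *: (X *m J)) (2^-1 *: (X *m K)).

Lemma vec10_omega h X : vec10 X *m omega_mx J K h = cmx (X *m J *m h) (- (X *m K *m h)).
Proof.
have [JI JK KJ KI IK] := quaternion_rel II JJ KK IJ.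
rewrite /vec10 /omega_mx cmxM; congr cmx; rewrite ?mulmxN ?mulNmx ?opprK -!scalemxAl !mulmxA.
  by rewrite -[X *m I *m K]mulmxA IK mulmxN mulNmx; mx_lra.
by rewrite -[X *m I *m J]mulmxA IJ; mx_lra.
Qed.

Lemma vec10J_omega h X : vec10J X *m omega_mx J K h = cmx (- (X *m h)) (- (X *m I *m h)).
Proof.
have [JI JK KJ KI IK] := quaternion_rel II JJ KK IJ.
rewrite /vec10J /omega_mx cmxM; congr cmx; rewrite ?mulmxN ?mulNmx ?opprK -!scalemxAl !mulmxA.
  by rewrite -[X *m J *m J]mulmxA -[X *m K *m K]mulmxA JJ KK !mulmxN !mulNmx mulmx1; mx_lra.
by rewrite -[X *m J *m K]mulmxA -[X *m K *m J]mulmxA JK KJ mulmxN mulNmx; mx_lra.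
Qed.

Lemma hermitian_tr (L h : 'M[R]_m) : L *m L = - 1%:M -> L *m h *m L^T = h -> h *m L^T = - (L *m h).
Proof. by move=> LL hL; rewrite -{2}hL !mulmxA LL !mulNmx mul1mx opprK. Qed.

Section Pairings.
Variable h : 'M[R]_m.
Hypothesis hH : quat_hermitian I J K h.

Lemma pair_vec10 X Y : vec10 X *m omega_mx J K h *m (vec10 Y)^T =
  cmx (X *m J *m h *m Y^T) (- (X *m K *m h *m Y^T)).
Proof.
have [JI JK KJ KI IK] := quaternion_rel II JJ KK IJ; have [hI hJ hK] := hH.
have tI := hermitian_tr II hI.
rewrite vec10_omega /vec10 cmxT cmxM !trmxN !trmxZ !trmx_mul; congr cmx;
  rewrite ?mulmxN ?mulNmx ?opprK -!scalemxAr.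
  rewrite [X *m K *m h *m (_ *m _)]mulmxA -[X *m K *m h *m _]mulmxA tI mulmxN mulNmx !mulmxA.
  by rewrite -[X *m K *m I]mulmxA KI; mx_lra.
rewrite [X *m J *m h *m (_ *m _)]mulmxA -[X *m J *m h *m _]mulmxA tI mulmxN mulNmx !mulmxA.
by rewrite -[X *m J *m I]mulmxA JI mulmxN !mulNmx; mx_lra.
Qed.

Lemma pair_vec10J X Y : vec10J X *m omega_mx J K h *m (vec10J Y)^T =
  cmx (X *m J *m h *m Y^T) (X *m K *m h *m Y^T).
Proof.
have [JI JK KJ KI IK] := quaternion_rel II JJ KK IJ; have [hI hJ hK] := hH.
have tJ := hermitian_tr JJ hJ; have tK := hermitian_tr KK hK.
rewrite vec10J_omega /vec10J cmxT cmxM !trmxZ !trmx_mul -!scalemxAr !mulNmx !mulmxA.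
rewrite -[X *m h *m J^T]mulmxA -[X *m h *m K^T]mulmxA -[X *m I *m h *m J^T]mulmxA -[X *m I *m h *m K^T]mulmxA.
rewrite tJ tK !mulmxN !mulNmx !mulmxA -[X *m I *m K]mulmxA -[X *m I *m J]mulmxA IK IJ mulmxN !mulNmx.
by congr cmx; mx_lra.
Qed.

Lemma pair_vec10_vec10J X Y : vec10 X *m omega_mx J K h *m (vec10J Y)^T =
  cmx (X *m h *m Y^T) (- (X *m I *m h *m Y^T)).
Proof.
have [JI JK KJ KI IK] := quaternion_rel II JJ KK IJ; have [hI hJ hK] := hH.
have tJ := hermitian_tr JJ hJ; have tK := hermitian_tr KK hK.
rewrite vec10_omega /vec10J cmxT cmxM !trmxZ !trmx_mul -!scalemxAr !mulNmx !mulmxA.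
rewrite -[X *m J *m h *m J^T]mulmxA -[X *m J *m h *m K^T]mulmxA -[X *m K *m h *m J^T]mulmxA -[X *m
  K *m h *m K^T]mulmxA.
rewrite tJ tK !mulmxN !mulNmx !mulmxA -[X *m J *m J]mulmxA -[X *m J *m K]mulmxA -[X *m K *m
  J]mulmxA -[X *m K *m K]mulmxA.
rewrite JJ JK KJ KK !mulmxN !mulNmx mulmx1.
by congr cmx; mx_lra.
Qed.

Lemma omega_mx_anti : h^T = h -> (omega_mx J K h)^T = - omega_mx J K h.
Proof.
move=> hT; have [hI hJ hK] := hH.
by rewrite /omega_mx cmxT cmxN trmxN !trmx_mul hT (hermitian_tr JJ hJ) (hermitian_tr KK hK).
Qed.

(** On z = [vec10 X] the form takes the value h(X, X) - i h(XI, X); positivity of a complex number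
    bears on its real part. *)
Lemma positive20_posdef : positive20 I J (mx_form (omega_mx J K h)) -> posdef h.
Proof.
move=> pos X X0; have := pos (vec10 X) (vec10_type X) (vec10_neq0 X0).
rewrite vec10_conj /mx_form (tnth_nth 0) /= (tnth_nth 0) /= -/(vec10J X) pair_vec10_vec10J cmxE ltcE /=.
by case/andP.
Qed.

End Pairings.
End PointwiseForms.

Section FormNorm.
Variables (R : realType) (m : nat).
Local Notation C := R[i].
Local Open Scope complex_scope.

Lemma sum_ffun2 (V : nmodType) (T : finType) (F : T -> T -> V) :
  \sum_(i : {ffun 'I_2 -> T}) F (i ord0) (i ord_max) = \sum_a \sum_b F a b.
Proof.
rewrite pair_big /=.
pose f (p : T * T) : {ffun 'I_2 -> T} := [ffun t => if t == ord0 then p.1 else p.2].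
rewrite (reindex f); first by apply: eq_bigr => p _; rewrite !ffunE.
exists (fun i : {ffun 'I_2 -> T} => (i ord0, i ord_max)) => [[a b] _|i _]; first by rewrite !ffunE.
by apply/ffunP => t; rewrite ffunE; case: t => [[|[|]]] //= lt; congr (i _); apply/val_inj.
Qed.

Lemma Re_sum (T : Type) (r : seq T) (P : pred T) (F : T -> C) :
  complex.Re (\sum_(i <- r | P i) F i) = \sum_(i <- r | P i) complex.Re (F i).
Proof. by elim/big_rec2: _ => // i x z _ <-; case: (F i) z => a b [c d]. Qed.

Lemma trace4 (G A B : 'M[R]_m) : \tr (G^T *m A *m B *m A^T) =
  \sum_a \sum_b \sum_c \sum_d G a c * B b d * (A a b * A c d).
Proof.
rewrite exchange_big [RHS](eq_bigr _ (fun b _ => exchange_big _ _ _ _ _ _)) [RHS]exchange_big /=.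
apply: eq_bigr => c _; rewrite mxE.
rewrite [RHS](eq_bigr _ (fun b _ => exchange_big _ _ _ _ _ _)) [RHS]exchange_big /=.
apply: eq_bigr => d _; rewrite mxE mulr_suml; apply: eq_bigr => b _.
rewrite mxE !mulr_suml; apply: eq_bigr => a _; rewrite !mxE; ring.
Qed.

(** The real part JH and the imaginary part -KH contribute equally, by invariance of g^-1; the
    factor 1/2! of the norm absorbs the resulting 2. *)
Lemma form_norm_omega (I J K g H : 'M[R]_m) :
  quat_invariant I J K (invmx g) -> (invmx g)^T = invmx g -> H^T = H ->
  form_norm g (mx_form (omega_mx J K H)) =
  Num.sqrt (\tr (invmx g *m H *m invmx g *m H)).
Proof.
move=> [GI GJ GK] GT HT; rewrite /form_norm; congr Num.sqrt.
set G := invmx g in GI GJ GK GT *.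
pose A := J *m H; pose B := - (K *m H).
pose F a b c d : C := (G a c * G b d)%:C * (cmx A B a b * conjc (cmx A B c d)).
rewrite (_ : \sum_i _ = \sum_(i : {ffun 'I_2 -> 'I_m}) \sum_(j : {ffun 'I_2 -> 'I_m})
   F (i ord0) (i ord_max) (j ord0) (j ord_max)); last first.
  apply: eq_bigr => i _; apply: eq_bigr => j _; rewrite /F; congr (_ * (_ * conjc _)).
  - rewrite big_ord_recl big_ord1 rmorphM /= !mxE; congr (_ * (G _ _)%:C); congr fun_of_fin; exact/val_inj.
  - exact: mx_form_delta.
  - exact: mx_form_delta.
have -> : \sum_(i : {ffun 'I_2 -> 'I_m}) \sum_(j : {ffun 'I_2 -> 'I_m})
   F (i ord0) (i ord_max) (j ord0) (j ord_max) = \sum_a \sum_b \sum_c \sum_d F a b c d.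
  rewrite -(sum_ffun2 (fun a b => \sum_c \sum_d F a b c d)); apply: eq_bigr => i _.
  exact: (sum_ffun2 (F (i ord0) (i ord_max))).
have -> : ((2`!)%:R^-1 : C) = (2^-1)%:C by rewrite fmorphV rmorph_nat.
have ReM c (z : C) : complex.Re (c%:C * z) = c * complex.Re z.
  by case: z => a b /=; rewrite mul0r subr0.
rewrite ReM Re_sum.
have -> : \sum_a complex.Re (\sum_b \sum_c \sum_d F a b c d) =
  \tr (G^T *m A *m G *m A^T) + \tr (G^T *m B *m G *m B^T).
  rewrite !trace4 -big_split; apply: eq_bigr => a _ /=; rewrite Re_sum -big_split.
  apply: eq_bigr => b _ /=; rewrite Re_sum -big_split; apply: eq_bigr => c _ /=.
  rewrite Re_sum -big_split; apply: eq_bigr => d _ /=; rewrite ReM !cmxE /=; ring.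
have E L : L^T *m G *m L = G -> \tr (G *m (L *m H) *m G *m (L *m H)^T) = \tr (G *m H *m G *m H).
  by move=> GL; rewrite trmx_mul HT !mulmxA mxtrace_mulC !mulmxA GL.
rewrite GT /A /B E //.
rewrite !trmxN !mulmxN !mulNmx opprK E //; lra.
Qed.
End FormNorm.

(** * The quaternionic volume *)

Section WedgePowers.
Variables (R : realType) (m : nat).
Local Notation C := R[i].
Local Notation vec := 'rV[C]_m.
Local Open Scope complex_scope.

Lemma wedge_perm k l (alpha : kform R m k) (beta : kform R m l) X (p : 'S_(k + l)) :
  wedge alpha beta (fun t => X (p t)) = (-1) ^+ odd_perm p * wedge alpha beta X.
Proof.
rewrite /wedge mulrCA; congr (_ * _); rewrite mulr_sumr (reindex_inj (mulIg p^-1)%g) /=.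
rewrite [RHS](reindex_inj (mulgI 1%g)) /=; apply: eq_bigr => s _.
rewrite mul1g odd_permM odd_permV signr_addb [(-1) ^+ s * _]mulrC -mulrA.
congr (_ * (_ * (alpha _ * beta _))); apply/funext => t; congr X; by rewrite permM permKV.
Qed.

Lemma wedge_pow_perm k (alpha : kform R m k) n X (p : 'S_(n * k)) :
  wedge_pow alpha n (fun t => X (p t)) = (-1) ^+ odd_perm p * wedge_pow alpha n X.
Proof.
case: n p X => [|n] p X; last exact: wedge_perm.
have -> : p = 1%g by apply/permP => -[].
by rewrite odd_perm1 mul1r.
Qed.

Lemma wedge_powE k (alpha : kform R m k) n X :
  wedge_pow alpha n.+1 X = wedge alpha (wedge_pow alpha n) X.
Proof. by []. Qed.

(** The family Z is fixed and f selects from it, because the recursion evaluates lower powers on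
    permuted subfamilies. *)
Lemma wedge_pow_scale (T : Type) (alpha beta : kform R m 2) (Z : T -> vec) (c : T -> C) n
    (f : 'I_(n * 2) -> T) :
  (forall h : 'I_2 -> T, alpha (Z \o h) = c (h ord0) * c (h ord_max) * beta (Z \o h)) ->
  wedge_pow alpha n (Z \o f) = (\prod_t c (f t)) * wedge_pow beta n (Z \o f).
Proof.
move=> ab; elim: n f => [|n IH] f; first by rewrite big_ord0 mulr1.
rewrite !wedge_powE /wedge mulrCA; congr (_ * _).
rewrite mulr_sumr; apply: eq_bigr => s _.
pose f0 t := f (s (lshift (n * 2) t)); pose f' t := f (s (rshift 2 t)).
transitivity ((-1) ^+ odd_perm s * ((c (f0 ord0) * c (f0 ord_max) * beta (Z \o f0)) *
    (\prod_t c (f' t) * wedge_pow beta n (Z \o f')))).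
  by rewrite -(ab f0) -(IH f').
rewrite [RHS]mulrCA; congr (_ * _).
rewrite [\prod_(t < n.+1 * 2) _](reindex_inj (@perm_inj _ s)) [\prod_(t < n.+1 * 2)
  _](@big_split_ord _ _ _ 2 (n * 2)).
rewrite big_ord_recl big_ord1.
have -> : lift ord0 ord0 = ord_max :> 'I_2 by apply/val_inj.
by rewrite -!mulrA; congr (_ * (_ * _)); rewrite mulrCA.
Qed.

(** Gram matrix of a symplectic basis listed in blocks: 1 on (2k, 2k+1), -1 on (2k+1, 2k), and 0
    elsewhere. *)
Definition darboux (a b : nat) : C := (a./2 == b./2)%:R * ((odd b)%:R - (odd a)%:R).

Lemma darboux_anti a b : darboux b a = - darboux a b.
Proof. by rewrite /darboux eq_sym -mulrN opprB. Qed.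

Lemma darboux_neq0 a b : darboux a b != 0 -> a./2 = b./2 /\ odd a = ~~ odd b.
Proof.
rewrite /darboux; have [ab|_] := eqVneq a./2 b./2; last by rewrite mul0r eqxx.
by rewrite mul1r; case: (odd a); case: (odd b); rewrite ?subrr ?eqxx.
Qed.

Lemma lift_perm_fix n (s : 'S_n.+1) : s ord0 = ord0 -> exists s', s = lift_perm ord0 ord0 s'.
Proof.
move=> s0.
have sk k : exists j, s (lift ord0 k) = lift ord0 j.
  case: (unliftP ord0 (s (lift ord0 k))) => [j ->|/eqP]; first by exists j.
  by rewrite -{2}s0 (inj_eq perm_inj) eq_sym (negPf (neq_lift _ _)).
pose f k := odflt k (unlift ord0 (s (lift ord0 k))).
have fE k : lift ord0 (f k) = s (lift ord0 k).
  by have [j E] := sk k; rewrite /f E liftK.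
have fi : injective f.
  by move=> a b /(congr1 (lift ord0)); rewrite !fE => /perm_inj /lift_inj.
exists (perm fi); apply/permP => i; case: (unliftP ord0 i) => [k ->|->].
  by rewrite lift_perm_lift permE fE.
by rewrite lift_perm_id.
Qed.

Section Positivity.
Variable V : 'M[C]_m.
Hypothesis VT : V^T = - V.

Lemma mx_form_anti (x y : vec) : (x *m V *m y^T) 0 0 = - (y *m V *m x^T) 0 0.
Proof.
have trE (P : 'M[C]_1) : P^T 0 0 = P 0 0 by rewrite mxE.
by rewrite -[LHS]trE !trmx_mul trmxK VT mulNmx mulmxN mulmxA mxE.
Qed.

Definition darboux_family n (X : 'I_(n * 2) -> vec) :=
  forall a b, (X a *m V *m (X b)^T) 0 0 = darboux a b.

Let i0 n : 'I_(2 + n * 2) := ord0.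
Let i1 n : 'I_(2 + n * 2) := lift ord0 ord0.

Definition wedge_term n (X : 'I_(2 + n * 2) -> vec) (s : 'S_(2 + n * 2)) : C :=
  (-1) ^+ odd_perm s * ((X (s (i0 n)) *m V *m (X (s (i1 n)))^T) 0 0 *
    wedge_pow (mx_form V) n (fun t => X (s (rshift 2 t)))).

Lemma wedge_powS n (X : 'I_(2 + n * 2) -> vec) :
  wedge_pow (mx_form V) n.+1 X = (2`! * (n * 2)`!)%:R^-1 * \sum_s wedge_term X s.
Proof.
rewrite wedge_powE /wedge; congr (_ * _); apply: eq_bigr => s _; rewrite /wedge_term /mx_form.
have -> : lshift (n * 2) ord0 = i0 n by apply/val_inj.
by have -> : lshift (n * 2) ord_max = i1 n by apply/val_inj.
Qed.

(** The permutation acts on the remaining vectors only, and its sign is compensated by the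
    antisymmetry of the lower power. *)
Lemma wedge_term_fix n X (s : 'S_(2 + n * 2)) : s (i0 n) = i0 n -> s (i1 n) = i1 n ->
  wedge_term X s = wedge_term X 1%g.
Proof.
move=> s0 s1; have [s' E] := lift_perm_fix s0; have s'0 : s' ord0 = ord0.
  by apply: (@lift_inj _ ord0); rewrite -(lift_perm_lift ord0 ord0 s') -E.
have [r E'] := lift_perm_fix s'0; rewrite /wedge_term s0 s1 !perm1 odd_perm1 mul1r.
rewrite mulrCA; congr (_ * _).
have rs (t : 'I_(n * 2)) : rshift 2 t = lift ord0 (lift ord0 t) by apply/val_inj.
rewrite (_ : (fun t => X (s (rshift 2 t))) = fun t => X (rshift 2 (r t))); last first.
  by apply/funext => t; rewrite !rs E E' !lift_perm_lift.
rewrite (wedge_pow_perm _ (fun t => X (rshift 2 t))) E E' !odd_lift_perm /= mulrA -expr2 sqrr_sign mul1r.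
by congr wedge_pow; apply/funext => t; rewrite perm1.
Qed.

(** Exchanging the two front positions changes both the sign of the permutation and that of the
    form. *)
Lemma wedge_term_flip n X (s : 'S_(2 + n * 2)) :
  wedge_term X (tperm (i0 n) (i1 n) * s)%g = wedge_term X s.
Proof.
rewrite /wedge_term odd_permM odd_tperm /= signrN !permM tpermL tpermR mx_form_anti.
rewrite mulNr mulNr mulrN opprK; congr (_ * (_ * _)); congr wedge_pow; apply/funext => t.
by rewrite permM tpermD.
Qed.

Lemma wedge_term_shift n X (s p : 'S_(2 + n * 2)) : ~~ odd_perm p ->
  wedge_term (fun a => X (p^-1 a)%g) (s * p)%g = wedge_term X s.
Proof.
move=> /negPf op; rewrite /wedge_term odd_permM op addbF !permM !permK.
by congr (_ * (_ * _)); congr wedge_pow; apply/funext => t; rewrite permM permK.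
Qed.

(* Every nonzero term of the sum over permutations pairs two vectors of one
   block; an even permutation moves that block to the front. *)
Lemma wedge_pow_darboux_pos n (X : 'I_(n * 2) -> vec) : darboux_family X ->
  0 < wedge_pow (mx_form V) n X.
Proof.
elim: n X => [|n IH] X XD; first exact: ltr01.
(* Removing the front block leaves a Darboux family, to which the induction hypothesis applies. *)
have t1 Y : darboux_family (n := n.+1) Y -> 0 < wedge_term Y 1%g.
  move=> YD; rewrite /wedge_term odd_perm1 mul1r !perm1 YD /darboux /= subr0 !mulr1 mul1r.
  rewrite (_ : (fun t => _) = fun t => Y (rshift 2 t)); last by apply/funext => t; rewrite perm1.
  by apply: IH => a b; rewrite YD /darboux /= !negbK.
rewrite wedge_powS mulr_gt0 //.
have pos Y (s : 'S_(2 + n * 2)) : darboux_family (n := n.+1) Y -> ~~ odd (s (i0 n)) ->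
    darboux (s (i0 n)) (s (i1 n)) != 0 -> 0 < wedge_term Y s.
  move=> YD; move Ea : (s (i0 n)) => a; move Eb : (s (i1 n)) => b ae /darboux_neq0[ab ob].
  (* [p] exchanges the front block with {a, b}, preserving the order inside blocks. It is a product
     of two transpositions, both trivial if the block is already in front, hence even, and it
     preserves [darboux]. *)
  pose p : 'S_(2 + n * 2) := (tperm (i0 n) a * tperm (i1 n) b)%g.
  have [k [ak bk]] : exists k, (a : nat) = (2 * k)%N /\ (b : nat) = (2 * k).+1.
    exists a./2; split; first by rewrite mul2n -[LHS]odd_double_half (negPf ae).
    have ob' : odd b by rewrite -[odd b]negbK -ob.
    by rewrite mul2n -[LHS]odd_double_half ob' ab.
  have ne1 : i1 n != a by rewrite -val_eqE /= /bump /= ak; lia.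
  have ne2 : b != a by rewrite -val_eqE /= /bump /= ak bk; lia.
  have ne3 : b != i0 n by rewrite -val_eqE /= bk.
  have pE x : p x = (if x == i0 n then a else if x == a then i0 n else
      if x == i1 n then b else if x == b then i1 n else x) :> nat.
    rewrite /p permM; case: (tpermP (i0 n) a x) => [->|->|/eqP/negPf -> /eqP/negPf ->]; rewrite ?eqxx.
    - by rewrite tpermD.
    - by case: eqP => [->|_]; rewrite tpermD.
    by case: tpermP => [->|->|/eqP/negPf -> /eqP/negPf ->]; rewrite ?eqxx //; case: eqP => [->|].
  have op : ~~ odd_perm p.
    by rewrite /p odd_permM !odd_tperm -!val_eqE /= /bump /= ak bk; case: (k).
  have half x : (p x)./2 = (if x./2 == 0 then a./2 else if x./2 == a./2 then 0 else x./2)%N.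
    rewrite pE -!val_eqE /= /bump /= ak bk; do !case: eqP => //; lia.
  have oddp x : odd (p x) = odd x.
    rewrite pE -!val_eqE /= /bump /= ak bk; do !case: eqP => //; rewrite ?/i0 ?/i1 /=; lia.
  have pd x y : darboux (p x) (p y) = darboux x y.
    rewrite /darboux !oddp !half; congr ((nat_of_bool _)%:R * _).
    by do !case: eqP => //; lia.
  rewrite -(wedge_term_shift Y s op) wedge_term_fix.
  - by apply: t1 => x y; rewrite YD -pd !permKV.
  - by rewrite permM Ea; apply/val_inj => /=; rewrite pE eqxx; case: eqP => // ->.
  - rewrite permM Eb; apply/val_inj => /=; rewrite pE -!val_eqE /= /bump /= ak bk; do !case: eqP => //; lia.
(* A pairing that starts with the odd vector of its block is first flipped. *)
have nneg s : 0 <= wedge_term X s.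
  case: (eqVneq (darboux (s (i0 n)) (s (i1 n))) 0) => [d0|dn].
    by rewrite /wedge_term XD d0 mul0r mulr0.
  case: (boolP (odd (s (i0 n)))) => [s0|s0]; last exact/ltW/pos.
  have [h par] := darboux_neq0 dn.
  rewrite -wedge_term_flip; apply/ltW/pos => //; rewrite !permM tpermL ?tpermR.
    by rewrite -par.
  by rewrite darboux_anti oppr_eq0.
rewrite (bigD1 1%g) //=; apply: ltr_wpDr; last exact: t1.
by apply: sumr_ge0.
Qed.
End Positivity.
End WedgePowers.

Lemma prod_block2 (R : realType) n (F : nat -> R) : (forall j, 0 <= F j) ->
  \prod_(t < n * 2) Num.sqrt (F t./2) = \prod_(j < n) F j.
Proof.
move=> F0; rewrite -(big_mkord xpredT (fun t => Num.sqrt (F t./2))) -(big_mkord xpredT F).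
elim: n => [|n IH]; first by rewrite mul0n !big_geq.
rewrite mulSn addnC !addnS addn0 !big_nat_recr //= IH -mulrA; congr (_ * _).
have -> : uphalf (n * 2) = n by lia.
have -> : (n * 2)./2 = n by lia.
by rewrite -expr2 sqr_sqrtr.
Qed.

Section FrameVolume.
Variables (R : realType) (n m : nat) (I J K g h : 'M[R]_m) (e : nat -> 'rV[R]_m) (lam : nat -> R).
Hypotheses (II : I *m I = - 1%:M) (JJ : J *m J = - 1%:M) (KK : K *m K = - 1%:M).
Hypothesis IJ : I *m J = K.
Hypotheses (gT : g^T = g).
Hypotheses (gH : quat_hermitian I J K g) (hH : quat_hermitian I J K h).
Hypothesis F : quat_frame I J K g h n e lam.
Hypothesis lam_pos : forall j, (j < n)%N -> 0 < lam j.
Local Open Scope complex_scope.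

(** The vectors z_j, \bar z_j J attached to the frame: a Darboux basis of T^{1,0} for the form of
    g. *)
Definition frame_vec (t : nat) : 'rV[R[i]]_m :=
  if odd t then vec10J J K (e t./2) else vec10 I (e t./2).

Let ltn_half (t : 'I_(n * 2)) : (t./2 < n)%N.
Proof. by have := ltn_ord t; lia. Qed.

Lemma frame_row_form j q : (j < n)%N ->
  e j *m quat_unit I J K q *m h = lam j *: (e j *m quat_unit I J K q *m g).
Proof.
move=> jn; apply/rowP => l; rewrite mx_scaleE.
have := qf_diag_unit II JJ KK gH hH q (delta_mx 0 l) F jn.
by rewrite /bform !trmx_delta -!colE !mxE.
Qed.

Lemma frame_vec_scale (t : 'I_(n * 2)) :
  frame_vec t *m omega_mx J K h = (lam t./2)%:C *: (frame_vec t *m omega_mx J K g).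
Proof.
have [E0 E1 E2 E3] := quat_unitE I J K.
have H q := frame_row_form q (ltn_half t).
have := H (inord 0); rewrite E0 mulmx1 => H0; have := H (inord 1); rewrite E1 => H1.
have := H (inord 2); rewrite E2 => H2; have := H (inord 3); rewrite E3 => H3.
rewrite /frame_vec; case: (odd t).
  by rewrite !(vec10J_omega II JJ KK IJ) cmxZr H0 H1 !scalerN.
by rewrite !(vec10_omega II JJ KK IJ) cmxZr H2 H3 !scalerN.
Qed.

Lemma frame_darboux (s t : 'I_(n * 2)) :
  (frame_vec s *m omega_mx J K g *m (frame_vec t)^T) 0 0 = darboux R s t.
Proof.
have [E0 E1 E2 E3] := quat_unitE I J K.
have orth q q' (a b : 'I_(n * 2)) := qf_orth F q q' (ltn_half a) (ltn_half b).
have ne a b : (a < 4)%N -> (b < 4)%N -> ((inord a : 'I_4) == inord b) = (a == b).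
  by move=> a4 b4; rewrite -val_eqE /= !inordK.
have orth0 q (a b : 'I_(n * 2)) : (e a./2 *m quat_unit I J K q *m g *m (e b./2)^T) 0 0 =
    ((a./2 == b./2) && (q == inord 0))%:R.
  by have := orth q (inord 0) a b; rewrite E0 mulmx1.
have h0 (a b : 'I_(n * 2)) : (e a./2 *m g *m (e b./2)^T) 0 0 = (a./2 == b./2)%:R.
  by have := orth0 (inord 0) a b; rewrite E0 mulmx1 eqxx andbT.
have h1 (a b : 'I_(n * 2)) : (e a./2 *m I *m g *m (e b./2)^T) 0 0 = 0.
  by have := orth0 (inord 1) a b; rewrite E1 ne //= andbF.
have h2 (a b : 'I_(n * 2)) : (e a./2 *m J *m g *m (e b./2)^T) 0 0 = 0.
  by have := orth0 (inord 2) a b; rewrite E2 ne //= andbF.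
have h3 (a b : 'I_(n * 2)) : (e a./2 *m K *m g *m (e b./2)^T) 0 0 = 0.
  by have := orth0 (inord 3) a b; rewrite E3 ne //= andbF.
rewrite /frame_vec /darboux; case os: (odd s); case ot: (odd t).
- by rewrite (pair_vec10J II JJ KK IJ gH) cmxE h2 h3 subrr mulr0.
- rewrite (mx_form_anti (omega_mx_anti JJ KK gH gT)) (pair_vec10_vec10J II JJ KK IJ gH) cmxE mx_oppE h0 h1.
  rewrite oppr0 sub0r mulrN1 [(s./2 == _)]eq_sym.
  by case: eqP.
- rewrite (pair_vec10_vec10J II JJ KK IJ gH) cmxE mx_oppE h0 h1 oppr0 subr0 mulr1.
  by case: eqP.
- by rewrite (pair_vec10 II JJ KK IJ gH) cmxE mx_oppE h2 h3 oppr0 subrr mulr0.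
Qed.

(** On the Darboux basis the form of h is that of g with each vector scaled by the square root of
    its eigenvalue. The n-th powers thus differ by the product of the eigenvalues, and the power for
    g is nonzero. *)
Lemma frame_volume (D : R) :
  (forall X, wedge_pow (mx_form (omega_mx J K h)) n X =
     D%:C * wedge_pow (mx_form (omega_mx J K g)) n X) -> \prod_(j < n) lam j = D.
Proof.
move=> E; pose Z (t : 'I_(n * 2)) := frame_vec t.
have pos := wedge_pow_darboux_pos (omega_mx_anti JJ KK gH gT) frame_darboux.
(* Extended by 0 beyond n, as [prod_block2] asks for nonnegativity at every index. *)
pose mu j := if (j < n)%N then lam j else 0.
have mu0 j : 0 <= mu j by rewrite /mu; case: ltnP => // /lam_pos/ltW.
pose c (t : 'I_(n * 2)) := (Num.sqrt (mu t./2))%:C.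
have sc (f : 'I_2 -> 'I_(n * 2)) : mx_form (omega_mx J K h) (Z \o f) =
    c (f ord0) * c (f ord_max) * mx_form (omega_mx J K g) (Z \o f).
  rewrite /mx_form /= /Z frame_vec_scale -scalemxAl mxE frame_darboux.
  have [->|/darboux_neq0[hf _]] := eqVneq (darboux R (f ord0) (f ord_max)) 0; first by rewrite !mulr0.
  by rewrite /c -hf -rmorphM /= -expr2 sqr_sqrtr // /mu ltn_half.
have := wedge_pow_scale (n := n) id sc.
have -> : Z \o id = Z by [].
rewrite E => /(mulIf (lt0r_neq0 pos)); rewrite -rmorph_prod => /complexI ->.
by rewrite prod_block2 //; apply: eq_bigr => j _; rewrite /mu ltn_ord.
Qed.
End FrameVolume.

(** * The Laplacian on the manifold *)

Section ChangeOfCoordinates.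
Variables (R : realType) (m : nat) (V W : set 'rV[R]_m) (psi : 'rV[R]_m -> 'rV[R]_m).
Hypotheses (oV : open V) (oW : open W) (sp : smooth_mx_on V psi).
Hypothesis VW : forall z, V z -> W (psi z).

Let comp k z := psi z 0 k.

Definition partial_jacobian z : 'M[R]_m := \matrix_(j, k) pderiv j (comp k) z.

Lemma smooth_map_differentiable y : V y -> differentiable psi y.
Proof.
move=> Vy; have -> : psi = \sum_(k < m) (fun z => comp k z *: (delta_mx 0 k : 'rV[R]_m)).
  by apply/funext => z; rewrite fct_sumE {1}[psi z]row_sum_delta.
apply: differentiable_sum => k; apply: differentiableZl.
exact: (smooth_differentiable oV Vy (sp 0 k)).
Qed.

Lemma jacobianE y : V y -> jacobian psi y = partial_jacobian y.
Proof.
move=> Vy; have dp := smooth_map_differentiable Vy.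
apply/row_matrixP => j; rewrite !rowE -(deriveEjacobian _ dp) -rowE.
rewrite derive_mx; last exact: diff_derivable.
by apply/rowP => k; rewrite !mxE pderivE.
Qed.

Lemma pderiv_comp u j y : V y -> smooth_on W u ->
  pderiv j (u \o psi) y = \sum_k pderiv j (comp k) y * pderiv k u (psi y).
Proof.
move=> Vy su; have dp := smooth_map_differentiable Vy.
have du := smooth_differentiable oW (VW Vy) su.
rewrite pderivE deriveE; last exact: differentiable_comp.
rewrite diff_comp //= -[LHS](deriveE _ du) (derive_pderiv _ oW (VW Vy) su).
apply: eq_bigr => k _; congr (_ * _).
by rewrite -deriveE // (deriveEjacobian _ dp) jacobianE // -rowE !mxE.
Qed.

Lemma smooth_comp u : smooth_on W u -> smooth_on V (u \o psi).
Proof.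
move=> su k; elim: k u su => [|k IH] u su.
  split=> // z Vz; apply: continuous_comp; last exact: smooth_continuous su (VW Vz).
  exact/differentiable_continuous/smooth_map_differentiable.
split=> [z Vz|j].
  apply: continuous_comp; last exact: smooth_continuous su (VW Vz).
  exact/differentiable_continuous/smooth_map_differentiable.
split=> [z Vz|].
  apply: diff_derivable; apply: differentiable_comp; first exact: smooth_map_differentiable.
  exact: smooth_differentiable oW (VW Vz) su.
apply: (Ck_eq_on oV (u := fun z => \sum_k pderiv j (comp k) z * (pderiv k u \o psi) z)) => [z Vz|].
  by rewrite -pderivE pderiv_comp.
elim: index_enum => [|l r IHr].
  by apply: (Ck_eq_on oV) (Ck_cst _ _ 0) => z _; rewrite big_nil.
apply: (Ck_eq_on oV) (CkD oV (CkM oV _ (IH _ _)) IHr) => [z _||].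
- by rewrite big_cons.
- exact: (smooth_pderiv j (sp 0 l)).
- exact: smooth_pderiv.
Qed.

Lemma smooth_partial_jacobian : smooth_mx_on V partial_jacobian.
Proof.
move=> j k; apply: (smooth_eq_on oV (u := pderiv j (comp k))) => [z _|]; first by rewrite mxE.
exact/smooth_pderiv/sp.
Qed.

(** The exterior derivative commutes with pullback: the second derivatives of psi form the symmetric
    array [T], which the antisymmetrisation removes. *)
Lemma curl_pullback (b c : 'rV[R]_m -> 'cV[R]_m) y : V y -> smooth_mx_on W b ->
  (forall z, V z -> c z = partial_jacobian z *m b (psi z)) ->
  curl c y = partial_jacobian y *m curl b (psi y) *m (partial_jacobian y)^T.
Proof.
move=> Vy sb cE; rewrite (curl_eq_on oV Vy cE).
pose N : 'M[R]_m := \matrix_(d, k) pdmx d b (psi y) k 0.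
have sbp : smooth_mx_on V (b \o psi) by move=> i j; exact: (smooth_comp (sb i j)).
have [T [TS E]] : exists T : 'I_m -> 'I_m -> R, (forall i j, T i j = T j i) /\
    forall i j, pdmx i (fun z => partial_jacobian z *m b (psi z)) y j 0 =
      T i j + (partial_jacobian y *m N *m (partial_jacobian y)^T) i j.
  exists (fun i j => \sum_k pderiv i (pderiv j (comp k)) y * b (psi y) k 0); split=> i j.
    apply: eq_bigr => k _.
    have -> // : pderiv i (pderiv j (comp k)) y = pderiv j (pderiv i (comp k)) y.
    have sk : smooth_on V (comp k) := sp 0 k.
    exact: (schwarz j i oV Vy sk).
  rewrite (pdmxM oV i Vy smooth_partial_jacobian sbp) mx_addE; congr (_ + _).
    rewrite mxE; apply: eq_bigr => k _; rewrite pdmxE; congr (_ * _).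
    by apply: pderiv_ext => z; rewrite mxE.
  rewrite -mulmxA -[RHS]mx_trE !trmx_mul trmxK -mulmxA mxE [RHS]mxE; apply: eq_bigr => k _.
  congr (_ * _); rewrite pdmxE (pderiv_comp i Vy (sb k 0)) mxE; apply: eq_bigr => d _.
  by rewrite !mxE pdmxE mulrC.
apply/matrixP => i j; rewrite curlE !E (TS i j).
have -> : curl b (psi y) = N - N^T.
  by apply/matrixP => d k; rewrite curlE !mxE.
rewrite mulmxBr mulmxBl mx_addE mx_oppE.
rewrite -[(_ *m N^T *m _) i j]mx_trE !trmx_mul !trmxK mulmxA; lra.
Qed.
End ChangeOfCoordinates.

Lemma posdef_unit (R : realType) m (A : 'M[R]_m) : posdef A -> A \in unitmx.
Proof.
move=> pA; rewrite -row_free_unit -kermx_eq0; apply/eqP/row_matrixP => i; rewrite row0.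
apply/eqP; apply: contraT => /pA; rewrite /qform /bform.
have -> : row i (kermx A) *m A = 0 by rewrite -row_mul mulmx_ker row0.
by rewrite mul0mx mxE ltxx.
Qed.

Lemma trace_congruence (R : realType) m (P A B : 'M[R]_m) : P *m A *m P^T \in unitmx ->
  \tr (invmx (P *m A *m P^T) *m (P *m B *m P^T)) = \tr (invmx A *m B).
Proof.
move=> u; have := u; rewrite !unitmx_mul => /andP[/andP[uP uA] _].
set X := invmx _.
have -> : invmx A = P^T *m X *m P.
  have E : A *m (P^T *m X *m P) = 1%:M.
    rewrite -[A]mul1mx -(mulVmx uP) -!mulmxA [A *m _]mulmxA [P *m _]mulmxA [P *m _ *m _]mulmxA.
    by rewrite [P *m (A *m P^T)]mulmxA mulmxV // mul1mx mulVmx.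
  by rewrite -[RHS]mul1mx -(mulVmx uA) -[RHS]mulmxA E mulmx1.
rewrite !mulmxA [LHS]mxtrace_mulC !mulmxA //.
Qed.

Section Charts.
Variables (R : realType) (m : nat) (M : manifold R m) (I J K g : matrix_field M).
Hypotheses (hc : hypercomplex I J K) (rm : riemannian g) (hh : hyperhermitian I J K g)
  (hkl : hyperkahler I J K g).
Local Open Scope complex_scope.

Lemma chart_coord_im (a : chart M) x : dom a x -> chart_im a (chart_coord a x).
Proof. by move=> ax; exists x. Qed.

Lemma chart_metric_posdef a y : chart_im a y -> posdef (g a y).
Proof. by case: rm => _ _ pos ay X X0; exact: pos. Qed.

Lemma hyperkahler_in_chart a : hyperkahler_chart (chart_im a) (g a) (I a) (J a) (K a).
Proof.
have [[[sI _] II _] [[sJ _] JJ _] [[sK _] KK _] IJK] := hc.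
have [[sg _] gs _] := rm; have [gI gJ gK] := hh; have [dI dJ dK] := hkl.
have oU : open (chart_im a) := @chart_im_open R m M a.
have ke (L : matrix_field M) : smooth_field L ->
    (forall a y, chart_im a y -> L a y *m L a y = - 1%:M) -> hermitian_metric L g ->
    closed_form (fund_form L g) -> kahler_endo (chart_im a) (g a) (L a).
  move=> sL LL gL dL; split.
  - exact: sL.
  - by move=> y Uy; exact: LL.
  - by move=> y Uy; exact: gL.
  move=> y Uy; apply: (closed_cyclic oU Uy).
  - exact: (smooth_mxM oU (sL a) (sg a)).
  - by move=> z Uz; rewrite trmx_mul (gs a z Uz) (hermitian_tr (LL a z Uz) (gL a z Uz)).
  by move=> X; exact: dL.
split.
- exact: oU.
- exact: sg.
- by move=> y Uy; exact: gs.
- by move=> y Uy; exact/posdef_unit/chart_metric_posdef.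
- exact: ke.
- exact: ke.
- exact: ke.
move=> y Uy; have := congr1 (mulmx^~ (K a y)) (IJK a y Uy).
by rewrite /= -mulmxA KK // mulmxN mulmx1 mulNmx mul1mx => /oppr_inj.
Qed.

Definition chart_laplacian (a : chart M) (u : M -> R) y : R :=
  \tr (invmx (g a y) *m hess (g a) (u \o param a) y).

Lemma metric_inv_invariant a y : chart_im a y ->
  quat_invariant (I a y) (J a y) (K a y) (invmx (g a y)).
Proof. by move=> Uy; exact: (metric_invariant (hyperkahler_in_chart a) Uy). Qed.

(** (S I^T - I S) I^T = - (S + I S I^T), and both terms have the same trace against g^-1. The right
    side transforms with the Jacobian only, which yields independence of the chart. *)
Lemma laplacian_curl a u y : chart_im a y -> smooth_fun u -> chart_laplacian a u y =
  - 2^-1 * \tr (invmx (g a y) *m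
     (curl (fun z => I a z *m gradient (u \o param a) z) y *m (I a y)^T)).
Proof.
move=> Uy su; have hk := hyperkahler_in_chart a.
have [oU sg gs gu kI kJ kK IJ] := hk.
have nI k : nabla_endo (g a) k (I a) y = 0 by have [] := hyperkahler_parallel k hk Uy.
rewrite (curl_endo_gradient oU gs (su a) (ke_smooth kI) Uy nI).
have [GI _ _] := metric_inv_invariant Uy.
set S := hess _ _ _.
have II := ke_sqr kI Uy.
have -> : (S *m (I a y)^T - I a y *m S) *m (I a y)^T = - (S + I a y *m S *m (I a y)^T).
  rewrite mulmxBl -[S *m _ *m _]mulmxA -trmx_mul II trmxN trmx1 mulmxN mulmx1; mx_lra.
set T := I a y *m S *m (I a y)^T.
have -> : invmx (g a y) *m - (S + T) = - (invmx (g a y) *m S + invmx (g a y) *m T).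
  by rewrite mulmxN mulmxDr.
rewrite raddfN raddfD /=.
have -> : \tr (invmx (g a y) *m T) = \tr (invmx (g a y) *m S).
  by rewrite /T !mulmxA mxtrace_mulC !mulmxA GI.
by rewrite /chart_laplacian -/S; lra.
Qed.

Lemma transition_open (a b : chart M) : open (chart_coord a @` (dom a `&` dom b)).
Proof.
rewrite openE => _ [x [ax bx] <-].
have ay := chart_coord_im ax.
have n1 : nbhs (chart_coord a x) (chart_im a) by apply: open_nbhs_nbhs; split=> //; exact: chart_im_open.
have n2 : nbhs (chart_coord a x) (param a @^-1` dom b).
  apply: (param_continuous ay); rewrite chart_coordK //.
  by apply: open_nbhs_nbhs; split=> //; exact: dom_open.
apply: filterS (filterI n1 n2) => _ [[z az <-]] /=; rewrite chart_coordK // => bz.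
by exists z.
Qed.

Lemma chart_laplacian_invariant a b u x : dom a x -> dom b x -> smooth_fun u ->
  chart_laplacian a u (chart_coord a x) = chart_laplacian b u (chart_coord b x).
Proof.
move=> ax bx su.
have [ay cy] := (chart_coord_im ax, chart_coord_im bx).
rewrite (laplacian_curl ay su) (laplacian_curl cy su); congr (_ * _).
pose psi := chart_coord b \o param a.
pose V := chart_coord a @` (dom a `&` dom b).
have oV : open V := @transition_open a b.
have oW : open (chart_im b) := @chart_im_open R m M b.
have sp : smooth_mx_on V psi := transition_smooth a b.
have VW z : V z -> chart_im b (psi z).
  by move=> [x' [ax' bx'] <-]; exists x' => //; rewrite /psi /= chart_coordK.
have Vy : V (chart_coord a x) by exists x.
have py : psi (chart_coord a x) = chart_coord b x by rewrite /psi /= chart_coordK.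
have jac z : dom a z -> dom b z -> transition_jacobian a b z = partial_jacobian psi (chart_coord a z).
  by move=> az bz; apply: (jacobianE oV sp); exists z.
have hk := hyperkahler_in_chart b; have [_ _ _ _ kI _ _ _] := hk.
have [[[sI tI] _ _] _ _ _] := hc; have [[_ tg] _ _] := rm.
pose P := partial_jacobian psi (chart_coord a x).
have -> : curl (fun z => I a z *m gradient (u \o param a) z) (chart_coord a x) =
    P *m curl (fun z => I b z *m gradient (u \o param b) z) (chart_coord b x) *m P^T.
  rewrite -py; apply: (curl_pullback oV oW sp VW Vy).
    exact: (smooth_mxM oW (ke_smooth kI) (smooth_gradient oW (su b))).
  move=> z Vz; have [x' [ax' bx'] xz] := Vz.
  have -> : gradient (u \o param a) z = partial_jacobian psi z *m gradient (u \o param b) (psi z).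
    apply/colP => j; rewrite [LHS]mxE (pderiv_eq_on (v := (u \o param b) \o psi) j oV Vz); last first.
      by move=> _ [w [aw bw] <-]; rewrite /psi /= chart_coordK // chart_coordK.
    rewrite (pderiv_comp oV oW sp VW j Vz (su b)) mxE; apply: eq_bigr => k _.
    by rewrite !mxE.
  rewrite !mulmxA -xz -(jac _ ax' bx') tI // /psi /= chart_coordK //.
have tIx := tI a b x ax bx; rewrite (jac _ ax bx) -/P in tIx.
have tgx := tg a b x ax bx; rewrite (jac _ ax bx) -/P in tgx.
have := posdef_unit (chart_metric_posdef ay); rewrite tgx => ug.
set D := curl _ _.
have -> : P *m D *m P^T *m (I a (chart_coord a x))^T = P *m (D *m (I b (chart_coord b x))^T) *m P^T.
  by rewrite -[LHS]mulmxA -trmx_mul tIx trmx_mul !mulmxA.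
by rewrite (trace_congruence _ ug).
Qed.

End Charts.

(** * The a priori estimate *)

Lemma continuous_compact_bounded (R : realType) (T : topologicalType) (w : T -> R) :
  compact [set: T] -> continuous w -> exists c, forall x, w x <= c.
Proof.
move=> cT cw; have [[x0 _]|T0] := pselect (exists x : T, True); last first.
  by exists 0 => x; case: T0; exists x.
have [||z _ zmax] := compact_EVT_max (f := w) (A := [set: T]) _ cT.
- by exists x0.
- by apply: continuous_subspaceT.
by exists (w z) => x; apply: zmax; rewrite inE.
Qed.

Lemma hessB (R : realType) m (U : set 'rV[R]_m) g (u v : 'rV[R]_m -> R) y :
  open U -> U y -> smooth_on U u -> smooth_on U v ->
  hess g (fun z => u z - v z) y = hess g u y - hess g v y.
Proof.
move=> oU Uy su sv; apply/matrixP => k i; rewrite mx_addE mx_oppE !hessE.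
have D j z : U z -> pderiv j (fun z => u z - v z) z = pderiv j u z - pderiv j v z.
  by move=> Uz; exact: (pderivB j Uz su sv).
rewrite (pderiv_eq_on k oU Uy (D i)) (pderivB k Uy (smooth_pderiv i su) (smooth_pderiv i sv)).
under eq_bigr do rewrite D // mulrBr.
have aux (a b c d : R) : a - b - (c - d) = a - c - (b - d) by lra.
by rewrite sumrB aux.
Qed.

(** At a maximum the gradient vanishes, so the Christoffel terms disappear and the coordinate second
    derivatives decide. *)
Lemma trace_hess_max (R : realType) m (U : set 'rV[R]_m) g (q : 'rV[R]_m -> R) (C : 'M[R]_m) y :
  open U -> U y -> smooth_on U q -> (forall z, U z -> q z <= q y) ->
  \tr (C^T *m C *m hess g q y) <= 0.
Proof.
move=> oU Uy sq qmax.
have -> : \tr (C^T *m C *m hess g q y) = \tr (C *m hess g q y *m C^T).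
  by rewrite -mulmxA mxtrace_mulC.
apply: sumr_le0 => r _.
have -> : (C *m hess g q y *m C^T) r r =
    \sum_l \sum_k (row r C) 0 l * (row r C) 0 k * pderiv l (pderiv k q) y.
  have -> : (C *m hess g q y *m C^T) r r = bform (hess g q y) (row r C) (row r C).
    by rewrite /bform tr_row -row_mul !mxE; apply: eq_bigr => k _; rewrite !mxE.
  rewrite /bform bilinearE; apply: eq_bigr => l _; apply: eq_bigr => k _.
  rewrite hessE big1 ?subr0 // => p _.
  by rewrite (max_pderiv_eq0 oU Uy sq qmax) mulr0.
exact: (max_second_deriv_le0 oU Uy sq qmax).
Qed.

Section Estimate.
Variables (R : realType) (n m : nat) (mE : m = (4 * n)%N) (M : manifold R m).
Variables (I J K g : matrix_field M).
Hypotheses (hc : hypercomplex I J K) (rm : riemannian g) (hh : hyperhermitian I J K g)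
  (hkl : hyperkahler I J K g).
Local Open Scope complex_scope.

Let hk a := hyperkahler_in_chart hc rm hh hkl a.

Lemma continuous_from_charts (w : M -> R) (W : chart M -> 'rV[R]_m -> R) :
  (forall a, smooth_on (chart_im a) (W a)) ->
  (forall a x, dom a x -> w x = W a (chart_coord a x)) -> continuous w.
Proof.
move=> sW wW x; have [a ax] := dom_cover x.
have cW : {for x, continuous (W a \o chart_coord a)}.
  apply: continuous_comp; first exact: chart_coord_continuous.
  exact: smooth_continuous (sW a) (chart_coord_im ax).
rewrite /prop_for /continuous_at (wW a x ax); apply: cvg_trans cW; apply: near_eq_cvg.
have : nbhs x (dom a) by apply: open_nbhs_nbhs; split=> //; exact: dom_open.
by apply: filterS => z az /=; rewrite (wW a z az).
Qed.

Lemma smooth_fun_continuous (u : M -> R) : smooth_fun u -> continuous u.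
Proof.
move=> su; apply: (continuous_from_charts su) => a x ax.
by rewrite /= chart_coordK.
Qed.

Lemma smooth_chart_laplacian a u : smooth_fun u -> smooth_on (chart_im a) (chart_laplacian g a u).
Proof.
move=> su; have [oU sg gs gu _ _ _ _] := hk a.
exact: (smooth_trace oU (smooth_mxM oU (smooth_invmx oU gu sg) (smooth_hess oU sg gu (su a)))).
Qed.

(** Evaluated in an arbitrarily chosen chart at each point; [laplacianE] makes the choice immaterial
    for smooth functions. *)
Definition laplacian (u : M -> R) (x : M) : R :=
  let a := projT1 (cid (dom_cover x)) in chart_laplacian g a u (chart_coord a x).

Lemma laplacianE a u x : dom a x -> smooth_fun u ->
  laplacian u x = chart_laplacian g a u (chart_coord a x).
Proof.
move=> ax su; rewrite /laplacian; case: (cid _) => b bx /=.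
exact: (chart_laplacian_invariant hc rm hh hkl).
Qed.

Lemma laplacian_continuous u : smooth_fun u -> continuous (laplacian u).
Proof.
move=> su; apply: (continuous_from_charts (W := fun a => chart_laplacian g a u)) => [a|a x ax].
  exact: smooth_chart_laplacian.
exact: laplacianE.
Qed.

Definition hessian_avg (phi : M -> R) a y : 'M[R]_m :=
  quat_avg (I a y) (J a y) (K a y) (hess (g a) (phi \o param a) y).

Lemma hessian_form_omega phi a y : smooth_fun phi -> chart_im a y ->
  hessian_form I J phi a y = mx_form (omega_mx (J a y) (K a y) (hessian_avg phi a y)).
Proof. by move=> sphi Uy; apply/funext => X; exact: (del_del_J_hess (hk a) (sphi a) X Uy). Qed.

Lemma Omega_omega a y : Omega J K g a y = mx_form (omega_mx (J a y) (K a y) (g a y)).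
Proof.
apply/funext => X; rewrite /Omega /fund_form /mx_form !cmx_real /omega_mx.
have -> : cmx (J a y *m g a y) (- (K a y *m g a y)) =
    cmx (J a y *m g a y) 0 - 'i%C *: cmx (K a y *m g a y) 0.
  by rewrite cmxZi cmxN cmxD; congr cmx; mx_lra.
by rewrite mulmxBr mulmxBl -scalemxAr -scalemxAl !mxE.
Qed.

Lemma perturbed_form_omega phi a y : smooth_fun phi -> chart_im a y ->
  perturbed_form I J K g phi a y =
  mx_form (omega_mx (J a y) (K a y) (g a y + hessian_avg phi a y)).
Proof.
move=> sphi Uy; apply/funext => X.
rewrite /perturbed_form hessian_form_omega // Omega_omega omega_mxD.
by rewrite /mx_form mulmxDr mulmxDl [RHS]mxE.
Qed.

Variables (f phi : M -> R).
Hypotheses (sf : smooth_fun f) (sphi : smooth_fun phi).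
Hypothesis MA : quaternionic_MA n I J K g f phi.

Let h a y := g a y + hessian_avg phi a y.

(** The two halves of the equation meet here: positivity of the form makes h positive definite, and
    the n-th power fixes the product of the eigenvalues. *)
Lemma perturbed_frame a y : chart_im a y -> posdef (h a y) /\
  exists e lam, [/\ quat_frame (I a y) (J a y) (K a y) (g a y) (h a y) n e lam,
    forall j, (j < n)%N -> 0 < lam j & \prod_(j < n) lam j = expR (f (param a y))].
Proof.
move=> Uy; have [II JJ KK] := sqr_endo (hk a) Uy; have IJ := hk_IJ (hk a) Uy.
have gH := metric_hermitian (hk a) Uy.
have hH : quat_hermitian (I a y) (J a y) (K a y) (h a y).
  by apply: quat_hermitianD => //; exact: quat_avg_hermitian.
have gT := hk_sym (hk a) Uy.
have hT := perturbed_sym (hk a) (sphi a) Uy.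
have [vol pos] := MA Uy; rewrite (perturbed_form_omega sphi Uy) in vol pos.
have hp := positive20_posdef II JJ KK IJ hH pos.
split=> //.
have gp := chart_metric_posdef rm Uy.
have mn : (4 * n <= m)%N by rewrite mE.
have [e [lam F]] := quat_frame_exists II JJ KK IJ gT hT gp gH hH mn.
have lp := frame_pos hp F.
exists e, lam; split=> //.
apply: (frame_volume II JJ KK IJ gT gH hH F lp) => X.
by rewrite vol Omega_omega.
Qed.

Lemma laplacian_trace a y : chart_im a y ->
  chart_laplacian g a phi y = \tr (invmx (g a y) *m h a y) - m%:R.
Proof.
move=> Uy; rewrite /chart_laplacian /h mulmxDr mulVmx ?mxtraceD ?mxtrace1; last exact: (hk_unit (hk a)).
rewrite /hessian_avg trace_quat_avg; last exact: (metric_inv_invariant hc rm hh hkl Uy).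
by rewrite addrC addKr.
Qed.

Lemma laplacian_bound_at_max (F L : R) x0 : (forall x, f x <= F) ->
  (forall x, - laplacian f x <= L) -> 0 <= L ->
  (forall x, laplacian phi x - phi x <= laplacian phi x0 - phi x0) ->
  laplacian phi x0 <= m%:R * (expR F * (1 + n%:R + L) ^+ n).
Proof.
move=> fF fL L0 xmax; have [a ax] := dom_cover x0.
pose y := chart_coord a x0; have Uy : chart_im a y := chart_coord_im ax.
pose v := chart_laplacian g a phi.
pose q z := v z - (phi \o param a) z.
have [oU sg gs gu _ _ _ _] := hk a.
have sv : smooth_on (chart_im a) v := smooth_chart_laplacian a sphi.
have sq : smooth_on (chart_im a) q := smoothB oU sv (sphi a).
have qE x : dom a x -> q (chart_coord a x) = laplacian phi x - phi x.
  by move=> xa; rewrite /q /= chart_coordK // (laplacianE xa sphi).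
have qmax z : chart_im a z -> q z <= q y by move=> [x xa <-]; rewrite !qE.
have [hp [e [lam [Fr lp vol]]]] := perturbed_frame Uy.
have [II JJ KK] := sqr_endo (hk a) Uy.
have gH := metric_hermitian (hk a) Uy.
have hH : quat_hermitian (I a y) (J a y) (K a y) (h a y).
  by apply: quat_hermitianD => //; apply: quat_avg_hermitian => //; exact: (hk_IJ (hk a)).
have hu z : chart_im a z -> h a z \in unitmx by move=> /perturbed_frame[/posdef_unit].
have dets z : chart_im a z -> \det (h a z) = expR (4 * (f \o param a) z) * \det (g a z).
  move=> Uz; have [hpz [ez [lz [Fz _ volz]]]] := perturbed_frame Uz.
  have [IIz JJz KKz] := sqr_endo (hk a) Uz.
  rewrite (frame_det mE IIz JJz KKz (metric_hermitian (hk a) Uz) _ Fz); last first.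
    by apply: quat_hermitianD; [exact: (metric_hermitian (hk a))|
      apply: quat_avg_hermitian => //; exact: (hk_IJ (hk a))].
  by rewrite volz -expRM_natl.
pose B := frame_mx (I a y) (J a y) (K a y) e.
pose C := perturbed_frame_mx (I a y) (J a y) (K a y) e lam.
have GB : invmx (g a y) = B^T *m B := frame_inv_metric mE Fr.
have [_ PC] := frame_inv_form mE II JJ KK hp gH hH Fr; rewrite -/C in PC.
have boch := bochner_inequality (hk a) (sphi a) (sf a) hu dets Uy GB PC.
have := trace_hess_max (g a) C oU Uy sq qmax; rewrite -PC (hessB (g a) oU Uy sv (sphi a)).
have Pinv : quat_invariant (I a y) (J a y) (K a y) (invmx (h a y)).
  by apply: quat_invariant_inv => //; exact: hu.
rewrite mulmxBr raddfB /= -(trace_quat_avg (hess (g a) (phi \o param a) y) Pinv) -/(hessian_avg phi a y).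
have -> : hessian_avg phi a y = h a y - g a y by rewrite /h addrAC subrr add0r.
rewrite mulmxBr mulVmx ?hu // raddfB /= mxtrace1 (frame_trace_form mE II JJ KK hp gH hH Fr).
rewrite (laplacianE ax sphi) (laplacian_trace Uy) (frame_trace_metric mE II JJ KK gH hH Fr).
have lf := fL x0; rewrite (laplacianE ax sf) -/y /chart_laplacian in lf.
move=> low.
have mn : m%:R = 4 * n%:R :> R by rewrite mE natrM.
(* The two inequalities combine to 4 \Delta f <= tr(h^-1 \nabla^2 phi) = 4n - 4 \sum 1 / lam_j, so
   the sum is at most n + L; the extra 1 provides the lower bound on c in [eigenvalue_bound]. *)
have inv : \sum_(j < n) (lam j)^-1 <= 1 + n%:R + L.
  rewrite mn in low; rewrite -/v in boch; lra.
have n0 : 0 <= n%:R :> R by rewrite ler0n.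
have c1 : 1 <= 1 + n%:R + L :> R by lra.
have volF : \prod_(j < n) lam j <= expR F by rewrite vol ler_expR.
have lb := eigenvalue_bound lp volF c1 inv.
have sumb : \sum_(j < n) lam j <= n%:R * (expR F * (1 + n%:R + L) ^+ n).
  have -> : n%:R * (expR F * (1 + n%:R + L) ^+ n) = \sum_(j < n) (expR F * (1 + n%:R + L) ^+ n).
    by rewrite sumr_const card_ord mulr_natl.
  by apply: ler_sum => j _; exact: lb.
rewrite mn -mulrA; lra.
Qed.

Lemma form_norm_bound a y (V : R) : chart_im a y -> chart_laplacian g a phi y <= V -> 0 <= V ->
  form_norm (g a y) (hessian_form I J phi a y) <= Num.sqrt (m%:R * (V + n%:R + 1) ^+ 2).
Proof.
move=> Uy lV V0; have [hp [e [lam [Fr lp vol]]]] := perturbed_frame Uy.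
have [II JJ KK] := sqr_endo (hk a) Uy.
have gH := metric_hermitian (hk a) Uy.
have hH : quat_hermitian (I a y) (J a y) (K a y) (h a y).
  by apply: quat_hermitianD => //; apply: quat_avg_hermitian => //; exact: (hk_IJ (hk a)).
have gT := hk_sym (hk a) Uy.
have hE : hessian_avg phi a y = h a y - g a y by rewrite /h addrAC subrr add0r.
have hT := perturbed_sym (hk a) (sphi a) Uy.
rewrite (hessian_form_omega sphi Uy) (form_norm_omega (metric_inv_invariant hc rm hh hkl Uy)); first last.
- by rewrite hE trmxD trmxN gT hT.
- by rewrite trmx_inv gT.
rewrite hE (frame_trace_sqr mE II JJ KK gH hH Fr) ler_wsqrtr //.
have mn : m%:R = 4 * n%:R :> R by rewrite mE natrM.
rewrite mn -mulrA ler_pM2l; last lra.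
have -> : n%:R * (V + n%:R + 1) ^+ 2 = \sum_(j < n) (V + n%:R + 1) ^+ 2 :> R.
  by rewrite sumr_const card_ord mulr_natl.
apply: ler_sum => j _.
(* The Laplacian is 4 \sum lam_j - 4n, and one eigenvalue is at most the sum of all since they are
   positive. *)
have lj : lam j <= V + n%:R.
  have := lV; rewrite (laplacian_trace Uy) (frame_trace_metric mE II JJ KK gH hH Fr) mn => H.
  apply: le_trans (_ : \sum_(j < n) lam j <= _); last lra.
  rewrite (bigD1 j) //= lerDl; apply: sumr_ge0 => i _; exact/ltW/lp.
have l0 := lp j (ltn_ord j); have n0 : 0 <= n%:R :> R by rewrite ler0n.
by nra.
Qed.

End Estimate.

Theorem theorem4p1 (R : realType) (n : nat) (M : manifold R (4 * n))
    (I J K g : matrix_field M) (f : M -> R) :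
  compact [set: M] -> connected [set: M] ->
  hypercomplex I J K -> riemannian g -> hyperhermitian I J K g ->
  hyperkahler I J K g ->
  smooth_fun f ->
  forall B : R, 0 <= B ->
  exists C : R, forall phi : M -> R,
    smooth_fun phi ->
    sup [set `|phi x| | x in [set: M]] = B ->
    quaternionic_MA n I J K g f phi ->
    forall (a : chart M) (y : 'rV[R]_(4 * n)), chart_im a y ->
      form_norm (g a y) (hessian_form I J phi a y) <= C.
Proof.
move=> cM _ hc rm hh hkl sf B B0.
have [F fF] := continuous_compact_bounded cM (smooth_fun_continuous sf).
have cl u : smooth_fun u -> continuous (laplacian g u) by exact: laplacian_continuous hc rm hh hkl u.
have [L' fL'] : exists L, forall x, - laplacian g f x <= L.
  by apply: (continuous_compact_bounded cM) => x; apply: continuousN; exact: cl.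
(* Nonnegativity of [L] guarantees 1 <= 1 + n + L. *)
pose L := Num.max L' 0.
have L0 : 0 <= L by rewrite le_max lexx orbT.
have fL x : - laplacian g f x <= L by rewrite le_max fL'.
(* The bound on v at the maximum of v - phi, plus 2 B for the difference of the values of phi at two
   points. *)
pose V := (4 * n)%:R * (expR F * (1 + n%:R + L) ^+ n) + (B + B).
exists (Num.sqrt ((4 * n)%:R * (V + n%:R + 1) ^+ 2)) => phi sphi supB MA a y Uy.
have phiB x : `|phi x| <= B.
  rewrite -supB; apply: ub_le_sup; last by exists x.
  (* [sup] dominates its set only when the set is bounded, which compactness provides; this [c]
     depends on phi but does not enter the constant. *)
  have [c cB] : exists c, forall x, `|phi x| <= c.
    apply: (continuous_compact_bounded cM) => z; apply: continuous_comp; last exact: norm_continuous.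
    exact: smooth_fun_continuous.
  by exists c => _ [z _ <-].
have V0 : 0 <= V.
  rewrite addr_ge0 ?addr_ge0 // mulr_ge0 ?ler0n // mulr_ge0 ?expR_ge0 // exprn_ge0 //.
  by rewrite !addr_ge0.
apply: (form_norm_bound erefl hc rm hh hkl sphi MA Uy) => //.
have [x ax <-] := Uy.
have [x0 _ xmax] : exists2 x0, x0 \in [set: M] &
    forall z, z \in [set: M] -> laplacian g phi z - phi z <= laplacian g phi x0 - phi x0.
  apply: compact_EVT_max cM _; first by exists x.
  apply: continuous_subspaceT => z; apply: continuousB; first exact: cl.
  exact: smooth_fun_continuous.
have xm z : laplacian g phi z - phi z <= laplacian g phi x0 - phi x0 by apply: xmax; rewrite inE.
have bound := laplacian_bound_at_max erefl hc rm hh hkl sf sphi MA fF fL L0 xm.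
rewrite -(laplacianE hc rm hh hkl ax sphi).
have := xm x; have := phiB x; have := phiB x0; rewrite !ler_norml => /andP[p1 p2] /andP[p3 p4].
by rewrite /V; lra.
Qed.
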